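(* Let $R=\mathbb{Q}[\log(2),\pi,\zeta(\mathrm{odd}),\beta(\mathrm{even})]$ be the $\mathbb{Q}$-subalgebra of $\mathbb{R}$ generated by $\log 2$, $\pi$, the values $\zeta(2k+1)$ and the values $\beta(2k)$, $k\ge1$. For any integer $m \geq 1$, \begin{align*} S(\overline{2}, \{1\}_{2m}) &\in R + \mathbb{Q} \cdot \zeta(\overline{2m+1}, 1) , \\ S(\overline{2}, \{1\}_{2m-1}, \overline{1}) &\in R + \mathbb{Q} \cdot \zeta(\overline{2m+1}, 1) + \mathbb{Q} \cdot W_{m} , \end{align*} where $$W_m = \sum_{\substack{p + q = 2m+2 \\ p, q \geq 1}} \frac{1}{2^p} \zeta(\overline{p}, q) ,$$ and the sums on the right-hand sides of the membership statements are sums of $\mathbb{Q}$-subspaces of $\mathbb{R}$.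
   Context: $\zeta$ is the Riemann zeta function and $\beta(s)=\sum_{n\ge1}(-1)^{n-1}(2n-1)^{-s}$ is the Dirichlet beta function. For integers $a,b\ge1$, $\zeta(\overline a,b)=\sum_{n>m>0}\frac{(-1)^n}{n^am^b}$ (limit of partial sums over $n\le N$). $\{1\}_n$ denotes $1$ repeated $n$ times. The multiple $S$ values in question are $$S(\overline2,\{1\}_{2m})=2^{2m+1}\sum_{\substack{n_1>n_2>\cdots>n_{2m+1}>0\\ n_1,n_3,\ldots,n_{2m+1}\text{ even}\\ n_2,n_4,\ldots,n_{2m}\text{ odd}}}\frac{(-1)^{n_1/2}}{n_1^2n_2\cdots n_{2m+1}},$$ $$S(\overline2,\{1\}_{2m-1},\overline1)=2^{2m+1}\sum_{\substack{n_1>n_2>\cdots>n_{2m+1}>0\\ n_1,n_3,\ldots,n_{2m+1}\text{ even}\\ n_2,n_4,\ldots,n_{2m}\text{ odd}}}\frac{(-1)^{n_1/2}(-1)^{n_{2m+1}/2}}{n_1^2n_2\cdots n_{2m+1}}.$$ *)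

(* Defs.v *)
From mathcomp Require Import all_boot all_order all_algebra.
From mathcomp Require Import all_classical all_reals all_analysis.
From mathcomp Require Import Rstruct Rstruct_topology.

Set Implicit Arguments.
Unset Strict Implicit.
Unset Printing Implicit Defensive.

Import Order.TTheory GRing.Theory Num.Theory.
Import numFieldNormedType.Exports.

Local Open Scope classical_set_scope.
Local Open Scope ring_scope.

(* Only the values at integers s >= 2 (zeta) and s >= 1 (beta) are meaningful:
   there the series converges to the value of the analytic function. *)
Definition zeta {R : realType} (s : nat) : R :=
  limn (fun N => \sum_(1 <= n < N.+1) (n%:R ^- s : R)).

Definition beta {R : realType} (s : nat) : R :=
  limn (fun N =>
    \sum_(1 <= n < N.+1) ((-1) ^+ n.-1 * (2 * n - 1)%N%:R ^- s : R)).

(* zeta(abar, b), the bar being on the exponent of the larger summation index.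
   The series in n is only conditionally convergent when a = 1. *)
Definition zeta_bar {R : realType} (a b : nat) : R :=
  limn (fun N => \sum_(1 <= n < N.+1) \sum_(1 <= m < n)
                   ((-1) ^+ n / (n%:R ^+ a * m%:R ^+ b) : R)).

(* The tuple n_1 > ... > n_{2m+1} is the function n with n_k = n (k - 1), so
   "n_k even for k odd, n_k odd for k even" reads odd (n i) = odd i. *)
Definition S_index (m N : nat) (n : {ffun 'I_(2 * m).+1 -> 'I_N.+1}) : bool :=
  [&& [forall i, 0 < n i],
      [forall i : 'I_(2 * m).+1, forall j : 'I_(2 * m).+1,
         (i < j) ==> (n j < n i)]
    & [forall i, odd (n i) == odd i]]%N.

(* n_1^2 n_2 ... n_{2m+1} *)
Definition S_denom {R : realType} (m N : nat)
    (n : {ffun 'I_(2 * m).+1 -> 'I_N.+1}) : R :=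
  (n ord0)%:R ^+ 2 * \prod_(i | i != ord0) (n i)%:R.

(* S(2bar, {1}_{2m}), as the limit of the partial sums over n_1 <= N. *)
Definition S_2bar_ones {R : realType} (m : nat) : R :=
  2 ^+ (2 * m).+1 *
  limn (fun N => \sum_(n : {ffun 'I_(2 * m).+1 -> 'I_N.+1} | S_index n)
                   ((-1) ^+ (n ord0)./2 / S_denom n : R)).

(* S(2bar, {1}_{2m-1}, 1bar), as the limit of the partial sums over n_1 <= N. *)
Definition S_2bar_ones_1bar {R : realType} (m : nat) : R :=
  2 ^+ (2 * m).+1 *
  limn (fun N => \sum_(n : {ffun 'I_(2 * m).+1 -> 'I_N.+1} | S_index n)
                   ((-1) ^+ (n ord0)./2 * (-1) ^+ (n ord_max)./2
                      / S_denom n : R)).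

Definition W {R : realType} (m : nat) : R :=
  \sum_(1 <= p < 2 * m + 2) (2 ^- p * zeta_bar p (2 * m + 2 - p)).

Definition Qsubalgebra {R : realType} (A : set R) : Prop :=
  [/\ forall q : rat, A (ratr q),
      forall x y, A x -> A y -> A (x + y)
    & forall x y, A x -> A y -> A (x * y)].

Definition generators {R : realType} : set R :=
  [set ln 2; pi] `|` [set zeta (2 * k + 1) | k in [set k | (1 <= k)%N]]
                 `|` [set beta (2 * k) | k in [set k | (1 <= k)%N]].

Definition Ralg {R : realType} : set R := smallest Qsubalgebra generators.

Definition Qline {R : realType} (x : R) : set R :=
  [set ratr q * x | q in [set: rat]].

Definition sumset {R : realType} (A B : set R) : set R :=
  [set x + y | x in A & y in B].

(* Main.v *)
Require Import Defs.
From mathcomp Require Import all_boot all_order all_algebra.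
From mathcomp Require Import all_classical all_reals all_analysis.
From mathcomp Require Import Rstruct Rstruct_topology.
From mathcomp Require Import ring lra zify.

Set Implicit Arguments.
Unset Strict Implicit.
Unset Printing Implicit Defensive.

Import Order.TTheory GRing.Theory Num.Theory.
Import numFieldNormedType.Exports.

Local Open Scope classical_set_scope.
Local Open Scope ring_scope.

(* Substituting x = i tan t turns the generating series of the nested sums into
   iterated integrals of log cos t (and of log cos 2t for the variant with a
   final bar), so that, up to a power of 2, each S value is the integral over
   [0, pi/4] of such an iterated integral against 2 dt / sin 2t.  Expanding it
   in a Fourier series, whose k-th coefficient decays like k^-(2m+1), and
   integrating (cos 2kt - 1) / sin 2t, which gives partial harmonic sums, leaves
   - the moments of t^(2i) / sin 2t, which repeated integration by parts reduces
     to pi, beta(even) and zeta(odd);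
   - double sums of u(n) v(l) / (n^(2m+1) l) over n > l, with u, v of period
     dividing 4.
   For the latter, Euler's argument (multiply two single series and sum the
   resulting geometric progression by partial fractions) gives one linear
   relation modulo products of single values for each pair of periodic
   functions.  These relations reduce every double sum that occurs to
   zeta(2m+1 bar, 1) and one further sum, which the same partial fractions
   express through W_m. *)

(** * Calculus and sequences *)

Section Calculus.
Context {R : realType}.
Implicit Types (f g : R -> R) (x y c : R).

(** Integrals appear as primitives vanishing at 0 and are compared through their derivatives by the
    mean value theorem ([der_bound]); a Lebesgue integral is needed only to obtain primitives of
    t^(2i) / sin 2t. The two S values are treated together: [e] is the sign on the innermost index
    and [c] switches on the log cos 2t part, with [triv] and 0 in one case, [sg] and 1 in the other.
    The obstacle is the endpoint. The value pi/4 corresponds to tan t = 1, the boundary of the disc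
    of convergence, where geometric estimates no longer compare truncated power series with
    truncated Fourier series. They are compared on [0, b] for b < pi/4; both sides are uniformly
    Cauchy on [0, pi/4], which carries the limit to pi/4. Euler's relations contain divergent
    harmonic sums, and zeta(1bar, 2m+1) inside W_m converges only conditionally. Hence relations are
    written between sequences of partial sums ([limin]): only the combination has to converge, and
    convergence of zeta(1bar, 2m+1) comes out of the relation that contains it. *)

Lemma der_eq f x a b : is_derive x 1 f a -> a = b -> is_derive x 1 f b.
Proof. by move=> h <-. Qed.

Lemma der_cst c x : is_derive x 1 (fun=> c : R) 0.
Proof. exact: is_derive_cst. Qed.

Lemma der_id x : is_derive x 1 (fun t => t) (1 : R).
Proof. exact: is_derive_id. Qed.

Lemma derD f g x a b : is_derive x 1 f a -> is_derive x 1 g b ->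
  is_derive x 1 (fun t => f t + g t) (a + b).
Proof. exact: is_deriveD. Qed.

Lemma derN f x a : is_derive x 1 f a -> is_derive x 1 (fun t => - f t) (- a).
Proof. exact: is_deriveN. Qed.

Lemma derB f g x a b : is_derive x 1 f a -> is_derive x 1 g b ->
  is_derive x 1 (fun t => f t - g t) (a - b).
Proof. exact: is_deriveB. Qed.

Lemma derM f g x a b : is_derive x 1 f a -> is_derive x 1 g b ->
  is_derive x 1 (fun t => f t * g t) (f x * b + g x * a).
Proof. exact: is_deriveM. Qed.

Lemma derZ c f x a : is_derive x 1 f a -> is_derive x 1 (fun t => c * f t) (c * a).
Proof. exact: is_deriveZ. Qed.

Lemma derX f n x a : is_derive x 1 f a ->
  is_derive x 1 (fun t => f t ^+ n) (n%:R * f x ^+ n.-1 * a).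
Proof.
move=> df; elim: n => [|n IH].
  by rewrite !mul0r; apply: der_cst.
apply: (der_eq (f := fun t => f t ^+ n.+1) (a := f x * (n%:R * f x ^+ n.-1 * a) + f x ^+ n * a)).
  have -> : (fun t => f t ^+ n.+1) = (fun t => f t * f t ^+ n).
    by apply/funext => t; rewrite exprS.
  exact: derM df IH.
case: n {IH} => [|n]; first by rewrite /=; ring.
by rewrite /= exprS (natrD _ 1 n.+1); ring.
Qed.

Lemma derV f x a : f x != 0 -> is_derive x 1 f a ->
  is_derive x 1 (fun t => (f t)^-1) (- (f x) ^- 2 * a).
Proof. exact: is_deriveV. Qed.

Lemma der_comp f g x a b : is_derive (g x) 1 f a -> is_derive x 1 g b ->
  is_derive x 1 (fun t => f (g t)) (a * b).
Proof. exact: is_derive1_comp. Qed.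

Lemma der_sum (r : seq nat) (P : pred nat) (F : nat -> R -> R) (dF : nat -> R) x :
  (forall k, P k -> is_derive x 1 (F k) (dF k)) ->
  is_derive x 1 (fun t => \sum_(k <- r | P k) F k t) (\sum_(k <- r | P k) dF k).
Proof.
move=> h; elim: r => [|k r IH].
  rewrite big_nil; have -> : (fun t => \sum_(k <- [::] | P k) F k t) = (fun=> 0).
    by apply/funext => t; rewrite big_nil.
  exact: der_cst.
have -> : (fun t => \sum_(j <- k :: r | P j) F j t) =
  (fun t => (if P k then F k t else 0) + \sum_(j <- r | P j) F j t).
  by apply/funext => t; rewrite big_cons; case: ifP; rewrite ?add0r.
rewrite big_cons; case: ifP => [Pk|_]; first exact: (derD (h _ Pk) IH).
by apply: (der_eq (derD (der_cst 0 x) IH)); rewrite add0r.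
Qed.

Lemma der_sum_nat (m n : nat) (F : nat -> R -> R) (dF : nat -> R) x :
  (forall k, (m <= k < n)%N -> is_derive x 1 (F k) (dF k)) ->
  is_derive x 1 (fun t => \sum_(m <= k < n) F k t) (\sum_(m <= k < n) dF k).
Proof.
move=> h; rewrite big_nat.
have -> : (fun t => \sum_(m <= k < n) F k t) =
    (fun t => \sum_(m <= k < n | (m <= k < n)%N) F k t).
  by apply/funext => t; rewrite big_nat.
exact: der_sum.
Qed.

Lemma der_cosZ c x : is_derive x 1 (fun t => cos (c * t)) (- c * sin (c * x)).
Proof.
apply: (der_eq (der_comp (is_derive_cos _) (derZ c (der_id x)))).
by rewrite mulr1 mulrC mulrN mulNr.
Qed.

Lemma der_sinZ c x : is_derive x 1 (fun t => sin (c * t)) (c * cos (c * x)).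
Proof.
apply: (der_eq (der_comp (is_derive_sin _) (derZ c (der_id x)))).
by rewrite mulr1 mulrC.
Qed.

Lemma der_tan x : cos x != 0 -> is_derive x 1 tan (1 + tan x ^+ 2).
Proof. by move=> h; rewrite -cos2_tan2 //; exact: is_derive_tan. Qed.

Lemma der_continuous f x a : is_derive x 1 f a -> {for x, continuous f}.
Proof.
move=> h; apply/differentiable_continuous/derivable1_diffP.
by case: h.
Qed.

Lemma der_within f (f' : R -> R) (a b : R) :
  (forall x, a <= x <= b -> is_derive x 1 f (f' x)) ->
  {within `[a, b], continuous f}.
Proof.
move=> h; apply: derivable_within_continuous => x; rewrite in_itv /= => /h [].
by [].
Qed.

(** The mean value theorem for g - s f with s = 1 and s = -1. Derivatives are asked for on the open
    interval only, because the primitives obtained from a Lebesgue integral are differentiated only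
    there. *)
Lemma der_bound f g (f' g' : R -> R) (b : R) :
  (forall x, 0 < x < b -> is_derive x 1 f (f' x)) ->
  (forall x, 0 < x < b -> is_derive x 1 g (g' x)) ->
  {within `[0, b], continuous f} -> {within `[0, b], continuous g} ->
  (forall x, 0 < x < b -> `|f' x| <= g' x) ->
  `|f 0| <= g 0 ->
  forall x, 0 <= x <= b -> `|f x| <= g x.
Proof.
move=> df dg cf cg hfg h0 x /andP[x0 xb].
have sub : `[0, x]%classic `<=` `[0, b]%classic.
  by move=> t /=; rewrite !in_itv /= => /andP[-> h]; exact: le_trans xb.
have cf' := continuous_subspaceW sub cf.
have cg' := continuous_subspaceW sub cg.
have lt_b t : t \in `]0, x[ -> 0 < t < b.
  by rewrite in_itv /= => /andP[-> h]; exact: lt_le_trans xb.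
have key (s : R) : `|s| = 1 -> s * f x - g x <= s * f 0 - g 0.
  move=> s1; have [->|x1] := eqVneq x 0; first by [].
  case: (@MVT R (fun t => g t - s * f t) (fun t => g' t - s * f' t) 0 x).
  - by rewrite lt_neqAle eq_sym x1.
  - by move=> t /lt_b tb; apply: derB; [exact: dg|apply: derZ; exact: df].
  - move=> t; apply: cvgB; first exact: cg'.
    by apply: cvgM; [exact: cvg_cst|exact: cf'].
  move=> d /lt_b db e.
  have := hfg _ db; have := ler_norm (s * f' d); rewrite normrM s1 mul1r => h1 h2.
  have : 0 <= (g' d - s * f' d) * (x - 0) by rewrite mulr_ge0 ?subr_ge0 // (le_trans h1).
  by rewrite -e; lra.
have := key 1 (normr1 _); have := key (-1) (normrN1 _).
have := ler_normlP _ _ h0 => -[h1 h2] h3 h4.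
by apply/ler_normlP; split; lra.
Qed.

End Calculus.

Section Sequences.
Context {R : realType}.
Implicit Types (u v : nat -> R) (l : R).

Lemma cvg0_le u v : (forall n, `|u n| <= v n) -> v @ \oo --> (0 : R) ->
  u @ \oo --> (0 : R).
Proof.
move=> uv v0; apply: norm_cvg0.
apply: (@squeeze_cvgr _ _ _ _ (fun=> 0) v); last exact: v0; last exact: cvg_cst.
by near=> n; rewrite uv normr_ge0.
Unshelve. all: by end_near. Qed.

Lemma cvg_diff u v l : v @ \oo --> l -> (fun n => u n - v n) @ \oo --> (0 : R) ->
  u @ \oo --> l.
Proof.
move=> vl uv0; rewrite -(addr0 l).
have -> : u = (fun n => v n + (u n - v n)) by apply/funext => n; lra.
exact: cvgD.
Qed.

Lemma eq_cvgn u v l : v @ \oo --> l -> (forall n, u n = v n) -> u @ \oo --> l.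
Proof. by move=> vl uv; have -> : u = v by apply/funext. Qed.

Lemma cvgn_unique u l k : u @ \oo --> l -> u @ \oo --> k -> l = k.
Proof. by move=> ul uk; rewrite -(cvg_lim _ ul) // -(cvg_lim _ uk). Qed.

Lemma cvg_sub (s : nat -> nat) u l : (forall n, (n <= s n)%N) ->
  u @ \oo --> l -> (fun n => u (s n)) @ \oo --> l.
Proof.
move=> hs ul; apply: (cvg_comp s u) ul.
by move=> A [N _ NA]; exists N => // n /= Nn; apply: NA => /=; exact: leq_trans (hs n).
Qed.

Lemma cvg_half u l : u @ \oo --> l -> (fun n => u n./2) @ \oo --> l.
Proof.
move=> ul; apply: (cvg_comp half u) ul.
by move=> A [N _ NA]; exists N.*2 => // n /= Nn; apply: NA => /=; lia.
Qed.

Lemma cvgn_cst l : (fun=> l) @ \oo --> l.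
Proof. exact: cvg_cst. Qed.

Lemma cvg_scale (c : R) u : u @ \oo --> (0 : R) -> (fun n => c * u n) @ \oo --> (0 : R).
Proof. by move=> h; rewrite -(mulr0 c); apply: cvgM => //; exact: cvg_cst. Qed.

Lemma cvg_add u v l (k : R) : u @ \oo --> l -> v @ \oo --> k ->
  (fun n => u n + v n) @ \oo --> l + k.
Proof. exact: cvgD. Qed.

Lemma cvg_mul u v l (k : R) : u @ \oo --> l -> v @ \oo --> k ->
  (fun n => u n * v n) @ \oo --> l * k.
Proof. exact: cvgM. Qed.

Lemma cvg_opp u l : u @ \oo --> l -> (fun n => - u n) @ \oo --> - l.
Proof. exact: cvgN. Qed.

Lemma cvg_sum_seq (r : seq nat) (F : nat -> nat -> R) (L : nat -> R) :
  (forall k, k \in r -> F k @ \oo --> L k) ->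
  (fun n => \sum_(k <- r) F k n) @ \oo --> \sum_(k <- r) L k.
Proof.
elim: r => [|k r IH] h.
  by rewrite big_nil; apply: eq_cvgn (cvg_cst _) _ => n; rewrite big_nil.
rewrite big_cons.
apply: eq_cvgn (cvg_add (h k _) (IH _)) _ => [|j jr|n]; rewrite ?big_cons ?inE ?eqxx //.
by apply: h; rewrite inE jr orbT.
Qed.

Lemma cvg_invS : (fun n => n.+1%:R^-1) @ \oo --> (0 : R).
Proof. exact: cvg_harmonic. Qed.

Lemma cvg_dominated (a b : nat -> R) (C : R) :
  (forall n, (0 < n)%N -> `|a n| <= b n) ->
  (forall N, \sum_(1 <= n < N.+1) b n <= C) ->
  exists l : R, (fun N => \sum_(1 <= n < N.+1) a n) @ \oo --> l.
Proof.
move=> ab bC.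
have b0 n : (0 < n)%N -> 0 <= b n by move=> n0; apply: le_trans (ab n n0).
have sE (c : nat -> R) : (fun N => \sum_(1 <= n < N.+1) c n) = series (fun n => c n.+1).
  by apply/funext => N; rewrite seriesEnat /= big_add1.
rewrite sE; have : cvgn (series (fun n => a n.+1)).
  apply: normed_cvg.
  apply: (@series_le_cvg _ _ (fun n => b n.+1)) => //.
  - by move=> n; exact: normr_ge0.
  - by move=> n; exact: b0.
  - by move=> n; exact: ab.
  rewrite -sE; apply: nondecreasing_is_cvgn.
    apply/nondecreasing_seqP => n; rewrite [leRHS]big_nat_recr //= lerDl; exact: b0.
  by exists C => _ [N _ <-].
by move=> h; exists (limn (series (fun n => a n.+1))).
Qed.

Lemma sum_inv_sqr_le N : \sum_(1 <= n < N.+1) (n%:R ^- 2 : R) <= 2.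
Proof.
(* Telescoping majorant: 2/n - 2/(n+1) >= 1/n^2 for n >= 1. *)
suff : \sum_(1 <= n < N.+1) (n%:R ^- 2 : R) <= 2 - 2 / N.+1%:R.
  by move=> h; apply: le_trans h _; rewrite gerBl divr_ge0.
elim: N => [|N IH]; first by rewrite big_geq //; lra.
rewrite big_nat_recr //=; apply: le_trans (lerD IH (lexx _)) _.
have -> : N.+2%:R = N.+1%:R + 1 :> R by rewrite -natr1.
have : 1 <= N.+1%:R :> R by rewrite ler1n.
move: (N.+1%:R : R) => x x1.
rewrite -subr_ge0.
have -> : 2 - 2 / (x + 1) - (2 - 2 / x + x ^- 2) = (x - 1) / (x ^+ 2 * (x+1)) :> R.
  by field; apply/andP; split; apply: lt0r_neq0; lra.
by rewrite divr_ge0 ?mulr_ge0 ?exprn_ge0 //; lra.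
Qed.

Lemma norm_mul_le1 (a b c : R) : `|a| <= 1 -> `|b| <= c -> `|a * b| <= c.
Proof.
move=> a1 bc; rewrite normrM -[c]mul1r ler_pM //.
Qed.

Lemma sum_swap (F : nat -> nat -> R) N :
  \sum_(1 <= n < N.+1) \sum_(1 <= m < n) F n m =
  \sum_(1 <= m < N.+1) \sum_(m.+1 <= n < N.+1) F n m.
Proof.
elim: N => [|N IH]; first by rewrite !big_geq.
rewrite big_nat_recr //= IH [RHS]big_nat_recr //= [X in _ = _ + X]big_geq // addr0.
rewrite -big_split /=; apply: eq_big_nat => i /andP[i1 iN].
by rewrite [RHS]big_nat_recr.
Qed.

End Sequences.

(** * Euler's partial fraction argument *)

Section EulerBox.
Context {R : realType}.
Implicit Types (f g u v : nat -> R).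

Definition hs f (a N : nat) : R := \sum_(1 <= n < N.+1) f n / n%:R ^+ a.

Definition lsum (q : nat) u v (N : nat) : R :=
  \sum_(1 <= n < N.+1) u n / n%:R ^+ q * \sum_(1 <= l < n) v l / l%:R.

(** The off-diagonal part left by the partial fractions: n runs over the whole box on both sides of
    m, and the denominator n - m keeps its sign. *)
Definition dsum (q : nat) f g (N : nat) : R :=
  \sum_(1 <= m < N.+1) g m / m%:R ^+ q *
    \sum_(1 <= n < N.+1 | n != m) f n / (n%:R - m%:R).

Lemma hsS f a N : hs f a N.+1 = hs f a N + f N.+1 / N.+1%:R ^+ a.
Proof. by rewrite /hs big_nat_recr. Qed.

(** A geometric progression of ratio y/x. Euler's relations ([euler_box]) and the evaluation of W_m
    ([wsum_geom]) are both instances of it. *)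
Lemma geom_pow (x y : R) q : x != 0 -> y != 0 -> x != y ->
  \sum_(1 <= a < q.+1) x^-1 ^+ a * y^-1 ^+ (q.+1 - a) =
  (y^-1 ^+ q - x^-1 ^+ q) / (x - y).
Proof.
move=> x0 y0 xy; have xy0 : x - y != 0 by rewrite subr_eq0.
elim: q => [|q IH]; first by rewrite big_geq // !expr0 subrr mul0r.
rewrite big_nat_recr //= subSnn expr1.
rewrite (_ : \sum_(1 <= a < q.+1) _ = y^-1 * \sum_(1 <= a < q.+1) x^-1 ^+ a * y^-1 ^+ (q.+1 - a)); last first.
  rewrite mulr_sumr; apply: eq_big_nat => a /andP[_ aq].
  by rewrite (subSn (ltnW aq)) exprS; ring.
rewrite IH !exprS; field.
by rewrite x0 y0 xy0.
Qed.

(* The sum over a of n^-a m^-(q+1-a) collapses to (m^-q - n^-q) / (n - m). *)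
Lemma euler_box f g q N :
  \sum_(1 <= a < q.+1) hs f a N * hs g (q.+1 - a) N =
  q%:R * hs (fun n => f n * g n) q.+1 N + (dsum q f g N + dsum q g f N).
Proof.
have lhsE : \sum_(1 <= a < q.+1) hs f a N * hs g (q.+1 - a) N =
    \sum_(1 <= n < N.+1) \sum_(1 <= m < N.+1) f n * g m *
      \sum_(1 <= a < q.+1) n%:R^-1 ^+ a * m%:R^-1 ^+ (q.+1 - a).
  under eq_bigr do rewrite /hs mulr_suml.
  rewrite exchange_big /=; apply: eq_bigr => n _.
  under eq_bigr do rewrite mulr_sumr.
  rewrite exchange_big /=; apply: eq_bigr => m _.
  by rewrite mulr_sumr; apply: eq_bigr => a _; rewrite !exprVn; ring.
rewrite lhsE.
have nz n : (0 < n)%N -> n%:R != 0 :> R by rewrite pnatr_eq0 -lt0n.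
pose A n m : R := g m / m%:R ^+ q * (f n / (n%:R - m%:R)).
pose B n m : R := f n / n%:R ^+ q * (g m / (m%:R - n%:R)).
have E n m : (0 < n)%N -> (0 < m)%N -> f n * g m *
      (\sum_(1 <= a < q.+1) n%:R^-1 ^+ a * m%:R^-1 ^+ (q.+1 - a)) =
      (if m == n then q%:R * (f n * g n / n%:R ^+ q.+1) else 0) +
      ((if n != m then A n m else 0) + (if m != n then B n m else 0)).
  move=> n0 m0; rewrite (eq_sym m n); case: eqVneq => [->|mn] /=.
    rewrite !addr0 (eq_big_nat _ _ (F2 := fun=> m%:R^-1 ^+ q.+1)).
      by rewrite sumr_const_nat subSS subn0 -exprVn -[_ *+ q]mulr_natl; ring.
    by move=> a /andP[_ aq]; rewrite -exprD subnKC // ltnW.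
  have xy : n%:R != m%:R :> R by rewrite eqr_nat.
  rewrite geom_pow ?nz // add0r /A /B -!exprVn.
  have -> : (m%:R - n%:R)^-1 = - (n%:R - m%:R)^-1 :> R.
    by rewrite -invrN opprB.
  by ring.
rewrite (eq_big_nat _ _ (F2 := fun n => q%:R * (f n * g n / n%:R ^+ q.+1) +
   (\sum_(1 <= m < N.+1 | n != m) A n m + \sum_(1 <= m < N.+1 | m != n) B n m))); last first.
  move=> n /andP[n0 nN].
  under eq_big_nat => m /andP[m0 _] do rewrite (E n m n0 m0).
  rewrite !big_split /= -!big_mkcond /=; congr (_ + _).
  by rewrite big_nat1_eq n0 nN.
rewrite !big_split /= -mulr_sumr; congr (_ + (_ + _)).
  under eq_bigr do rewrite big_mkcond.
  rewrite exchange_big /= /dsum; apply: eq_bigr => m _.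
  by rewrite mulr_sumr [RHS]big_mkcond.
by rewrite /dsum; apply: eq_bigr => n _; rewrite mulr_sumr.
Qed.

(** Substitute n = m + l above the diagonal and n = m - l below it; addition formulas for f then
    separate m from l. The same u and v serve on both sides up to the scalars s and s'. Below the
    diagonal this is exactly a double sum [lsum], while above it the inner sum stops at N - m. *)
Lemma dsum_split q f g u v (s s' : R) N :
  (forall m l, (0 < m)%N -> (0 < l)%N -> g m * f (m + l)%N = s * (u m * v l)) ->
  (forall m l, (0 < l)%N -> (l < m)%N -> g m * f (m - l)%N = s' * (u m * v l)) ->
  dsum q f g N = s * (\sum_(1 <= m < N.+1) u m / m%:R ^+ q * hs v 1 (N - m))
                 - s' * lsum q u v N.
Proof.
move=> hp hm; rewrite /dsum /lsum !mulr_sumr -sumrB; apply: eq_big_nat => m /andP[m0 mN].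
have -> : \sum_(1 <= n < N.+1 | n != m) f n / (n%:R - m%:R) =
   \sum_(1 <= l < (N - m).+1) f (m + l)%N / l%:R - \sum_(1 <= l < m) f (m - l)%N / l%:R :> R.
  rewrite big_mkcond (@big_cat_nat _ _ _ m) //=; last exact: ltnW.
  rewrite [X in _ + X = _](@big_cat_nat _ _ _ m.+1) //= big_nat1 eqxx /= add0r addrC; congr (_ + _).
    rewrite -{1}(add0n m.+1) big_addn subSS [RHS]big_add1 /=.
    apply: eq_big_nat => l _; rewrite (_ : (l + m.+1 = m + l.+1)%N); last by lia.
    rewrite ifT; last by apply/eqP; lia.
    by rewrite natrD [m%:R + _]addrC addrK.
  rewrite -sumrN big_nat_rev /= add1n.
  apply: eq_big_nat => l /andP[l0 lm]; rewrite ifT; last by apply/eqP; lia.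
  rewrite subSS (natrB _ (ltnW lm)) (_ : m%:R - l%:R - m%:R = - l%:R); last by ring.
  by rewrite invrN mulrN.
rewrite mulrBr; congr (_ - _).
  rewrite /hs !mulr_sumr; apply: eq_big_nat => l /andP[l0 _].
  by rewrite expr1; transitivity (g m * f (m + l)%N / m%:R ^+ q / l%:R); [ring|rewrite hp //; ring].
rewrite !mulr_sumr; apply: eq_big_nat => l /andP[l0 lm].
by transitivity (g m * f (m - l)%N / m%:R ^+ q / l%:R); [ring|rewrite hm //; ring].
Qed.

End EulerBox.

(** * Truncation errors in Euler's relation *)

Section Tails.
Context {R : realType}.
Implicit Types (f g u v : nat -> R).

Lemma hs_gap v K m : (forall n, `|v n| <= 1) -> (m <= K)%N ->
  `|hs v 1 K - hs v 1 (K - m)| <= m%:R / (K - m).+1%:R.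
Proof.
move=> v1 mK; rewrite /hs (@big_cat_nat _ _ _ (K - m).+1) //=; last by lia.
rewrite addrAC subrr add0r (le_trans (ler_norm_sum _ _ _)) //.
rewrite big_seq_cond (le_trans (ler_sum _ (G := fun=> (K - m).+1%:R^-1) _)) //.
  move=> n; rewrite mem_index_iota andbT => /andP[h _].
  apply: norm_mul_le1; first exact: v1.
  by rewrite expr1 ger0_norm ?invr_ge0 // lef_pV2 ?ler_nat ?posrE ?ltr0n //; lia.
rewrite -big_seq_cond sumr_const_nat (_ : (K.+1 - (K - m).+1 = m)%N); last by lia.
by rewrite -[_ *+ m]mulr_natl.
Qed.

(** With K = s N, lowering the harmonic truncation from K to K - m costs in total at most the sum
    over m of 1/(m (K+1-m)). By partial fractions this is 2/(K+1) times a harmonic number, that is,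
    twice a Cesaro mean of 1/n. The map s is the identity for Euler's box and doubling for W_m. *)
Lemma sum_tail_cvg q u v (s : nat -> nat) : (1 < q)%N ->
  (forall n, `|u n| <= 1) -> (forall n, `|v n| <= 1) -> (forall n, (n <= s n)%N) ->
  (fun N => \sum_(1 <= m < N.+1) u m / m%:R ^+ q *
      (hs v 1 (s N) - hs v 1 (s N - m))) @ \oo --> (0 : R).
Proof.
move=> q1 u1 v1 hsN.
pose w K : R := 2 * arithmetic_mean (@harmonic R) K.
have w0 : w @ \oo --> (0 : R).
  by apply: cvg_scale; apply: cesaro; exact: cvg_harmonic.
apply: (@cvg0_le _ _ (fun N => w (s N))); last exact: cvg_sub w0.
move=> N; move: (s N) (hsN N) => K NK.
apply: (@le_trans _ _ (\sum_(1 <= m < K.+1) (m%:R^-1 * (K.+1 - m)%:R^-1))).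
  rewrite (le_trans (ler_norm_sum _ _ _)) //.
  rewrite [leRHS](@big_cat_nat _ _ _ N.+1) //= [leLHS]big_nat_cond [X in _ <= X + _]big_nat_cond.
  apply: ler_wpDr; first by apply: sumr_ge0 => i _; rewrite mulr_ge0.
  apply: ler_sum => m; rewrite andbT ltnS => /andP[m0 mN].
  rewrite -mulrA; apply: norm_mul_le1; first exact: u1.
  have mK : (m <= K)%N by exact: leq_trans NK.
  have mR : 0 < m%:R :> R by rewrite ltr0n.
  rewrite normrM (subSn mK) (le_trans (ler_wpM2l _ (hs_gap v1 mK))) //.
  rewrite ger0_norm ?invr_ge0 ?exprn_ge0 // mulrA ler_wpM2r ?invr_ge0 //.
  rewrite ler_pdivrMl ?exprn_gt0 // -(prednK (ltnW q1)) exprSr -mulrA divff ?gt_eqF // mulr1.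
  by rewrite -[leLHS]expr1 ler_weXn2l ?ler1n //; lia.
rewrite /w /arithmetic_mean /= seriesEnat /=.
rewrite (eq_big_nat _ _ (F2 := fun m => K.+1%:R^-1 * (m%:R^-1 + (K.+1 - m)%:R^-1))); last first.
  move=> m /andP[m0 mK]; have mR : m%:R != 0 :> R by rewrite pnatr_eq0 -lt0n.
  have mR2 : (K.+1%:R - m%:R) != 0 :> R by rewrite subr_eq0 eqr_nat; lia.
  have KR : K.+1%:R != 0 :> R by rewrite pnatr_eq0.
  rewrite natrB ?(ltnW mK) //; move: (K.+1%:R : R) (m%:R : R) mR mR2 KR => a b b0 ab0 a0.
  by field; rewrite b0 ab0 a0.
rewrite -mulr_sumr mulrCA ler_wpM2l ?invr_ge0 // big_split /=.
rewrite [X in _ + X]big_nat_rev /= (eq_big_nat _ _ (F1 := fun i => (K.+1 - _)%:R^-1) (F2 := fun m => m%:R^-1)); last first.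
  by move=> m /andP[m0 mK]; congr (_ %:R ^-1); lia.
rewrite -[X in X + X <= _]mul1r -mulrDl ler_wpM2l // big_add1 /=.
by rewrite [leRHS]big_nat_recr //= lerDl invr_ge0.
Qed.

(** Above the diagonal the double sum decouples, in the limit, into a product of two single sums;
    below it a genuine double sum remains. Only the total difference tends to 0: the individual
    terms are allowed to diverge. *)
Lemma box_cvg q f g u v u2 v2 (s s' t t' : R) : (1 < q)%N ->
  (forall m l, (0 < m)%N -> (0 < l)%N -> g m * f (m + l)%N = s * (u m * v l)) ->
  (forall m l, (0 < l)%N -> (l < m)%N -> g m * f (m - l)%N = s' * (u m * v l)) ->
  (forall m l, (0 < m)%N -> (0 < l)%N -> f m * g (m + l)%N = t * (u2 m * v2 l)) ->
  (forall m l, (0 < l)%N -> (l < m)%N -> f m * g (m - l)%N = t' * (u2 m * v2 l)) ->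
  (forall n, `|u n| <= 1) -> (forall n, `|v n| <= 1) ->
  (forall n, `|u2 n| <= 1) -> (forall n, `|v2 n| <= 1) ->
  (fun N => \sum_(1 <= a < q.+1) hs f a N * hs g (q.+1 - a) N -
    (q%:R * hs (fun n => f n * g n) q.+1 N
     + (s * (hs v 1 N * hs u q N) - s' * lsum q u v N)
     + (t * (hs v2 1 N * hs u2 q N) - t' * lsum q u2 v2 N))) @ \oo --> (0 : R).
Proof.
move=> q1 h1 h2 h3 h4 bu bv bu2 bv2.
have tail (x y : nat -> R) : (forall n, `|x n| <= 1) -> (forall n, `|y n| <= 1) ->
    (fun N => \sum_(1 <= m < N.+1) x m / m%:R ^+ q * hs y 1 (N - m)
              - hs y 1 N * hs x q N) @ \oo --> (0 : R).
  move=> bx bY; have := cvg_opp (sum_tail_cvg q1 bx bY (@leqnn)).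
  rewrite oppr0 => h; apply: eq_cvgn h _ => N; rewrite /= -sumrN [X in _ - _ * X]/hs mulr_sumr -sumrB.
  by apply: eq_bigr => m _; ring.
have := cvg_add (cvg_scale s (tail _ _ bu bv)) (cvg_scale t (tail _ _ bu2 bv2)).
rewrite addr0 => h; apply: eq_cvgn h _ => N.
by rewrite euler_box (dsum_split _ _ h1 h2) (dsum_split _ _ h3 h4); ring.
Qed.

End Tails.

(** * Periodic functions of period dividing 4 *)

Section Characters.
Context {R : realType}.

Definition triv : nat -> R := fun=> 1.
Definition alt : nat -> R := fun n => (-1) ^+ n.
Definition od : nat -> R := fun n => (odd n)%:R.
Definition ev : nat -> R := fun n => (~~ odd n)%:R.
(* [kap n] and [chi n] are the cosine and the sine of [n * pi / 2]. *)
Definition kap : nat -> R := fun n => if odd n then 0 else (-1) ^+ n./2.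
Definition chi : nat -> R := fun n => if odd n then (-1) ^+ n./2 else 0.

Lemma triv_le1 n : `|triv n| <= 1. Proof. by rewrite normr1. Qed.
Lemma alt_le1 n : `|alt n| <= 1. Proof. by rewrite normrX normrN1 expr1n. Qed.
Lemma od_le1 n : `|od n| <= 1.
Proof. by rewrite /od; case: odd; rewrite ?normr1 ?normr0 ?ler01. Qed.
Lemma ev_le1 n : `|ev n| <= 1.
Proof. by rewrite /ev; case: odd; rewrite ?normr1 ?normr0 ?ler01. Qed.
Lemma kap_le1 n : `|kap n| <= 1.
Proof. by rewrite /kap; case: odd; rewrite ?normr0 ?ler01 // normrX normrN1 expr1n. Qed.
Lemma chi_le1 n : `|chi n| <= 1.
Proof. by rewrite /chi; case: odd; rewrite ?normr0 ?ler01 // normrX normrN1 expr1n. Qed.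

Lemma sqr_sign n : (-1) ^+ n * (-1) ^+ n = 1 :> R.
Proof. by rewrite -exprMn mulrNN mulr1 expr1n. Qed.

Lemma kapD m l : kap (m + l) = kap m * kap l - chi m * chi l.
Proof.
rewrite /kap /chi oddD halfD.
case: (odd m); case: (odd l) => /=; rewrite ?add1n ?add0n ?exprS ?exprD; ring.
Qed.

Lemma chiD m l : chi (m + l) = chi m * kap l + kap m * chi l.
Proof.
rewrite /kap /chi oddD halfD.
case: (odd m); case: (odd l) => /=; rewrite ?add1n ?add0n ?exprS ?exprD; ring.
Qed.

Lemma kap2 n : kap n * kap n = ev n.
Proof. by rewrite /kap /ev; case: odd; rewrite ?mul0r // sqr_sign. Qed.

Lemma chi2 n : chi n * chi n = od n.
Proof. by rewrite /chi /od; case: odd; rewrite ?mul0r // sqr_sign. Qed.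

Lemma chi_kap n : chi n * kap n = 0.
Proof. by rewrite /chi /kap; case: odd; rewrite ?mul0r ?mulr0. Qed.

Lemma od_kap n : od n * kap n = 0.
Proof. by rewrite /od /kap; case: odd; rewrite ?mul0r ?mulr0. Qed.

Lemma od_chi n : od n * chi n = chi n.
Proof. by rewrite /od /chi; case: odd; rewrite ?mul1r ?mulr0. Qed.

Lemma od_ev n : od n + ev n = 1.
Proof. by rewrite /od /ev; case: odd; rewrite ?addr0 ?add0r. Qed.

Lemma kapB m l : (l <= m)%N -> kap (m - l) = kap m * kap l + chi m * chi l.
Proof.
move=> lm; rewrite -{2 3}(subnK lm) kapD chiD.
(* 1 = chi l ^ 2 + kap l ^ 2 inverts the addition formulas written for m = (m - l) + l. *)
rewrite -[LHS]mulr1 -(od_ev l) -chi2 -kap2; ring.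
Qed.

Lemma chiB m l : (l <= m)%N -> chi (m - l) = chi m * kap l - kap m * chi l.
Proof.
move=> lm; rewrite -{2 3}(subnK lm) kapD chiD.
rewrite -[LHS]mulr1 -(od_ev l) -chi2 -kap2; ring.
Qed.

End Characters.

(** * Rational spaces of limits *)

Section Spaces.
Context {R : realType}.
Implicit Types (M : set R) (u v : nat -> R) (x y c : R).

Definition israt c := exists q : rat, c = ratr q.

(** Closure under products is not part of it, because adjoining the lines through zeta(2m+1 bar, 1)
    and W_m gives only a Q-subspace. Products of limits are therefore formed inside [Ralg]
    ([liminM]) and transported afterwards. *)
Definition qspace M := [/\ Ralg `<=` M, forall x y, M x -> M y -> M (x + y)
  & forall c x, israt c -> M x -> M (c * x)].

(** Membership is attached to sequences and not to values, so that divergent pieces can be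
    recombined before any limit is taken. *)
Definition limin M u := exists2 l, M l & u @ \oo --> l.

Lemma israt_nat n : israt n%:R.
Proof. by exists n%:R; rewrite ratr_nat. Qed.

Lemma israt0 : israt 0. Proof. by exists 0; rewrite rmorph0. Qed.

Lemma israt1 : israt 1. Proof. by exists 1; rewrite rmorph1. Qed.

Lemma isratD x y : israt x -> israt y -> israt (x + y).
Proof. by move=> [p ->] [q ->]; exists (p + q); rewrite rmorphD. Qed.

Lemma isratN x : israt x -> israt (- x).
Proof. by move=> [p ->]; exists (- p); rewrite rmorphN. Qed.

Lemma isratM x y : israt x -> israt y -> israt (x * y).
Proof. by move=> [p ->] [q ->]; exists (p * q); rewrite rmorphM. Qed.

Lemma isratV x : israt x -> israt x^-1.
Proof. by move=> [p ->]; exists p^-1; rewrite fmorphV. Qed.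

Lemma isratX x n : israt x -> israt (x ^+ n).
Proof. by move=> [p ->]; exists (p ^+ n); rewrite rmorphXn. Qed.

Lemma Ralg_subalgebra : Qsubalgebra (@Ralg R).
Proof.
split.
- by move=> q A [[h _ _] _]; exact: h.
- by move=> x y hx hy A hA; have [[_ h _] _] := hA; exact: h (hx A hA) (hy A hA).
- by move=> x y hx hy A hA; have [[_ _ h] _] := hA; exact: h (hx A hA) (hy A hA).
Qed.

Lemma Ralg_gen x : generators x -> Ralg x.
Proof. by move=> gx A [_ h]; exact: h. Qed.

Lemma RalgM x y : Ralg x -> Ralg y -> Ralg (x * y).
Proof. by case: Ralg_subalgebra => _ _; apply. Qed.

Lemma RalgQ c : israt c -> Ralg c.
Proof. by move=> [q ->]; case: Ralg_subalgebra => + _ _; apply. Qed.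

Lemma RalgX x n : Ralg x -> Ralg (x ^+ n).
Proof.
move=> h; elim: n => [|n IH]; last by rewrite exprS; exact: RalgM.
by rewrite expr0; apply: RalgQ; exact: israt1.
Qed.

Lemma Ralg_qspace : qspace Ralg.
Proof.
have [h1 h2 h3] := Ralg_subalgebra.
by split=> // c x hc hx; apply: h3 => //; exact: RalgQ.
Qed.

Lemma qspaceN M x : qspace M -> M x -> M (- x).
Proof. by case=> _ _ h Mx; rewrite -mulN1r; apply: h => //; apply: isratN; exact: israt1. Qed.

Lemma qspace_line M x : qspace M -> qspace (sumset M (Qline x)).
Proof.
case=> h1 h2 h3; split.
- move=> y hy; exists y; first exact: h1.
  by exists 0; [exists 0; rewrite ?rmorph0 ?mul0r|rewrite addr0].
- move=> _ _ [a Ma [_ [p _ <-] <-]] [b Mb [_ [q _ <-] <-]].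
  exists (a + b); first exact: h2.
  by exists (ratr (p + q) * x); [exists (p + q)|rewrite rmorphD; ring].
- move=> c _ hc [a Ma [_ [p _ <-] <-]]; exists (c * a); first exact: h3.
  case: hc => q ->.
  by exists (ratr (q * p) * x); [exists (q * p)|rewrite rmorphM; ring].
Qed.

Lemma sumset_l M x : M `<=` sumset M (Qline x).
Proof.
move=> y My; exists y => //.
by exists 0; [exists 0; rewrite ?rmorph0 ?mul0r|rewrite addr0].
Qed.

Lemma sumset_r M x : qspace M -> sumset M (Qline x) x.
Proof.
case=> h1 _ _; exists 0; first by apply: h1; apply: RalgQ; exact: israt0.
by exists x; [exists 1; rewrite ?rmorph1 ?mul1r|rewrite add0r].
Qed.

Lemma limin_eq M u v : limin M v -> (forall n, u n = v n) -> limin M u.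
Proof. by move=> [l Ml vl] uv; exists l => //; exact: eq_cvgn vl uv. Qed.

Lemma limin_diff M u v : limin M v -> (fun n => u n - v n) @ \oo --> (0 : R) -> limin M u.
Proof. by move=> [l Ml vl] uv; exists l => //; exact: cvg_diff vl uv. Qed.

Lemma limin_sub M (M' : set R) u : M `<=` M' -> limin M u -> limin M' u.
Proof. by move=> h [l /h Ml ul]; exists l. Qed.

Lemma limin_comp M u (s : nat -> nat) : (forall n, (n <= s n)%N) -> limin M u ->
  limin M (fun n => u (s n)).
Proof. by move=> hs [l Ml ul]; exists l => //; exact: cvg_sub. Qed.

Lemma limin_half M u : limin M u -> limin M (fun n => u n./2).
Proof. by move=> [l Ml ul]; exists l => //; exact: cvg_half. Qed.

Lemma limin_cst M x : M x -> limin M (fun=> x).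
Proof. by exists x => //; exact: cvg_cst. Qed.

Lemma liminD M u v : qspace M -> limin M u -> limin M v -> limin M (fun n => u n + v n).
Proof.
by move=> [_ h _] [l Ml ul] [k Mk vk]; exists (l + k); [exact: h|exact: cvg_add].
Qed.

Lemma liminZ M c u : qspace M -> israt c -> limin M u -> limin M (fun n => c * u n).
Proof.
move=> [_ _ h] hc [l Ml ul]; exists (c * l); first exact: h.
by apply: cvg_mul => //; exact: cvg_cst.
Qed.

Lemma liminN M u : qspace M -> limin M u -> limin M (fun n => - u n).
Proof. by move=> hM [l Ml ul]; exists (- l); [exact: qspaceN|exact: cvg_opp]. Qed.

Lemma liminB M u v : qspace M -> limin M u -> limin M v -> limin M (fun n => u n - v n).
Proof. by move=> hM hu hv; apply: liminD => //; exact: liminN. Qed.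

Lemma liminM u v : limin Ralg u -> limin Ralg v -> limin Ralg (fun n => u n * v n).
Proof.
by move=> [l Ml ul] [k Mk vk]; exists (l * k); [exact: RalgM|exact: cvg_mul].
Qed.

Lemma limin0 M u : qspace M -> u @ \oo --> (0 : R) -> limin M u.
Proof. by case=> h _ _ u0; exists 0 => //; apply: h; apply: RalgQ; exact: israt0. Qed.

Lemma limin_sum M (F : nat -> nat -> R) (r : seq nat) (P : pred nat) : qspace M ->
  (forall k, k \in r -> P k -> limin M (F k)) ->
  limin M (fun n => \sum_(k <- r | P k) F k n).
Proof.
move=> hM; elim: r => [|k r IH] h.
  by apply: (limin_eq (v := fun=> 0)) => [|n]; rewrite ?big_nil //; apply: limin0 => //; exact: cvg_cst.
have IH' : limin M (fun n => \sum_(j <- r | P j) F j n).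
  by apply: IH => j jr; apply: h; rewrite inE jr orbT.
case Pk: (P k); last by apply: limin_eq IH' _ => n; rewrite big_cons Pk.
apply: limin_eq (liminD hM (h k _ Pk) IH') _; first by rewrite inE eqxx.
by move=> n; rewrite big_cons Pk.
Qed.

Lemma limin_lim M u : limin M u -> M (limn u).
Proof. by move=> [l Ml ul]; rewrite (cvg_lim _ ul). Qed.

End Spaces.

(** * The alternating harmonic series *)

Section LogTwo.
Context {R : realType}.

(** The partial sum of (-x)^n / n plus ln(1 + x) has derivative (-1)^N x^N / (1 + x), at most x^N in
    absolute value on [0, 1]; hence the error at x = 1 is at most 1/(N+1). *)
Lemma hs_alt1 : hs (@alt R) 1 @ \oo --> (- ln 2 : R).
Proof.
pose f (N : nat) (x : R) : R := \sum_(1 <= n < N.+1) (-1) ^+ n * (x ^+ n / n%:R) + ln (1 + x).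
pose g (N : nat) (x : R) : R := x ^+ N.+1 / N.+1%:R.
have df (N : nat) (x : R) : 0 <= x -> is_derive x 1 (f N) ((-1) ^+ N * x ^+ N / (1 + x)).
  move=> x0; have x1 : 0 < 1 + x by lra.
  have -> : (-1) ^+ N * x ^+ N / (1 + x) =
     \sum_(1 <= n < N.+1) (-1) ^+ n * x ^+ n.-1 + (1 + x)^-1.
    elim: N => [|N IH]; first by rewrite big_geq // !expr0; lra.
    rewrite big_nat_recr //= addrAC -IH !exprS; field.
    by rewrite gt_eqF.
  apply: derD.
    apply: der_sum_nat => n /andP[n0 _]; apply: derZ.
    have nz : n%:R != 0 :> R by rewrite pnatr_eq0 -lt0n.
    apply: (der_eq (derM (derX n (der_id x)) (der_cst n%:R^-1 x))).
    by field.
  apply: (der_eq (der_comp (is_derive1_ln x1) (derD (der_cst 1 x) (der_id x)))).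
  by rewrite add0r mulr1.
have dg (N : nat) (x : R) : is_derive x 1 (g N) (x ^+ N).
  apply: (der_eq (derM (derX N.+1 (der_id x)) (der_cst N.+1%:R^-1 x))).
  by rewrite mulr0 add0r mulr1 mulKf ?pnatr_eq0.
have bnd N : `|f N 1| <= g N 1.
  apply: (@der_bound _ (f N) (g N) (fun x => (-1) ^+ N * x ^+ N / (1 + x)) (fun x => x ^+ N) 1).
  - by move=> x /andP[x0 _]; apply: df; exact: ltW.
  - by apply: der_within => x /andP[x0 _]; exact: df.
  - by apply: der_within => x _; exact: dg.
  - move=> x /andP[x0 _]; rewrite -mulrA; apply: norm_mul_le1.
      by rewrite normrX normrN1 expr1n.
    rewrite ger0_norm ?divr_ge0 ?exprn_ge0 //; [|lra..].
    rewrite ler_pdivrMr; last lra.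
    by rewrite ler_peMr ?exprn_ge0 //; lra.
  - rewrite /f /g addr0 ln1 addr0 expr0n /= mul0r big_nat big1 ?normr0 // => n /andP[n0 _].
    by rewrite expr0n gtn_eqF // mul0r mulr0.
  - by rewrite ler01 lexx.
apply: (@cvg_diff _ _ (fun=> - ln 2)); first exact: cvg_cst.
apply: (@cvg0_le _ _ _ _ cvg_invS) => N.
have := bnd N; rewrite /g expr1n mul1r; congr (`| _ | <= _).
rewrite /f /hs /alt opprK; congr (_ + ln _).
by apply: eq_bigr => n _; rewrite expr1n mul1r expr1.
Qed.

End LogTwo.

(** * Oscillating integrals over [0, pi/4] *)

Section QuarterPi.
Context {R : realType}.
Implicit Types (x t : R).

Definition qp : R := pi / 4.

Lemma qp_gt0 : 0 < qp. Proof. by rewrite divr_gt0 // pi_gt0. Qed.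

Lemma qp_lt1 : qp < 1.
Proof. by have := @pihalf_lt2 R; rewrite /qp; lra. Qed.

Lemma cos_gt0_qp x : 0 <= x <= qp -> 0 < cos x.
Proof.
move=> /andP[x0 xa]; apply: cos_gt0_pihalf.
by have := pi_gt0 R; move: xa; rewrite /qp; lra.
Qed.

Lemma cos_neq0_qp x : 0 <= x <= qp -> cos x != 0.
Proof. by move=> h; rewrite gt_eqF // cos_gt0_qp. Qed.

Lemma der_tan_qp x : 0 <= x <= qp -> is_derive x 1 tan (1 + tan x ^+ 2).
Proof. by move=> h; apply: der_tan; exact: cos_neq0_qp. Qed.

Lemma tan_qp : tan qp = 1 :> R. Proof. exact: tan_piquarter. Qed.

Lemma tan_mono x t : 0 <= x -> x < t -> t <= qp -> tan x < tan t.
Proof.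
move=> x0 xt ta; rewrite ltr_tan // in_itv /=; have := pi_gt0 R; move: ta; rewrite /qp; lra.
Qed.

Lemma tan_ge0 x : 0 <= x <= qp -> 0 <= tan x.
Proof.
move=> /andP[]; rewrite le_eqVlt => /predU1P[<-|x0 xa]; first by rewrite tan0.
by rewrite -tan0 ltW // tan_mono.
Qed.

Lemma tan_gt0 x : 0 < x <= qp -> 0 < tan x.
Proof. by move=> /andP[x0 xa]; rewrite -tan0 tan_mono. Qed.

Lemma tan_le1 x : 0 <= x <= qp -> tan x <= 1.
Proof.
move=> /andP[x0]; rewrite le_eqVlt => /predU1P[->|xa]; first by rewrite tan_qp.
by rewrite -tan_qp ltW // tan_mono.
Qed.

Lemma tan_ge x : 0 <= x <= qp -> x <= tan x.
Proof.
move=> hx; have := @der_bound _ (fun t => t) tan (fun=> 1) (fun t => 1 + tan t ^+ 2) qp.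
move=> /(_ (fun x _ => der_id x)).
have dt t : 0 < t < qp -> is_derive t 1 tan (1 + tan t ^+ 2).
  by move=> h; apply: der_tan_qp; lra.
move=> /(_ dt) h; have {h} : `|x| <= tan x.
  apply: h => //.
  - by apply: der_within => t _; exact: der_id.
  - by apply: der_within => t; exact: der_tan_qp.
  - by move=> t _; rewrite normr1 lerDl sqr_ge0.
  - by rewrite normr0 tan0.
by apply: le_trans; exact: ler_norm.
Qed.

Lemma cos_sin_halfpi (n : nat) :
  cos (n%:R * (pi / 2)) = kap n :> R /\ sin (n%:R * (pi / 2)) = chi n :> R.
Proof.
elim: n => [|n [IHc IHs]].
  by rewrite mul0r cos0 sin0 /kap /chi /= expr0.
have -> : n.+1%:R * (pi / 2) = n%:R * (pi / 2) + pi / 2 :> R by rewrite -natr1; ring.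
rewrite cosDpihalf sinDpihalf IHc IHs -addn1 kapD chiD /kap /chi /= !expr0.
by split; ring.
Qed.

Lemma cos_qp (k : nat) : cos (2 * k%:R * qp) = kap k :> R.
Proof. by rewrite -(cos_sin_halfpi k).1; congr cos; rewrite /qp; field. Qed.

Lemma sin_qp (k : nat) : sin (2 * k%:R * qp) = chi k :> R.
Proof. by rewrite -(cos_sin_halfpi k).2; congr sin; rewrite /qp; field. Qed.

End QuarterPi.

Section Oscillation.
Context {R : realType}.

(* The primitives of t^r sin(ct) and t^r cos(ct) vanishing at 0, by integration by parts. *)
Fixpoint js (r : nat) (c t : R) {struct r} : R :=
  if r is r'.+1 then - (t ^+ r * cos (c * t)) / c + r%:R / c * jc r' c t
  else (1 - cos (c * t)) / c
with jc (r : nat) (c t : R) {struct r} : R :=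
  if r is r'.+1 then t ^+ r * sin (c * t) / c - r%:R / c * js r' c t
  else sin (c * t) / c.

Lemma der_js_jc (r : nat) (c t : R) : c != 0 ->
  is_derive t 1 (js r c) (t ^+ r * sin (c * t)) /\
  is_derive t 1 (jc r c) (t ^+ r * cos (c * t)).
Proof.
move=> c0; elim: r => [|r [IHs IHc]].
  split.
    apply: (der_eq (derM (derB (der_cst 1 t) (der_cosZ c t)) (der_cst c^-1 t))).
    by rewrite expr0; field.
  apply: (der_eq (derM (der_sinZ c t) (der_cst c^-1 t))).
  by rewrite expr0; field.
split.
  apply: (der_eq (derD (derM (derN (derM (derX r.+1 (der_id t)) (der_cosZ c t)))
     (der_cst c^-1 t)) (derZ (r.+1%:R / c) IHc))).
  by rewrite /= exprS; field.
apply: (der_eq (derB (derM (derM (derX r.+1 (der_id t)) (der_sinZ c t))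
     (der_cst c^-1 t)) (derZ (r.+1%:R / c) IHs))).
by rewrite /= exprS; field.
Qed.

Lemma js_jc0 r (c : R) : js r c 0 = 0 /\ jc r c 0 = 0.
Proof.
elim: r => [|r [IHs IHc]] /=; rewrite mulr0 ?cos0 ?sin0 ?subrr ?mul0r //.
by rewrite IHs IHc expr0n /= !mul0r oppr0 !mul0r !mulr0 addr0 subr0.
Qed.

(** A quantitative Riemann-Lebesgue lemma. Subtracting e h sin(c x) / c, the boundary term of one
    integration by parts, leaves a function whose derivative - e h' sin(c x) / c is at most C / c.
    The factor [e] takes the sign of the Dirichlet kernel. *)
Lemma osc_cvg (V : nat -> R -> R) (h h' : R -> R) (e c : nat -> R) (C b : R) :
  0 <= b ->
  (forall N x, 0 < x < b -> is_derive x 1 (V N) (e N * (h x * cos (c N * x)))) ->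
  (forall N, {within `[0, b], continuous (V N)}) -> (forall N, V N 0 = 0) ->
  (forall x, 0 < x < b -> is_derive x 1 h (h' x)) ->
  {within `[0, b], continuous h} -> (forall x, 0 < x < b -> `|h' x| <= C) ->
  (forall N, N.+1%:R <= c N) -> (forall N, `|e N| <= 1) ->
  (fun N => V N b) @ \oo --> (0 : R).
Proof.
move=> b0 dV cV V0 dh ch hC hc he.
have c0 N : 0 < c N by apply: lt_le_trans (hc N); rewrite ltr0n.
suff bnd N : `|V N b| <= (C * b + `|h b|) / c N.
  apply: (@cvg0_le _ _ (fun N => `|C * b + `|h b| | * N.+1%:R^-1)).
    move=> N; apply: le_trans (bnd N) _.
    apply: (le_trans (ler_wpM2r _ (ler_norm _))); first by rewrite invr_ge0 ltW.
    by rewrite ler_wpM2l // lef_pV2 ?posrE ?ltr0n.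
  by apply: cvg_scale; exact: cvg_invS.
pose E x := V N x - e N * (h x * (sin (c N * x) / c N)).
have csin : continuous (fun x : R => sin (c N * x) / c N).
  move=> x; apply: (der_continuous (a := cos (c N * x))).
  apply: (der_eq (derM (der_sinZ (c N) x) (der_cst (c N)^-1 x))).
  by field; rewrite gt_eqF.
have : `|E b| <= C / c N * b.
  apply: (@der_bound _ E (fun x => C / c N * x)
    (fun x => - (e N * (h' x * (sin (c N * x) / c N)))) (fun=> C / c N) b).
  - move=> x hx.
    apply: (der_eq (derB (dV N x hx) (derZ (e N) (derM (dh x hx)
      (derM (der_sinZ (c N) x) (der_cst (c N)^-1 x)))))).
    by field; rewrite gt_eqF.
  - move=> x _; apply: (der_eq (derZ _ (der_id x))); exact: mulr1.
  - move=> x; apply: cvgB; first exact: cV.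
    apply: cvgM; first exact: cvg_cst.
    apply: cvgM; first exact: ch.
    exact: (continuous_subspaceT csin).
  - apply: der_within => x _; apply: (derZ _ (der_id x)).
  - move=> x hx; rewrite normrN; apply: norm_mul_le1; first exact: he.
    rewrite normrM ler_pM ?hC // normrM.
    rewrite [X in _ * X]ger0_norm ?invr_ge0 ?(ltW (c0 N)) //.
    by rewrite ler_piMl ?sin_max // invr_ge0 ltW.
  - by rewrite /E V0 !mulr0 sin0 mul0r !mulr0 subr0 normr0.
  - by rewrite b0 lexx.
have -> : V N b = E b + e N * (h b * (sin (c N * b) / c N)) by rewrite /E; ring.
move=> h1; apply: (le_trans (ler_normD _ _)).
rewrite mulrDl (mulrAC C) lerD //.
apply: norm_mul_le1; first exact: he.
rewrite normrM ler_wpM2l // normrM.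
rewrite [X in _ * X]ger0_norm ?invr_ge0 ?(ltW (c0 N)) //.
by rewrite ler_piMl ?sin_max // invr_ge0 ltW.
Qed.

End Oscillation.

Section Kernels.
Context {R : realType}.
Implicit Types (t : R).

Lemma dirichlet_cos N t : cos t != 0 ->
  2^-1 + \sum_(1 <= k < N.+1) (-1) ^+ k * cos (2 * k%:R * t) =
  (-1) ^+ N * cos ((2 * N%:R + 1) * t) / (2 * cos t).
Proof.
move=> ct; elim: N => [|N IH].
  by rewrite big_geq // mulr0 add0r !mul1r; field.
rewrite big_nat_recr //= addrA IH.
have -> : (2 * N%:R + 1) * t = 2 * N.+1%:R * t - t by rewrite -natr1; ring.
have -> : (2 * N.+1%:R + 1) * t = 2 * N.+1%:R * t + t by ring.
by rewrite trigo.cosB trigo.cosD exprS; field.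
Qed.

(** The left side is the termwise derivative of the Fourier series of log cos t. It equals - tan t
    only up to an oscillating term, which [lncos_bound] integrates. *)
Lemma dirichlet_sin N t : cos t != 0 ->
  \sum_(1 <= k < N.+1) (-1) ^+ k * (2 * sin (2 * k%:R * t)) =
  - tan t + (-1) ^+ N * (sin ((2 * N%:R + 1) * t) / cos t).
Proof.
move=> ct; elim: N => [|N IH].
  by rewrite big_geq // mulr0 add0r !mul1r /tan addNr.
rewrite big_nat_recr //= IH /tan.
have -> : (2 * N%:R + 1) * t = 2 * N.+1%:R * t - t by rewrite -natr1; ring.
have -> : (2 * N.+1%:R + 1) * t = 2 * N.+1%:R * t + t by ring.
by rewrite trigo.sinB trigo.sinD exprS; field.
Qed.

(** Restricting to odd k expands 1 / sin 2t into the terms 2 sin 2kt, up to the oscillating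
    remainder cos 4Nt / sin 2t. *)
Lemma fejer_sin N t :
  \sum_(1 <= k < (2 * N).+1) od k * sin (2 * k%:R * t) * (4 * (sin t * cos t)) =
  1 - cos (4 * N%:R * t).
Proof.
elim: N => [|N IH]; first by rewrite big_geq // !mulr0 mul0r cos0 subrr.
rewrite (_ : (2 * N.+1).+1 = (2 * N).+3)%N; last by lia.
rewrite big_nat_recr //= big_nat_recr //= IH {1 2}/od /= !oddM /= mul0r !mul0r addr0 mul1r.
have e1 : (2 * N).+1%:R = 2 * N%:R + 1 :> R by rewrite -natr1 natrM.
have e2 : N.+1%:R = N%:R + 1 :> R by rewrite -natr1.
have -> : 4 * N%:R * t = 2 * (2 * N).+1%:R * t - (t + t) by rewrite e1; ring.
have -> : 4 * N.+1%:R * t = 2 * (2 * N).+1%:R * t + (t + t) by rewrite e1 e2; ring.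
by rewrite trigo.cosB (trigo.cosD _ (t + t)) trigo.sinD; ring.
Qed.

End Kernels.

(** * Single values as elements of the algebra *)

Section EvenZeta.
Context {R : realType}.
Implicit Types (t : R) (f : nat -> R).

Lemma hs_cvg f a : (1 < a)%N -> (forall n, `|f n| <= 1) -> exists l : R, hs f a @ \oo --> l.
Proof.
move=> a1 f1; apply: (@cvg_dominated _ _ (fun n => n%:R ^- 2) 2); last exact: sum_inv_sqr_le.
move=> n n0; apply: norm_mul_le1; first exact: f1.
rewrite ger0_norm ?invr_ge0 ?exprn_ge0 // lef_pV2 ?posrE ?exprn_gt0 ?ltr0n //.
by rewrite ler_weXn2l // ler1n.
Qed.

Lemma half_sum (F : nat -> R) N :
  \sum_(1 <= n < N.+1) (if odd n then 0 else F n./2) = \sum_(1 <= n < N./2.+1) F n.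
Proof.
elim: N => [|N IH]; first by rewrite !big_geq.
rewrite big_nat_recr //= IH uphalf_half.
by case: (odd N) => /=; rewrite ?addr0 ?add0n // add1n [RHS]big_nat_recr.
Qed.

Lemma hs_ev a N : hs ev a N = 2 ^- a * hs triv a N./2 :> R.
Proof.
rewrite /hs mulr_sumr -half_sum; apply: eq_big_nat => n /andP[n0 _].
rewrite /ev /triv; case: ifP => on /=; first by rewrite mul0r.
have -> : n%:R = 2 * n./2%:R :> R by rewrite -natrM; congr (_ %:R); lia.
by rewrite exprMn invfM; ring.
Qed.

Lemma hs_kap a N : hs kap a N = 2 ^- a * hs alt a N./2 :> R.
Proof.
rewrite /hs mulr_sumr -half_sum; apply: eq_big_nat => n /andP[n0 _].
rewrite /kap /alt; case: ifP => on /=; first by rewrite mul0r.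
have -> : n%:R = 2 * n./2%:R :> R by rewrite -natrM; congr (_ %:R); lia.
by rewrite exprMn invfM; ring.
Qed.

Lemma hs_lin (c d : R) f g h a N : (forall n, h n = c * f n + d * g n) ->
  hs h a N = c * hs f a N + d * hs g a N.
Proof.
by move=> e; rewrite /hs !mulr_sumr -big_split /=; apply: eq_bigr => n _; rewrite e; ring.
Qed.

Lemma hs_alt a N : hs alt a N = 2 * hs ev a N - hs triv a N :> R.
Proof.
rewrite (@hs_lin 2 (-1) ev triv alt); first by ring.
by move=> n; rewrite /alt /ev /triv -signr_odd; case: (odd n) => /=; rewrite ?expr1 ?expr0; ring.
Qed.

Lemma hs_od a N : hs od a N = hs triv a N - hs ev a N :> R.
Proof.
rewrite (@hs_lin 1 (-1) triv ev od); first by ring.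
by move=> n; rewrite /od /ev /triv; case: (odd n) => /=; ring.
Qed.

Lemma zeta_hs a : (1 < a)%N -> hs triv a @ \oo --> (zeta a : R).
Proof.
move=> a1; have [l hl] := hs_cvg a1 triv_le1.
suff -> : zeta a = l by [].
apply/cvg_lim => //; apply: eq_cvgn hl _ => N.
by apply: eq_bigr => n _; rewrite mul1r.
Qed.

Lemma sum_odd (F : nat -> R) N :
  \sum_(1 <= n < N.+1) (if odd n then F n else 0) =
  \sum_(1 <= n < (uphalf N).+1) F (2 * n - 1)%N.
Proof.
elim: N => [|N IH]; first by rewrite !big_geq.
rewrite big_nat_recr // IH; case: ifP => oN.
  have -> : uphalf N.+1 = (uphalf N).+1 by move: oN => /=; lia.
  rewrite [RHS]big_nat_recr //=; congr (_ + F _); move: oN => /=; lia.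
by rewrite [LHS]Monoid.mulm1; congr (\sum_(1 <= n < _.+1) _); move: oN => /=; lia.
Qed.

Lemma beta_partial s N :
  \sum_(1 <= n < (uphalf N).+1) ((-1) ^+ n.-1 * (2 * n - 1)%N%:R ^- s) = hs chi s N :> R.
Proof.
rewrite /hs [RHS](eq_bigr (fun n => if odd n then (-1) ^+ n./2 / n%:R ^+ s else 0)); last first.
  by move=> n _; rewrite /chi; case: odd; rewrite ?mul0r.
rewrite sum_odd; apply: eq_big_nat => n /andP[n0 _]; congr (_ ^+ _ * _); lia.
Qed.

Lemma cvg_beta s (l : R) : hs chi s @ \oo --> l -> beta s = l.
Proof.
move=> hl; apply/cvg_lim => //.
apply: eq_cvgn (cvg_sub (s := fun n => (2 * n)%N) _ hl) _ => [n|n]; first by lia.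
by rewrite -beta_partial; congr (\sum_(1 <= n < _.+1) _); lia.
Qed.

Lemma hs_chi_even s : (0 < s)%N -> ~~ odd s -> limin Ralg (hs (@chi R) s).
Proof.
move=> s0 es; have [|l hl] := @hs_cvg (@chi R) s _ chi_le1; first by lia.
exists l => //; rewrite -(cvg_beta hl); apply: Ralg_gen; right.
by exists s./2 => /=; [lia|congr beta; lia].
Qed.

Lemma Ralg_qp : Ralg (qp : R).
Proof.
apply: RalgM; first by apply: Ralg_gen; left; left; right.
by apply: RalgQ; apply: isratV; exact: israt_nat.
Qed.

Lemma limin_ev a : limin Ralg (hs (@triv R) a) -> limin Ralg (hs (@ev R) a).
Proof.
move=> h; apply: limin_eq (hs_ev a); apply: liminZ; first exact: Ralg_qspace.
  by apply: isratV; apply: isratX; exact: israt_nat.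
exact: limin_half.
Qed.

Lemma limin_od a : limin Ralg (hs (@triv R) a) -> limin Ralg (hs (@od R) a).
Proof.
move=> h; apply: limin_eq (hs_od a); apply: liminB => //; first exact: Ralg_qspace.
exact: limin_ev.
Qed.

Lemma limin_alt_of_triv a : limin Ralg (hs (@triv R) a) -> limin Ralg (hs (@alt R) a).
Proof.
have hQ := @Ralg_qspace R.
move=> h; apply: limin_eq (hs_alt a); apply: liminB => //.
by apply: liminZ => //; [exact: israt_nat|exact: limin_ev].
Qed.

Lemma limin_kap_of_alt a : limin Ralg (hs (@alt R) a) -> limin Ralg (hs (@kap R) a).
Proof.
move=> h; apply: limin_eq (hs_kap a); apply: liminZ; first exact: Ralg_qspace.
  by apply: isratV; apply: isratX; exact: israt_nat.
exact: limin_half.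
Qed.

(* The values that are polynomials in pi: beta at odd and zeta at even exponents. *)
Definition pi_values (t : nat) : Prop :=
  (odd t -> limin Ralg (hs (@chi R) t)) /\ (~~ odd t -> limin Ralg (hs (@triv R) t)).

(* Integrates t^r against the Dirichlet kernel of [dirichlet_cos]. *)
Lemma jc_sum_cvg r :
  (fun N => qp ^+ r.+1 / (2 * r.+1%:R) +
     \sum_(1 <= k < N.+1) (-1) ^+ k * jc r (2 * k%:R) qp) @ \oo --> (0 : R).
Proof.
pose V N (t : R) : R := t ^+ r.+1 / (2 * r.+1%:R) +
     \sum_(1 <= k < N.+1) (-1) ^+ k * jc r (2 * k%:R) t.
pose h (t : R) : R := t ^+ r * (2 * cos t)^-1.
pose h' (t : R) : R := t ^+ r * (- (2 * cos t) ^- 2 * (2 * - sin t)) +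
   (2 * cos t)^-1 * (r%:R * t ^+ r.-1 * 1).
have dh t : 0 <= t <= qp -> is_derive t 1 h (h' t).
  move=> ht; apply: derM; first exact: derX (der_id t).
  apply: derV.
  by rewrite mulf_neq0 // cos_neq0_qp.
have dV N t : 0 <= t <= qp -> is_derive t 1 (V N) ((-1) ^+ N * (h t * cos ((2 * N%:R + 1) * t))).
  move=> ht; have ct := cos_neq0_qp ht.
  have -> : (-1) ^+ N * (h t * cos ((2 * N%:R + 1) * t)) =
     t ^+ r / 2 + \sum_(1 <= k < N.+1) (-1) ^+ k * (t ^+ r * cos (2 * k%:R * t)).
    transitivity (t ^+ r * (2^-1 + \sum_(1 <= k < N.+1) (-1) ^+ k * cos (2 * k%:R * t))).
      by rewrite dirichlet_cos // /h invfM; field.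
    by rewrite mulrDr mulr_sumr; congr (_ + _); apply: eq_bigr => k _; ring.
  have r0 : r.+1%:R != 0 :> R by rewrite pnatr_eq0.
  apply: derD.
    apply: (der_eq (derM (derX r.+1 (der_id t)) (der_cst (2 * r.+1%:R)^-1 t))).
    by rewrite /= mulr0 add0r mulr1 invfM; move: (r.+1%:R : R) r0 => z z0; field.
  apply: der_sum_nat => k /andP[k0 _]; apply: derZ.
  apply: (der_js_jc r t _).2.
  by rewrite mulf_neq0 // pnatr_eq0 -lt0n.
have sub t : 0 < t < qp -> 0 <= t <= qp by move=> ?; lra.
apply: (@osc_cvg _ V h h' (fun N => (-1) ^+ N) (fun N => 2 * N%:R + 1) (r%:R + 2) qp).
- exact: ltW qp_gt0.
- by move=> N t /sub; exact: dV.
- by move=> N; apply: der_within => t; exact: dV.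
- move=> N; rewrite /V expr0n mul0r add0r big1 // => k _.
  by rewrite (js_jc0 r (2 * k%:R)).2 mulr0.
- by move=> t /sub; exact: dh.
- by apply: der_within => t; exact: dh.
- move=> t /sub ht; have ct := cos_gt0_qp ht.
  have c2 : (cos t) ^- 2 <= 2.
    rewrite cos2_tan2 ?gt_eqF //; have := tan_le1 ht; have := tan_ge0 ht.
    move=> y0 y1; have : tan t ^+ 2 <= 1 by rewrite exprn_ile1.
    by lra.
  have c1 : (cos t)^-1 <= 2.
    apply: le_trans c2; rewrite -exprVn expr2 ler_peMr ?invr_ge0 ?(ltW ct) //.
    by rewrite invf_ge1 // cos_le1.
  have tX n : `|t ^+ n| <= 1.
    have /andP[t0 t1] := ht; have a1 := @qp_lt1 R.
    by rewrite ger0_norm ?exprn_ge0 // exprn_ile1 //; lra.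
  rewrite /h' addrC; apply: (le_trans (ler_normD _ _)); apply: lerD.
    rewrite mulr1 mulrC -mulrA -[leRHS]mulr1 normrM ger0_norm // ler_wpM2l //.
    apply: norm_mul_le1 => //; rewrite ger0_norm ?invr_ge0 ?mulr_ge0 ?(ltW ct) //.
    by rewrite invfM; lra.
  apply: norm_mul_le1 => //; rewrite mulrN mulNr mulrN opprK.
  rewrite mulrCA mulrA mulrC; apply: norm_mul_le1; first exact: sin_max.
  rewrite ger0_norm ?mulr_ge0 ?invr_ge0 ?exprn_ge0 ?mulr_ge0 ?(ltW ct) //.
  by rewrite exprMn invfM; lra.
- by move=> N; rewrite -natr1; have : 0 <= N%:R :> R by []; lra.
- by move=> N; rewrite normrX normrN1 expr1n.
Qed.

End EvenZeta.

Section PiValues.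
Context {R : realType}.

Local Notation hQ := (@Ralg_qspace R).

(** Numerators left at pi/4 when t^r cos 2kt has been integrated by parts down to degree 0: the last
    primitive is a sine for even r and 1 - cos for odd r, each with the sign (-1)^k. *)
Definition jtop (r : nat) : nat -> R :=
  fun k => if odd r then alt k * (1 - kap k) else alt k * chi k.

Lemma jtop2 r : jtop r.+2 = jtop r.
Proof. by apply/funext => k; rewrite /jtop /= negbK. Qed.

Lemma alt_chi k : alt k * chi k = - chi k :> R.
Proof. by rewrite /alt /chi -signr_odd; case: odd; rewrite ?expr1 ?mulN1r // mulr0 oppr0. Qed.

Lemma alt_kap k : alt k * kap k = kap k :> R.
Proof. by rewrite /alt /kap -signr_odd; case: odd; rewrite ?mulr0 // expr0 mul1r. Qed.

Lemma hs_scale (f : nat -> R) (c : R) a N : hs (fun n => c * f n) a N = c * hs f a N.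
Proof. by rewrite /hs mulr_sumr; apply: eq_bigr => n _; rewrite mulrA. Qed.

Definition jcsum r s N : R := \sum_(1 <= k < N.+1) alt k * jc r (2 * k%:R) qp / k%:R ^+ s.
Definition jssum r s N : R := \sum_(1 <= k < N.+1) alt k * js r (2 * k%:R) qp / k%:R ^+ s.

Lemma jcsum0 s N : jcsum 0 s N = 2^-1 * hs (jtop 0) s.+1 N.
Proof.
rewrite /jcsum /hs mulr_sumr; apply: eq_big_nat => k /andP[k0 _].
rewrite /= sin_qp /jtop /= exprS.
by rewrite !invfM; ring.
Qed.

Lemma jssum0 s N : jssum 0 s N = 2^-1 * hs (jtop 1) s.+1 N.
Proof.
rewrite /jssum /hs mulr_sumr; apply: eq_big_nat => k /andP[k0 _].
rewrite /= cos_qp /jtop /= exprS.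
by rewrite !invfM; ring.
Qed.

Lemma jcsumS r s N : jcsum r.+1 s N =
  (- 2^-1 * qp ^+ r.+1) * hs chi s.+1 N + (- (r.+1%:R / 2)) * jssum r s.+1 N.
Proof.
rewrite /jcsum /jssum /hs !mulr_sumr -big_split; apply: eq_big_nat => k /andP[k0 _].
rewrite [jc _ _ _]/= sin_qp [k%:R ^+ s.+1]exprS !invfM.
transitivity (alt k * chi k * (qp ^+ r.+1 / 2 * (k%:R^-1 / k%:R ^+ s)) -
  r.+1%:R / 2 * (alt k * js r (2 * k%:R) qp * (k%:R^-1 / k%:R ^+ s)) : R); first by ring.
by rewrite alt_chi /=; ring.
Qed.

Lemma jssumS r s N : jssum r.+1 s N =
  (- 2^-1 * qp ^+ r.+1) * hs kap s.+1 N + (r.+1%:R / 2) * jcsum r s.+1 N.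
Proof.
rewrite /jcsum /jssum /hs !mulr_sumr -big_split; apply: eq_big_nat => k /andP[k0 _].
rewrite [js _ _ _]/= cos_qp [k%:R ^+ s.+1]exprS !invfM.
transitivity (- (alt k * kap k * (qp ^+ r.+1 / 2 * (k%:R^-1 / k%:R ^+ s))) +
  r.+1%:R / 2 * (alt k * jc r (2 * k%:R) qp * (k%:R^-1 / k%:R ^+ s)) : R); first by ring.
by rewrite alt_kap /=; ring.
Qed.

Lemma israt_half n : israt (n%:R / 2 : R).
Proof. by apply: isratM; [exact: israt_nat|apply: isratV; exact: israt_nat]. Qed.

Lemma israt2V : israt (2^-1 : R).
Proof. by apply: isratV; exact: israt_nat. Qed.

Lemma Ralg_coef r : Ralg (- 2^-1 * qp ^+ r : R).
Proof.
by apply: RalgM; [apply: RalgQ; apply: isratN; exact: israt2V|apply: RalgX; exact: Ralg_qp].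
Qed.

(* Every boundary term of the integrations by parts except the last one involves
   a value at an exponent smaller than (s + r).+1. *)
Lemma jsum_mod K (hK : forall t, (0 < t < K)%N -> @pi_values R t) r : forall s,
  (s + r < K)%N ->
  (~~ odd s -> exists c : R, [/\ israt c, c != 0 &
     limin Ralg (fun N => jcsum r s N - c * hs (jtop r) (s + r).+1 N)]) /\
  (odd s -> exists c : R, [/\ israt c, c != 0 &
     limin Ralg (fun N => jssum r s N - c * hs (jtop r.+1) (s + r).+1 N)]).
Proof.
elim: r => [|r IH] s srK.
  have z : limin Ralg (fun=> 0 : R) by apply: (limin0 hQ); exact: cvg_cst.
  have h2 : 2^-1 != 0 :> R by rewrite invr_eq0 pnatr_eq0.
  split=> _; exists 2^-1; split => //; try exact: israt2V.
    by apply: limin_eq z _ => N; rewrite addn0 jcsum0 subrr.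
  by apply: limin_eq z _ => N; rewrite addn0 jssum0 subrr.
have [IHc IHs] := IH s.+1 (ltac:(lia)).
have [ho he] := hK s.+1 (ltac:(lia)).
have r0 : r.+1%:R / 2 != 0 :> R by rewrite mulf_neq0 ?invr_eq0 ?pnatr_eq0.
split=> os.
  have [c [qc c0 hc]] := IHs os; exists (- (r.+1%:R / 2) * c); split.
  - by apply: isratM => //; apply: isratN; exact: israt_half.
  - by rewrite mulf_neq0 // oppr_eq0.
  apply: limin_eq (liminD hQ (liminM (limin_cst (Ralg_coef r.+1)) (ho os))
    (liminZ hQ (isratN (israt_half r.+1)) hc)) _ => N.
  by rewrite jcsumS (addnS s r) addSn; ring.
have [c [qc c0 hc]] := IHc ltac:(by rewrite /= os); exists (r.+1%:R / 2 * c); split.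
- by apply: isratM => //; exact: israt_half.
- by rewrite mulf_neq0.
have hk : limin Ralg (hs (@kap R) s.+1).
  by apply: limin_kap_of_alt; apply: limin_alt_of_triv; apply: he; rewrite /= os.
apply: limin_eq (liminD hQ (liminM (limin_cst (Ralg_coef r.+1)) hk)
    (liminZ hQ (israt_half r.+1) hc)) _ => N.
by rewrite jssumS jtop2 (addnS s r) addSn; ring.
Qed.

(** By [jc_sum_cvg] the signed sum of the integrals of t^r cos 2kt over [0, pi/4] is a rational
    multiple of pi^(r+1). By [jsum_mod] the same sum is, modulo values at smaller exponents, a
    nonzero rational times a value at exponent r+1: beta for even r, a rational multiple of zeta for
    odd r. Strong induction on the exponent concludes. *)
Lemma pi_valuesP t : (0 < t)%N -> @pi_values R t.
Proof.
elim/ltn_ind: t => -[//|r] IH _.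
have [|h _] := @jsum_mod r.+1 _ r 0 (ltac:(lia)).
  by move=> t /andP[t0 tr]; exact: IH.
have {h} [//|c [qc c0 hc]] := h.
have hJ : limin Ralg (jcsum r 0).
  exists (- (qp ^+ r.+1 / (2 * r.+1%:R))).
    apply: (qspaceN hQ); apply: RalgM; first exact: RalgX Ralg_qp.
    by apply: RalgQ; apply: isratV; apply: isratM; exact: israt_nat.
  have := jc_sum_cvg (R := R) r => hV.
  apply: (@cvg_diff _ _ (fun=> - (qp ^+ r.+1 / (2 * r.+1%:R)))); first exact: cvg_cst.
  apply: eq_cvgn hV _ => N; rewrite opprK addrC; congr (_ + _).
  by apply: eq_bigr => k _; rewrite expr0 divr1.
have hT : limin Ralg (hs (jtop r) r.+1).
  apply: limin_eq (liminZ hQ (isratV qc) (liminB hQ hJ hc)) _ => N.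
  by rewrite subKr mulKf.
split=> /= ot.
  apply: limin_eq (liminN hQ hT) _ => N.
  rewrite -mulN1r -hs_scale; congr hs; apply/funext => n.
  by rewrite /jtop (negbTE ot) alt_chi; ring.
have r1 : (1 < r.+1)%N by case: r ot {hT hJ hc IH}.
have hz := zeta_hs (R := R) r1.
case: hT => l Rl hl.
(* p is the share of zeta(r+1) carried by even n. The [alt] series is (2p - 1) zeta(r+1) and the
   [kap] series is p times that, so their difference has the factor (1 - p)(2p - 1), nonzero since p
   <= 1/4. *)
pose p : R := 2 ^- r.+1.
have hev : hs ev r.+1 @ \oo --> p * zeta r.+1.
  by apply: eq_cvgn (hs_ev r.+1); apply: cvg_mul; [exact: cvg_cst|exact: cvg_half].
have halt : hs alt r.+1 @ \oo --> 2 * (p * zeta r.+1) - zeta r.+1.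
  apply: eq_cvgn (hs_alt r.+1); apply: cvgB => //.
  by apply: cvg_mul; [exact: cvg_cst|].
have hkap : hs kap r.+1 @ \oo --> p * (2 * (p * zeta r.+1) - zeta r.+1).
  by apply: eq_cvgn (hs_kap r.+1); apply: cvg_mul; [exact: cvg_cst|exact: cvg_half].
have el : l = (1 - p) * (2 * p - 1) * zeta r.+1.
  apply: (cvgn_unique hl); rewrite (_ : _ * zeta r.+1 =
    2 * (p * zeta r.+1) - zeta r.+1 - p * (2 * (p * zeta r.+1) - zeta r.+1)); last by ring.
  apply: eq_cvgn (cvg_add halt (cvg_opp hkap)) _ => N.
  rewrite (@hs_lin _ 1 (-1) alt kap (jtop r)); first by ring.
  by move=> n; rewrite /jtop; move: ot; case: (odd r) => //= _; rewrite mulrBr alt_kap; ring.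
exists (zeta r.+1) => //.
have hp : p <= 2^-1 * 2^-1.
  rewrite /p -exprVn -(subnKC r1) exprD expr2 ler_piMr // exprn_ile1 //; lra.
have p0 : 0 < p by rewrite invr_gt0 exprn_gt0.
have hc' : (1 - p) * (2 * p - 1) != 0.
  by rewrite mulf_neq0 // subr_eq0; apply/eqP; lra.
rewrite -(mulKf hc' (zeta r.+1)) -el; apply: RalgM => //; apply: RalgQ.
have qp' : israt p by apply: isratV; apply: isratX; exact: israt_nat.
apply: isratV; apply: isratM; apply: isratD => //; try exact: israt1.
- exact: isratN.
- by apply: isratM => //; exact: israt_nat.
- by apply: isratN; exact: israt1.
Qed.

End PiValues.

(** * Moments against 2 / sin 2t *)

Section SineMoments.
Context {R : realType}.
Implicit Types (t : R).

Local Notation hQ := (@Ralg_qspace R).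

Lemma limin_triv a : (1 < a)%N -> limin Ralg (hs (@triv R) a).
Proof.
move=> a1; case: (boolP (odd a)) => oa; last first.
  by case: (@pi_valuesP R a (ltnW a1)) => _; apply.
exists (zeta a); last exact: zeta_hs.
apply: Ralg_gen; left; right; exists a./2 => /=; first by lia.
by congr zeta; lia.
Qed.

Lemma limin_chi a : (0 < a)%N -> limin Ralg (hs (@chi R) a).
Proof.
move=> a0; case: (boolP (odd a)) => oa; last exact: hs_chi_even.
by case: (@pi_valuesP R a a0) => + _; apply.
Qed.

Definition jcod r s N : R := \sum_(1 <= k < N.+1) od k * jc r (2 * k%:R) qp / k%:R ^+ s.
Definition jsod r s N : R := \sum_(1 <= k < N.+1) od k * js r (2 * k%:R) qp / k%:R ^+ s.

Lemma jsod0 s N : jsod 0 s N = 2^-1 * hs od s.+1 N.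
Proof.
rewrite /jsod /hs mulr_sumr; apply: eq_big_nat => k /andP[k0 _].
rewrite /= cos_qp exprS !invfM.
transitivity (2^-1 * ((od k - od k * kap k) * (k%:R^-1 / k%:R ^+ s)) : R); first by ring.
by rewrite od_kap subr0; ring.
Qed.

Lemma jcodS r s N : jcod r.+1 s N =
  (- - 2^-1 * qp ^+ r.+1) * hs chi s.+1 N + (- (r.+1%:R / 2)) * jsod r s.+1 N.
Proof.
rewrite /jcod /jsod /hs !mulr_sumr -big_split; apply: eq_big_nat => k /andP[k0 _].
rewrite [jc _ _ _]/= sin_qp [k%:R ^+ s.+1]exprS !invfM.
transitivity (od k * chi k * (qp ^+ r.+1 / 2 * (k%:R^-1 / k%:R ^+ s)) -
  r.+1%:R / 2 * (od k * js r (2 * k%:R) qp * (k%:R^-1 / k%:R ^+ s)) : R); first by ring.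
by rewrite od_chi /=; ring.
Qed.

Lemma jsodS r s N : jsod r.+1 s N = (r.+1%:R / 2) * jcod r s.+1 N.
Proof.
rewrite /jcod /jsod /hs !mulr_sumr; apply: eq_big_nat => k /andP[k0 _].
rewrite [js _ _ _]/= cos_qp [k%:R ^+ s.+1]exprS !invfM.
transitivity (- (od k * kap k * (qp ^+ r.+1 / 2 * (k%:R^-1 / k%:R ^+ s))) +
  r.+1%:R / 2 * (od k * jc r (2 * k%:R) qp * (k%:R^-1 / k%:R ^+ s)) : R); first by ring.
by rewrite od_kap /=; ring.
Qed.

(** For odd k the cosine boundary terms vanish at pi/4, so each pair of integrations by parts
    contributes only a [chi] value. As r + s is even, these have even exponent and the last term is
    an odd zeta value of exponent r + s + 1 >= 3, up to a rational factor. *)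
Lemma limin_jod r : forall s, (1 < r + s)%N -> odd (r + s) = false ->
  (odd r -> limin Ralg (jcod r s)) /\ (~~ odd r -> limin Ralg (jsod r s)).
Proof.
elim: r => [|r IH] s rs1 ors.
  split=> // _; apply: limin_eq (jsod0 s); apply: (liminZ hQ); first exact: israt2V.
  by apply: limin_od; apply: limin_triv; lia.
have [IHc IHs] := IH s.+1 (ltac:(lia)) (ltac:(lia)).
split=> or.
  apply: limin_eq (jcodS r s); apply: (liminD hQ).
    apply: liminM; last by apply: limin_chi.
    by apply: limin_cst; rewrite mulNr; apply: (qspaceN hQ); exact: Ralg_coef.
  apply: (liminZ hQ); first by apply: isratN; exact: israt_half.
  by apply: IHs.
apply: limin_eq (jsodS r s); apply: (liminZ hQ); first exact: israt_half.
by apply: IHc; move: or => /=; rewrite negbK.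
Qed.

(* The factor (tan t)^-1 + tan t is 2 / sin 2t; the junk value 0 at t = 0 is the
   limit there when 0 < l. *)
Definition mint (l : nat) t : R := t ^+ (2 * l) * ((tan t)^-1 + tan t).

Definition mint' (l : nat) t : R :=
  t ^+ (2 * l) * (- (tan t) ^- 2 * (1 + tan t ^+ 2) + (1 + tan t ^+ 2)) +
  ((tan t)^-1 + tan t) * ((2 * l)%:R * t ^+ (2 * l).-1 * 1).

Lemma der_mint l t : 0 < t <= qp -> is_derive t 1 (mint l) (mint' l t).
Proof.
move=> ht; have ht' : 0 <= t <= qp by lra.
have dt := der_tan_qp ht'.
have y0 : tan t != 0 by rewrite gt_eqF // tan_gt0.
exact: derM (derX (2 * l) (der_id t)) (derD (derV y0 dt) dt).
Qed.

Lemma mint_bound l t : (0 < l)%N -> 0 < t <= qp -> `|mint l t| <= 2 * t.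
Proof.
move=> l0 ht; have ht' : 0 <= t <= qp by lra.
have y0 := tan_gt0 ht; have y1 := tan_le1 ht'; have ty := tan_ge ht'.
have /andP[t0 ta] := ht; have a1 := @qp_lt1 R.
have yV : (tan t)^-1 <= t^-1 by rewrite lef_pV2 ?posrE.
have tV : 1 <= t^-1 by rewrite invf_ge1 //; lra.
rewrite /mint ger0_norm; last by rewrite mulr_ge0 ?exprn_ge0 ?addr_ge0 ?invr_ge0; lra.
apply: (@le_trans _ _ (t ^+ 2 * (2 / t))); last by rewrite expr2 mulrA mulrAC mulfK ?gt_eqF // mulrC.
apply: ler_pM; rewrite ?exprn_ge0 ?addr_ge0 ?invr_ge0 //; try lra.
by rewrite ler_wiXn2l //; [lra..|lia].
Qed.

(** The double pole of the derivative of 1 / tan t at 0 is at most of size 1/t^2, since tan t >= t,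
    and t^(2l) <= t^2 compensates it. *)
Lemma mint'_bound l t : (0 < l)%N -> 0 < t < qp -> `|mint' l t| <= 2 + 4 * l%:R.
Proof.
move=> l0 ht; have ht' : 0 <= t <= qp by lra.
have ht2 : 0 < t <= qp by lra.
have y0 := tan_gt0 ht2; have y1 := tan_le1 ht'; have ty := tan_ge ht'.
have /andP[t0 ta] := ht; have a1 := @qp_lt1 R.
have yV : (tan t)^-1 <= t^-1 by rewrite lef_pV2 ?posrE.
have tV : 1 <= t^-1 by rewrite invf_ge1 //; lra.
have y1V : 1 <= (tan t)^-1 by rewrite invf_ge1.
rewrite /mint' mulr1; apply: (le_trans (ler_normD _ _)); apply: lerD.
  apply: (@le_trans _ _ (t ^+ 2 * (2 / t ^+ 2))); last first.
    by rewrite mulrCA mulfV ?mulr1 // expf_neq0 // gt_eqF.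
  rewrite normrM; apply: ler_pM => //.
    by rewrite ger0_norm ?exprn_ge0 ?(ltW t0) // ler_wiXn2l //; [lra..|lia].
  have -> : - tan t ^- 2 * (1 + tan t ^+ 2) + (1 + tan t ^+ 2) =
            - ((1 + tan t ^+ 2) * ((tan t)^-1 ^+ 2 - 1)) by rewrite exprVn; ring.
  have u2 : tan t ^+ 2 <= 1 by rewrite exprn_ile1 //; lra.
  have v2 : (tan t)^-1 ^+ 2 <= t ^- 2.
    by rewrite -exprVn lerXn2r ?nnegrE ?invr_ge0 //; lra.
  have w2 : 1 <= (tan t)^-1 ^+ 2 by rewrite exprn_ege1.
  have z2 : 0 <= tan t ^+ 2 by rewrite sqr_ge0.
  rewrite normrN ger0_norm; last by rewrite mulr_ge0; lra.
  by apply: ler_pM; lra.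
apply: (@le_trans _ _ ((2 / t) * ((2 * l)%:R * t))); last first.
  by rewrite natrM mulrCA divfK ?gt_eqF //; lra.
rewrite normrM; apply: ler_pM => //.
  rewrite ger0_norm; last by rewrite addr_ge0 ?invr_ge0; lra.
  by lra.
rewrite ger0_norm; last by rewrite mulr_ge0 ?exprn_ge0 //; lra.
by apply: ler_wpM2l => //; rewrite -[leRHS]expr1 ler_wiXn2l //; [lra..|lia].
Qed.

Lemma mint_within l : (0 < l)%N -> {within `[0, qp], continuous (mint l)}.
Proof.
move=> l0; have a0 := @qp_gt0 R; have a1 := @qp_lt1 R.
apply/(continuous_within_itvP _ a0); split.
- move=> t; rewrite in_itv /= => ht; apply: (der_continuous (a := mint' l t)).
  by apply: der_mint; lra.
- have -> : mint l 0 = 0 by rewrite /mint expr0n muln_eq0 /= gtn_eqF // mul0r.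
  apply: norm_cvg0.
  apply: (@squeeze_cvgr _ _ _ _ (fun=> 0) (fun t => 2 * t)).
  + near=> t; rewrite normr_ge0 mint_bound //.
    by apply/andP; split; near: t; [exact: nbhs_right_gt|exact: nbhs_right_le].
  + exact: cvg_cst.
  + rewrite -[X in _ --> X](mulr0 2); apply: cvgM; first exact: cvg_cst.
    by apply: cvg_at_right_filter; exact: cvg_id.
- apply: cvg_at_left_filter.
  apply: (der_continuous (a := mint' l qp)).
  by apply: der_mint; rewrite a0 lexx.
Unshelve. all: by end_near. Qed.

(** The only primitive of the development not given by an explicit formula: it comes from the
    Lebesgue integral and the fundamental theorem of calculus. *)
Lemma mint_primitive l : (0 < l)%N -> exists M : R -> R,
  [/\ M 0 = 0, {within `[0, qp], continuous M} &
    forall t, 0 < t < qp -> is_derive t 1 M (mint l t)].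
Proof.
move=> l0; have a0 := @qp_gt0 R.
have hint : (@lebesgue_measure R).-integrable `[0, qp] (EFin \o mint l).
  by apply: continuous_compact_integrable; [exact: segment_compact|exact: mint_within].
exists (fun x => parameterized_integral lebesgue_measure 0 x (mint l)); split.
- by rewrite /parameterized_integral set_itv1 Rintegral_set1.
- by apply: parameterized_integral_continuous => //; exact: ltW.
- move=> t /andP[t0 ta].
  have ct : {for t, continuous (mint l)}.
    by apply: (der_continuous (a := mint' l t)); apply: der_mint; rewrite t0 ltW.
  have [h1 h2] := continuous_FTC1_closed ta hint t0 ct.
  apply: DeriveDef; first exact: h1.
  by rewrite -derive1E h2.
Qed.

(** [fejer_sin] trades 1 / sin 2t for odd sines, up to a factor cos 4(N+1)t whose contribution dies
    by [osc_cvg]; the remaining integrals of t^(2l) sin 2kt are integrated by parts in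
    [limin_jod]. *)
Lemma mint_Ralg l (M : R -> R) : (0 < l)%N -> M 0 = 0 ->
  {within `[0, qp], continuous M} ->
  (forall t, 0 < t < qp -> is_derive t 1 M (mint l t)) -> Ralg (M qp).
Proof.
move=> l0 M0 cM dM.
(* [N.+1] in place of [N] keeps the frequency 4(N+1) positive at N = 0, as [osc_cvg] requires. *)
pose G N (t : R) : R := \sum_(1 <= k < (2 * N.+1).+1) od k * 4 * js (2 * l) (2 * k%:R) t.
have dG N t : is_derive t 1 (G N)
    (\sum_(1 <= k < (2 * N.+1).+1) od k * 4 * (t ^+ (2 * l) * sin (2 * k%:R * t))).
  apply: der_sum_nat => k /andP[k0 _]; apply: derZ; apply: (der_js_jc _ t _).1.
  by rewrite mulf_neq0 // pnatr_eq0 -lt0n.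
have hG : (fun N => M qp - G N qp) @ \oo --> (0 : R).
  apply: (@osc_cvg _ (fun N t => M t - G N t) (mint l) (mint' l) (fun=> 1)
    (fun N => 4 * N.+1%:R) (2 + 4 * l%:R) qp).
  - exact: ltW qp_gt0.
  - move=> N t ht; apply: (der_eq (derB (dM t ht) (dG N t))).
    have ht' : 0 <= t <= qp by lra.
    have ct := cos_neq0_qp ht'.
    have y0 : tan t != 0 by rewrite gt_eqF // tan_gt0; lra.
    have st : sin t != 0 by move: y0; rewrite /tan mulf_eq0 negb_or => /andP[].
    have mE : mint l t = t ^+ (2 * l) / (sin t * cos t).
      have := cos2Dsin2 t; rewrite /mint /tan => e.
      rewrite -[in RHS](mulr1 (t ^+ (2 * l))) -e; field.
      by rewrite ct st.
    rewrite mul1r mE -[cos (4 * _ * _)](subKr 1) -fejer_sin mulrBr mulr1.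
    congr (_ - _); rewrite mulr_sumr; apply: eq_bigr => k _.
    by field; rewrite ct st.
  - move=> N t; apply: cvgB; first exact: cM.
    apply: (continuous_subspaceT (f := G N)) => {}t.
    exact: der_continuous (dG N t).
  - move=> N; rewrite M0 /G big1 ?subrr // => k _.
    by rewrite (js_jc0 _ _).1 mulr0.
  - by move=> t ht; apply: der_mint; lra.
  - exact: mint_within.
  - by move=> t; exact: mint'_bound.
  - by move=> N; have : 0 <= N.+1%:R :> R by []; lra.
  - by move=> N; rewrite normr1.
have hGR : limin Ralg (G^~ qp).
  have h : limin Ralg (jsod (2 * l) 0).
    by apply: (limin_jod (r := 2 * l) (s := 0) _ _).2; lia.
  apply: limin_eq (liminZ hQ (israt_nat 4) (limin_comp (s := fun N => (2 * N.+1)%N) _ h)) _.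
    by move=> n; lia.
  move=> N; rewrite /G /jsod mulr_sumr; apply: eq_bigr => k _.
  by rewrite expr0; field.
case: hGR => g Rg hg.
suff -> : M qp = g by [].
apply/eqP; rewrite -subr_eq0; apply/eqP; symmetry; apply: (cvgn_unique hG).
exact: cvg_add (cvg_cst _) (cvg_opp hg).
Qed.

End SineMoments.

(** * Linear relations between double sums *)

Section EulerRelations.
Context {R : realType}.
Implicit Types (f g u v : nat -> R).

Local Notation hQ := (@Ralg_qspace R).

Lemma sum_ends (F : nat -> R) q : (1 < q)%N ->
  \sum_(1 <= a < q.+1) F a = F 1%N + \sum_(2 <= a < q) F a + F q.
Proof.
move=> q1; rewrite big_nat_recr /=; last exact: ltnW.
by rewrite big_ltn.
Qed.

(** In the sum over a, only the terms a = 1 and a = q have a possibly divergent factor. The last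
    hypothesis treats them together with the decoupled products from above the diagonal, which is
    where the divergences cancel; the conclusion keeps the two double sums from below it. *)
Lemma euler_rel q f g u v u2 v2 (s s' t t' : R) : (1 < q)%N ->
  (forall m l, (0 < m)%N -> (0 < l)%N -> g m * f (m + l)%N = s * (u m * v l)) ->
  (forall m l, (0 < l)%N -> (l < m)%N -> g m * f (m - l)%N = s' * (u m * v l)) ->
  (forall m l, (0 < m)%N -> (0 < l)%N -> f m * g (m + l)%N = t * (u2 m * v2 l)) ->
  (forall m l, (0 < l)%N -> (l < m)%N -> f m * g (m - l)%N = t' * (u2 m * v2 l)) ->
  (forall n, `|u n| <= 1) -> (forall n, `|v n| <= 1) ->
  (forall n, `|u2 n| <= 1) -> (forall n, `|v2 n| <= 1) ->
  (forall a, (1 < a)%N -> limin Ralg (hs f a)) ->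
  (forall a, (1 < a)%N -> limin Ralg (hs g a)) ->
  limin Ralg (hs (fun n => f n * g n) q.+1) ->
  limin Ralg (fun N => hs f 1 N * hs g q N + hs f q N * hs g 1 N -
    s * (hs v 1 N * hs u q N) - t * (hs v2 1 N * hs u2 q N)) ->
  limin Ralg (fun N => s' * lsum q u v N + t' * lsum q u2 v2 N).
Proof.
move=> q1 h1 h2 h3 h4 bu bv bu2 bv2 hf hg hfg hb.
have hmid : limin Ralg (fun N => \sum_(2 <= a < q) hs f a N * hs g (q.+1 - a) N).
  apply: (limin_sum hQ) => a; rewrite mem_index_iota => /andP[a2 aq] _.
  by apply: liminM; [exact: hf|apply: hg; lia].
have := box_cvg q1 h1 h2 h3 h4 bu bv bu2 bv2.
set e := (fun N => _) => he.
apply: limin_diff (liminB hQ (liminB hQ (liminZ hQ (israt_nat q) hfg) hmid) hb) _.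
apply: eq_cvgn he _ => N; rewrite /e sum_ends // subSS subn0 (_ : (q.+1 - q = 1)%N); last by lia.
ring.
Qed.

Lemma lsum_cvg q u v : (2 < q)%N -> (forall n, `|u n| <= 1) -> (forall n, `|v n| <= 1) ->
  exists l : R, lsum q u v @ \oo --> l.
Proof.
move=> q2 bu bv; apply: (@cvg_dominated _ _ (fun n => n%:R ^- 2) 2); last exact: sum_inv_sqr_le.
move=> n n0; rewrite -mulrA; apply: norm_mul_le1; first exact: bu.
have nR : 0 < n%:R :> R by rewrite ltr0n.
rewrite normrM ger0_norm ?invr_ge0 ?exprn_ge0 //.
apply: (@le_trans _ _ (n%:R ^- q * n%:R)); last first.
  rewrite ler_pdivrMl ?exprn_gt0 // ler_pdivlMr ?exprn_gt0 // -exprS.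
  by rewrite ler_weXn2l // ler1n.
rewrite ler_wpM2l ?invr_ge0 ?exprn_ge0 //.
apply: (le_trans (ler_norm_sum _ _ _)).
rewrite big_nat (le_trans (ler_sum _ (G := fun=> 1) _)) //.
  move=> l /andP[l0 _]; apply: norm_mul_le1; first exact: bv.
  by rewrite ger0_norm ?invr_ge0 // invf_le1 ?ltr0n // ler1n.
by rewrite -big_nat sumr_const_nat -[leRHS]/(1 *+ n) ler_pMn2l // leq_subr.
Qed.

Lemma limin_alt a : (0 < a)%N -> limin Ralg (hs (@alt R) a).
Proof.
case: a => [//|[|a]] _; last by apply: limin_alt_of_triv; exact: limin_triv.
exists (- ln 2); last exact: hs_alt1.
by apply: (qspaceN hQ); apply: Ralg_gen; left; left; left.
Qed.

Lemma limin_kap a : (0 < a)%N -> limin Ralg (hs (@kap R) a).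
Proof. by move=> a0; apply: limin_kap_of_alt; exact: limin_alt. Qed.

Lemma hs_0 (f : nat -> R) a N : (forall n, f n = 0) -> hs f a N = 0.
Proof. by move=> f0; rewrite /hs big1 // => n _; rewrite f0 mul0r. Qed.

Lemma eq_hs f g a : f =1 g -> hs f a = hs g a.
Proof. by move=> /funext ->. Qed.

Variables (q : nat).
Hypothesis q1 : (1 < q)%N.

Let q0 : (0 < q)%N. Proof. exact: ltnW. Qed.

(** Euler's classical case f = g = 1: the four products with a divergent harmonic factor cancel
    identically. *)
Lemma lsum_triv : limin Ralg (lsum q (@triv R) triv).
Proof.
have h : limin Ralg (fun N => 1 * lsum q (@triv R) triv N + 1 * lsum q triv triv N).
  have p1 (m l n : nat) : triv m * triv n = 1 * (triv m * triv l) :> R.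
    by rewrite /triv !mul1r.
  apply: (euler_rel q1 (fun m l _ _ => p1 m l _) (fun m l _ _ => p1 m l _)
    (fun m l _ _ => p1 m l _) (fun m l _ _ => p1 m l _)); try exact: triv_le1;
    try exact: limin_triv.
  - by rewrite (@eq_hs _ triv) => [|n]; [exact: limin_triv|rewrite /triv mulr1].
  - by apply: limin_eq (limin0 hQ (cvg_cst _)) _ => N; ring.
by apply: limin_eq (liminZ hQ israt2V h) _ => N; field.
Qed.

Lemma ev_odB n : ev n - od n = alt n :> R.
Proof. by rewrite /ev /od /alt -signr_odd; case: odd; rewrite /= ?expr0 ?expr1; ring. Qed.

Lemma od_ev_parity m l : od m * od (m + l) = od m * ev l :> R.
Proof. by rewrite /od /ev oddD; case: (odd m); case: (odd l); rewrite ?mul0r. Qed.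

Lemma od_ev_parityB m l : (l <= m)%N -> od m * od (m - l) = od m * ev l :> R.
Proof. by move=> lm; rewrite /od /ev oddB //; case: (odd m); case: (odd l); rewrite ?mul0r. Qed.

Lemma kap_od_parity m l : kap m * od (m + l) = kap m * od l :> R.
Proof. by rewrite /kap /od oddD; case: (odd m); case: (odd l); rewrite ?mul0r. Qed.

Lemma kap_od_parityB m l : (l <= m)%N -> kap m * od (m - l) = kap m * od l :> R.
Proof. by move=> lm; rewrite /kap /od oddB //; case: (odd m); case: (odd l); rewrite ?mul0r. Qed.

(** Taken with f = g = [od]. The divergent harmonic sums over odd and over even integers enter only
    through their difference, the alternating series of - log 2. *)
Lemma lsum_od_ev : limin Ralg (lsum q (@od R) ev).
Proof.
have h : limin Ralg (fun N => 1 * lsum q (@od R) ev N + 1 * lsum q od ev N).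
  have hod a : (1 < a)%N -> limin Ralg (hs (@od R) a).
    by move=> a1; apply: limin_od; exact: limin_triv.
  have p1 m l : (0 < m)%N -> (0 < l)%N -> od m * od (m + l) = 1 * (od m * ev l) :> R.
    by move=> _ _; rewrite od_ev_parity mul1r.
  have p2 m l : (0 < l)%N -> (l < m)%N -> od m * od (m - l) = 1 * (od m * ev l) :> R.
    by move=> _ lm; rewrite (od_ev_parityB (ltnW lm)) mul1r.
  apply: (euler_rel q1 p1 p2 p1 p2) => //; try exact: od_le1; try exact: ev_le1.
  - rewrite (@eq_hs _ od) => [|n]; first by apply: hod; exact: ltnW.
    by rewrite /od; case: odd; rewrite ?mulr1 ?mulr0.
  - apply: limin_eq (liminZ hQ (isratN (israt_nat 2)) (liminM (hod _ q1) (limin_alt (ltn0Sn 0)))) _ => N.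
    by rewrite (@hs_lin _ 1 (-1) ev od alt) => [|n]; rewrite -?ev_odB; ring.
by apply: limin_eq (liminZ hQ israt2V h) _ => N; field.
Qed.

(** Taken with f = g = [chi]: at multiples of pi/2 the product sin cos vanishes, so chi m chi (m +
    l) and chi m chi (m - l) both reduce to od m kap l. *)
Lemma lsum_od_kap : limin Ralg (lsum q (@od R) kap).
Proof.
have h : limin Ralg (fun N => 1 * lsum q (@od R) kap N + 1 * lsum q od kap N).
  have hod a : (1 < a)%N -> limin Ralg (hs (@od R) a).
    by move=> a1; apply: limin_od; exact: limin_triv.
  have p1 m l : (0 < m)%N -> (0 < l)%N -> chi m * chi (m + l) = 1 * (od m * kap l) :> R.
    by move=> _ _; rewrite chiD mulrDr !mulrA chi_kap chi2 mul0r addr0 mul1r.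
  have p2 m l : (0 < l)%N -> (l < m)%N -> chi m * chi (m - l) = 1 * (od m * kap l) :> R.
    by move=> _ lm; rewrite (chiB (ltnW lm)) mulrBr !mulrA chi_kap chi2 mul0r subr0 mul1r.
  have hchi a : (1 < a)%N -> limin Ralg (hs (@chi R) a).
    by move=> a1; apply: limin_chi; exact: ltnW.
  apply: (euler_rel q1 p1 p2 p1 p2) => //; try exact: od_le1; try exact: kap_le1.
  - rewrite (@eq_hs _ od) => [|n]; first by apply: hod; exact: ltnW.
    exact: chi2.
  - apply: limin_eq (liminZ hQ (israt_nat 2) (liminB hQ
      (liminM (limin_chi (ltn0Sn 0)) (hchi _ q1))
      (liminM (limin_kap (ltn0Sn 0)) (hod _ q1)))) _ => N; ring.
by apply: limin_eq (liminZ hQ israt2V h) _ => N; field.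
Qed.

(** Taken with f = [alt] and g = 1. It ties two unknown double sums together, and the second one is
    the partial sum of zeta(q bar, 1). *)
Lemma lsum_alt_alt : limin Ralg (fun N => lsum q (@alt R) alt N + lsum q alt triv N).
Proof.
have h : limin Ralg (fun N => 1 * lsum q (@alt R) alt N + 1 * lsum q alt triv N).
  have p1 m l : (0 < m)%N -> (0 < l)%N -> triv m * alt (m + l) = 1 * (alt m * alt l) :> R.
    by move=> _ _; rewrite /alt /triv exprD.
  have p2 m l : (0 < l)%N -> (l < m)%N -> triv m * alt (m - l) = 1 * (alt m * alt l) :> R.
    move=> _ lm; rewrite !mul1r -{2}(subnK (ltnW lm)) /alt exprD -mulrA sqr_sign mulr1.
    by [].
  apply: (@euler_rel _ alt triv _ _ _ _ 1 1 1 1 q1 p1 p2) => //; try exact: alt_le1; try exact: triv_le1.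
  - by move=> m l _ _; rewrite mul1r.
  - by move=> m l _ _; rewrite mul1r.
  - by move=> a a1; apply: limin_alt; exact: ltnW.
  - exact: limin_triv.
  - by rewrite (@eq_hs _ alt) => [|n]; [exact: limin_alt|rewrite /triv mulr1].
  - apply: limin_eq (liminB hQ
      (liminM (limin_alt (ltn0Sn 0)) (limin_triv q1))
      (liminM (limin_alt (ltn0Sn 0)) (limin_alt q0))) _ => N; ring.
by apply: limin_eq h _ => N; rewrite !mul1r.
Qed.

(** Taken with f = [od] and g = [kap]. Since od m kap (m + l) and od m kap (m - l) are opposite, the
    sign of the [chi] double sum is the one from below the diagonal. *)
Lemma lsum_chi_chi : limin Ralg (fun N => lsum q (@kap R) od N + lsum q chi chi N).
Proof.
have h : limin Ralg (fun N => 1 * lsum q (@kap R) od N + 1 * lsum q chi chi N).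
  have hod a : (1 < a)%N -> limin Ralg (hs (@od R) a).
    by move=> a1; apply: limin_od; exact: limin_triv.
  have p1 m l : (0 < m)%N -> (0 < l)%N -> kap m * od (m + l) = 1 * (kap m * od l) :> R.
    by move=> _ _; rewrite kap_od_parity mul1r.
  have p2 m l : (0 < l)%N -> (l < m)%N -> kap m * od (m - l) = 1 * (kap m * od l) :> R.
    by move=> _ lm; rewrite (kap_od_parityB (ltnW lm)) mul1r.
  have p3 m l : (0 < m)%N -> (0 < l)%N -> od m * kap (m + l) = (-1) * (chi m * chi l) :> R.
    by move=> _ _; rewrite kapD mulrBr !mulrA od_kap od_chi; ring.
  have p4 m l : (0 < l)%N -> (l < m)%N -> od m * kap (m - l) = 1 * (chi m * chi l) :> R.
    by move=> _ lm; rewrite (kapB (ltnW lm)) mulrDr !mulrA od_kap od_chi; ring.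
  apply: (euler_rel q1 p1 p2 p3 p4) => //; try exact: od_le1; try exact: kap_le1; try exact: chi_le1.
  - by move=> a a1; apply: limin_kap; exact: ltnW.
  - by apply: limin_eq (limin0 hQ (cvg_cst 0)) _ => N; rewrite hs_0 // => n; exact: od_kap.
  - apply: limin_eq (liminD hQ
      (liminM (hod _ q1) (limin_kap (ltn0Sn 0)))
      (liminM (limin_chi (ltn0Sn 0)) (limin_chi q0))) _ => N; ring.
by apply: limin_eq h _ => N; rewrite !mul1r.
Qed.

End EulerRelations.

(** * The double sums occurring in the S values *)

Section DoubleSums.
Context {R : realType}.
Variable q : nat.
Implicit Types (f g u v a b : nat -> R).

Local Notation hQ := (@Ralg_qspace R).

Lemma lsum_linl (c d : R) f g h v N : (forall n, h n = c * f n + d * g n) ->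
  lsum q h v N = c * lsum q f v N + d * lsum q g v N.
Proof.
by move=> e; rewrite /lsum !mulr_sumr -big_split /=; apply: eq_bigr => n _; rewrite e; ring.
Qed.

Lemma lsum_linr (c d : R) f g h u N : (forall n, h n = c * f n + d * g n) ->
  lsum q u h N = c * lsum q u f N + d * lsum q u g N.
Proof.
move=> e; rewrite /lsum !mulr_sumr -big_split /=; apply: eq_bigr => n _.
transitivity (u n / n%:R ^+ q * (c * (\sum_(1 <= l < n) f l / l%:R) + d * \sum_(1 <= l < n) g l / l%:R)).
  by congr (_ * _); rewrite !mulr_sumr -big_split; apply: eq_bigr => l _; rewrite e /=; ring.
by ring.
Qed.

Lemma lsum_half u v a b N :
  (forall n, u n = if odd n then 0 else a n./2) ->
  (forall n, v n = if odd n then 0 else b n./2) ->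
  lsum q u v N = 2 ^- q.+1 * lsum q a b N./2.
Proof.
move=> hu hv; rewrite /lsum mulr_sumr -half_sum; apply: eq_big_nat => n /andP[n0 _].
rewrite hu; case: ifP => on; first by rewrite !mul0r.
have nR (k : nat) : (odd k) = false -> k%:R = 2 * k./2%:R :> R.
  by move=> ok; rewrite -natrM; congr (_ %:R); lia.
rewrite {1}(nR n on) exprMn invfM exprS invfM.
have -> : \sum_(1 <= l < n) v l / l%:R = 2^-1 * \sum_(1 <= l < n./2) b l / l%:R.
  have e1 : n = n.-1.+1 by lia.
  have e2 : n./2 = n.-1./2.+1 by lia.
  rewrite e2 {1}e1 mulr_sumr -half_sum; apply: eq_big_nat => l /andP[l0 _].
  rewrite hv; case: ifP => ol; first by rewrite mul0r.
  by rewrite {1}(nR l ol) invfM; ring.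
by ring.
Qed.

Lemma kapE n : kap n = if odd n then 0 else alt n./2 :> R. Proof. by []. Qed.

Lemma evE n : ev n = if odd n then 0 else triv n./2 :> R.
Proof. by rewrite /ev /triv; case: odd. Qed.

Lemma lsum_double v N : lsum q kap v (2 * N) =
  \sum_(1 <= k < N.+1) alt k / (2 * k)%:R ^+ q * \sum_(1 <= l < 2 * k) v l / l%:R.
Proof.
rewrite /lsum -[in RHS](_ : (2 * N)./2 = N); last by lia.
rewrite -half_sum; apply: eq_big_nat => n _.
rewrite kapE; case: ifP => on; first by rewrite !mul0r.
by rewrite (_ : (2 * n./2)%N = n) //; lia.
Qed.

Section SineQuotient.
(* [I k] stands for the value at pi/4 of a primitive of (cos 2kt - 1)/(sin t cos t). *)
Variable I : nat -> R.
Hypotheses (I0 : I 0 = 0) (I1 : I 1 = - ln 2).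
Hypothesis IS : forall k, I k.+2 = I k + 2 * (kap k.+1 - 1) / k.+1%:R.

(** Starting the sum at 0, where the term is 0 because 0^-1 = 0, makes the recursion [S0S] valid for
    every k. *)
Let S0 v k : R := \sum_(0 <= j < k) v j / j%:R.

Let S0E v k : \sum_(1 <= j < k) v j / j%:R = S0 v k.
Proof.
case: k => [|k]; first by rewrite /S0 !big_geq.
by rewrite /S0 [in RHS]big_ltn // invr0 mulr0 add0r.
Qed.

Let S0S v k : S0 v k.+1 = S0 v k + v k / k%:R.
Proof. by rewrite /S0 big_nat_recr. Qed.

(** The two-step recursion unrolls separately on each parity. For even k it runs over odd j, where
    [kap] is 0, leaving -2 times an odd harmonic sum; for odd k it starts at - log 2 and runs over
    even j. *)
Let IE k : I k = - (ln 2 * od k) - 2 * ev k * S0 od k + 2 * od k * (S0 kap k - S0 ev k).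
Proof.
suff : I k = - (ln 2 * od k) - 2 * ev k * S0 od k + 2 * od k * (S0 kap k - S0 ev k) /\
  I k.+1 = - (ln 2 * od k.+1) - 2 * ev k.+1 * S0 od k.+1 + 2 * od k.+1 * (S0 kap k.+1 - S0 ev k.+1) by case.
elim: k => [|k [IH1 IH2]].
  rewrite I0 I1 !S0S /S0 !big_geq // /od /ev /= invr0; split; ring.
split=> //; rewrite IS IH1 !S0S.
rewrite /od /ev /kap /=; case: (odd k) => /=; ring.
Qed.

Lemma alt_IE k : alt k * I k = ln 2 * od k - 2 * (ev k * \sum_(1 <= j < k) od j / j%:R)
  - 2 * (od k * \sum_(1 <= j < k) kap j / j%:R) + 2 * (od k * \sum_(1 <= j < k) ev j / j%:R).
Proof.
rewrite !S0E IE /alt /od /ev -signr_odd; case: (odd k); rewrite /= ?expr0 ?expr1; ring.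
Qed.

Lemma sum_altI N : \sum_(1 <= k < N.+1) alt k * I k / k%:R ^+ q =
  ln 2 * hs od q N - 2 * lsum q ev od N - 2 * lsum q od kap N + 2 * lsum q od ev N.
Proof.
rewrite /hs /lsum !mulr_sumr -!sumrN -!big_split /=; apply: eq_bigr => k _.
by rewrite alt_IE; ring.
Qed.

(** At even arguments [I] is -2 times an odd harmonic sum, and writing k^q as 2^-q (2k)^q supplies
    the remaining power of 2. *)
Lemma sum_altI2 N : \sum_(1 <= k < N.+1) alt k * I (2 * k)%N / k%:R ^+ q =
  - 2 ^+ q.+1 * lsum q kap od (2 * N).
Proof.
rewrite lsum_double mulr_sumr; apply: eq_big_nat => k /andP[k0 _].
have kR : k%:R != 0 :> R by rewrite pnatr_eq0 -lt0n.
rewrite S0E IE /od /ev oddM /= natrM exprMn exprS.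
by field; rewrite expf_neq0 //= expf_neq0 // pnatr_eq0.
Qed.

End SineQuotient.

Variable M : set R.
Hypothesis hM : qspace M.
Hypothesis q2 : (2 < q)%N.
Hypothesis hMz : limin M (lsum q alt triv).

Let q1 : (1 < q)%N. Proof. exact: ltnW. Qed.

Let inM u : limin Ralg u -> limin M u.
Proof. by apply: limin_sub; case: hM. Qed.

Let qpow n : israt (2 ^- n : R).
Proof. by apply: isratV; apply: isratX; exact: israt_nat. Qed.

(** Write [od] as [triv] - [ev] on the inner index. The first part is the mean of the [triv] and
    [alt] double sums, the second a rescaled [triv] one. Through the [alt] sum zeta(2m+1 bar, 1)
    enters both S values. *)
Lemma lsum_ev_od_in : limin M (lsum q ev od).
Proof.
have h1 : limin M (fun N => 2^-1 * (lsum q triv triv N + lsum q alt triv N)).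
  apply: (liminZ hM israt2V); apply: (liminD hM) => //.
  by apply: inM; apply: lsum_triv.
have h2 : limin M (fun N => 2 ^- q.+1 * lsum q triv triv N./2).
  by apply: (liminZ hM (qpow _)); apply: limin_half; apply: inM; apply: lsum_triv.
apply: limin_eq (liminB hM h1 h2) _ => N.
rewrite -(lsum_half N evE evE).
rewrite (@lsum_linr 1 (-1) triv ev od) => [|n]; last by rewrite /triv; have := @od_ev R n; lra.
by rewrite (@lsum_linl 2^-1 2^-1 triv alt ev) => [|n]; [ring|rewrite -ev_odB /triv; have := @od_ev R n; lra].
Qed.

Lemma sum_altI_in I : I 0%N = 0 -> I 1%N = - ln 2 ->
  (forall k, I k.+2 = I k + 2 * (kap k.+1 - 1) / k.+1%:R) ->
  limin M (fun N => \sum_(1 <= k < N.+1) alt k * I k / k%:R ^+ q).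
Proof.
move=> I0 I1 IS.
have hln : limin Ralg (fun=> ln 2 : R).
  by apply: limin_cst; apply: Ralg_gen; left; left; left.
have hod : limin Ralg (hs (@od R) q) by apply: limin_od; exact: limin_triv.
have n2 := israt_nat (R := R) 2.
apply: limin_eq (liminD hM (liminB hM (liminB hM (inM (liminM hln hod))
  (liminZ hM n2 lsum_ev_od_in)) (liminZ hM n2 (inM (@lsum_od_kap R q q1))))
  (liminZ hM n2 (inM (@lsum_od_ev R q q1)))) _ => N.
exact: sum_altI.
Qed.

End DoubleSums.

(** * Partial fractions for W_m *)

Section WSum.
Context {R : realType}.
Variable q : nat.
Hypothesis q2 : (2 < q)%N.

Local Notation hQ := (@Ralg_qspace R).

Definition zb a b N : R :=
  \sum_(1 <= n < N.+1) \sum_(1 <= m < n) ((-1) ^+ n / (n%:R ^+ a * m%:R ^+ b)).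

Lemma zb_cvg a b : (1 < a)%N -> (0 < b)%N -> (3 < a + b)%N -> exists l : R, zb a b @ \oo --> l.
Proof.
move=> a1 b0 ab; apply: (@cvg_dominated _ _ (fun n => 2 * n%:R ^- 2) 4); last first.
  by move=> N; rewrite -mulr_sumr; have := @sum_inv_sqr_le R N; lra.
move=> n n0; have nR : 0 < n%:R :> R by rewrite ltr0n.
have -> : \sum_(1 <= m < n) ((-1) ^+ n / (n%:R ^+ a * m%:R ^+ b)) =
    (-1) ^+ n * (n%:R ^- a * \sum_(1 <= m < n) m%:R ^- b) :> R.
  by rewrite mulrA mulr_sumr; apply: eq_bigr => m _; rewrite invfM mulrA.
apply: norm_mul_le1; first by rewrite normrX normrN1 expr1n.
have s0 : 0 <= \sum_(1 <= m < n) (m%:R ^- b : R).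
  by apply: sumr_ge0 => m _; rewrite invr_ge0 exprn_ge0.
rewrite ger0_norm ?mulr_ge0 ?invr_ge0 ?exprn_ge0 //.
case: (ltnP 2 a) => a2.
  apply: (@le_trans _ _ (n%:R ^- a * n%:R)).
    rewrite ler_wpM2l ?invr_ge0 ?exprn_ge0 // big_nat (le_trans (ler_sum _ (G := fun=> 1) _)) //.
      by move=> l /andP[l0 _]; rewrite invf_le1 ?exprn_gt0 ?ltr0n // exprn_ege1 // ler1n.
    by rewrite -big_nat sumr_const_nat -[leRHS]/(1 *+ n) ler_pMn2l // leq_subr.
  apply: (@le_trans _ _ (n%:R ^- 2)); last by rewrite ler_peMl ?invr_ge0 ?exprn_ge0 //; lra.
  rewrite ler_pdivrMl ?exprn_gt0 // ler_pdivlMr ?exprn_gt0 // -exprS.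
  by rewrite ler_weXn2l // ler1n.
have -> : a = 2%N by lia.
rewrite mulrC ler_wpM2r ?invr_ge0 ?exprn_ge0 //.
case: n {s0 nR} n0 => // n _; apply: le_trans (sum_inv_sqr_le n).
rewrite [leLHS]big_nat [leRHS]big_nat; apply: ler_sum => m /andP[m0 _].
by rewrite lef_pV2 ?posrE ?exprn_gt0 ?ltr0n // ler_weXn2l ?ler1n //; lia.
Qed.

Lemma zb_lsum N : zb q 1 N = lsum q alt triv N.
Proof.
apply: eq_bigr => n _; rewrite mulr_sumr; apply: eq_bigr => m _.
by rewrite invfM expr1 /alt /triv; ring.
Qed.

(** All p share one truncation N, so that the exact identity [wsum_geom] holds before any limit;
    this includes p = 1, whose convergence is not known in advance. *)
Definition wsum N : R := \sum_(1 <= p < q.+1) 2 ^- p * zb p (q.+1 - p) N.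

(** The weights 2^-p of W_m turn n^-p into (2n)^-p, so that the sum over p is a geometric
    progression in 2n and l. *)
Lemma wsum_geom N : wsum N =
  \sum_(1 <= n < N.+1) \sum_(1 <= l < n) (-1) ^+ n *
    ((l%:R ^- q - (2 * n)%:R ^- q) / ((2 * n)%:R - l%:R)).
Proof.
rewrite /wsum; under eq_bigr do rewrite /zb mulr_sumr.
rewrite exchange_big; apply: eq_bigr => n _ /=.
under eq_bigr do rewrite mulr_sumr.
rewrite exchange_big /=; apply: eq_big_nat => l /andP[l0 ln].
rewrite -!exprVn -geom_pow ?pnatr_eq0 ?eqr_nat; [|lia..].
rewrite mulr_sumr; apply: eq_bigr => p _.
by rewrite natrM !exprVn exprMn !invfM; ring.
Qed.

(** Put j = 2n - l, so that (-1)^n = kap (j + l). As [kap] vanishes at odd arguments, every j may be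
    included, also j = l + 1 at the lower end. *)
Lemma kap_shift_sum l N : (l <= N)%N ->
  \sum_(l.+1 <= n < N.+1) (-1) ^+ n / ((2 * n)%:R - l%:R) =
  \sum_(l.+1 <= j < (2 * N - l).+1) kap (j + l) / j%:R :> R.
Proof.
move=> /subnK <-; elim: (N - l)%N => [|d IH].
  by rewrite !big_geq //; lia.
rewrite addSn big_nat_recr /=; last by lia.
rewrite IH (_ : (2 * (d + l).+1 - l = (2 * (d + l) - l).+2)%N); last by lia.
have k1 : kap ((2 * (d + l) - l).+1 + l) = 0 :> R.
  by rewrite /kap ifT //; lia.
have k2 : kap ((2 * (d + l) - l).+2 + l) = (-1) ^+ (d + l).+1 :> R.
  by rewrite /kap ifF; [congr (_ ^+ _); lia|lia].
have e : (2 * (d + l).+1)%:R - l%:R = (2 * (d + l) - l).+2%:R :> R.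
  by rewrite -natrB; [congr (_ %:R); lia|lia].
rewrite [RHS]big_nat_recr /=; last by lia.
rewrite [X in _ = X + _]big_nat_recr /=; last by lia.
by rewrite k1 k2 e mul0r addr0.
Qed.

Lemma wsum_first N :
  \sum_(1 <= l < N.+1) l%:R ^- q * \sum_(l.+1 <= n < N.+1) (-1) ^+ n / ((2 * n)%:R - l%:R) =
  \sum_(1 <= l < N.+1) kap l / l%:R ^+ q * (hs kap 1 (2 * N - l) - hs kap 1 l) -
  \sum_(1 <= l < N.+1) chi l / l%:R ^+ q * (hs chi 1 (2 * N - l) - hs chi 1 l) :> R.
Proof.
rewrite -sumrB; apply: eq_big_nat => l /andP[l0 lN].
rewrite kap_shift_sum //.
have gap (v : nat -> R) : hs v 1 (2 * N - l) - hs v 1 l = \sum_(l.+1 <= j < (2 * N - l).+1) v j / j%:R.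
  rewrite /hs (@big_cat_nat _ _ _ l.+1) //=; last by lia.
  by rewrite addrAC subrr add0r; apply: eq_bigr => j _; rewrite expr1.
rewrite !gap !mulr_sumr -sumrB; apply: eq_bigr => j _.
by rewrite kapD; ring.
Qed.

(** For fixed n the numbers 2n - l, 0 < l < n, are n+1, ..., 2n-1, so the inner sum is a difference
    of two harmonic sums with 1/n removed. *)
Lemma wsum_second N :
  \sum_(1 <= n < N.+1) \sum_(1 <= l < n) (-1) ^+ n * ((2 * n)%:R ^- q / ((2 * n)%:R - l%:R)) =
  lsum q kap triv (2 * N) - 2 ^- q * (lsum q alt triv N + hs alt q.+1 N) :> R.
Proof.
rewrite lsum_double /lsum /hs -big_split /= mulr_sumr -sumrB; apply: eq_big_nat => n /andP[n0 _].
rewrite -mulr_sumr -mulr_sumr /=.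
have -> : \sum_(1 <= l < n) ((2 * n)%:R - l%:R)^-1 =
    \sum_(1 <= l < 2 * n) triv l / l%:R - \sum_(1 <= l < n) triv l / l%:R - n%:R^-1 :> R.
  rewrite [X in X - _ - _](@big_cat_nat _ _ _ n) //=; last by lia.
  rewrite [X in _ + X - _ - _]big_ltn; last by lia.
  rewrite big_nat_rev /= add1n (_ : \sum_(n.+1 <= i < 2 * n) _ = \sum_(1 <= i < n) (triv (i + n) / (i + n)%:R)); last first.
    by rewrite -[n.+1]add1n big_addn; congr (\sum_(1 <= i < _) _); lia.
  rewrite /triv (_ : \sum_(1 <= i < n) ((2 * n)%:R - (n.+1 - i.+1)%:R)^-1 = \sum_(1 <= i < n) 1 / (i + n)%:R); first by ring.
  apply: eq_big_nat => i /andP[i0 iN]; rewrite subSS -natrB; last by lia.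
  by rewrite mul1r; congr (_%:R^-1); lia.
rewrite /alt natrM exprMn exprS !invfM; ring.
Qed.

Lemma wsumE N : wsum N =
  \sum_(1 <= l < N.+1) kap l / l%:R ^+ q * (hs kap 1 (2 * N - l) - hs kap 1 l) -
  \sum_(1 <= l < N.+1) chi l / l%:R ^+ q * (hs chi 1 (2 * N - l) - hs chi 1 l) -
  (lsum q kap triv (2 * N) - 2 ^- q * (lsum q alt triv N + hs alt q.+1 N)).
Proof.
rewrite wsum_geom -wsum_first -wsum_second.
under eq_bigr do under eq_bigr do rewrite mulrBl mulrBr.
under eq_bigr do rewrite sumrB.
rewrite sumrB; congr (_ - _).
rewrite (sum_swap (fun n l => (-1) ^+ n * (l%:R ^- q / ((2 * n)%:R - l%:R)))).
apply: eq_bigr => l _; rewrite mulr_sumr; apply: eq_bigr => n _; ring.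
Qed.

Lemma lsum_self u N : \sum_(1 <= l < N.+1) u l / l%:R ^+ q * hs u 1 l =
  lsum q u u N + hs (fun n => u n * u n) q.+1 N :> R.
Proof.
rewrite /lsum {2}/hs -big_split /=; apply: eq_big_nat => l /andP[l0 _].
rewrite -[l in hs u 1 l](prednK l0) hsS prednK // /hs prednK //.
under [in RHS]eq_bigr do rewrite -[X in _ / X]expr1.
by rewrite expr1 exprS invfM; ring.
Qed.

(** The inner sum up to 2N - l decouples by [sum_tail_cvg] applied to doubling; the inner sum up to
    l is a double sum plus its diagonal ([lsum_self]). *)
Lemma sum_reflect_cvg (u : nat -> R) : (forall n, `|u n| <= 1) ->
  (fun N => \sum_(1 <= l < N.+1) u l / l%:R ^+ q * (hs u 1 (2 * N - l) - hs u 1 l) -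
    (hs u 1 (2 * N) * hs u q N - lsum q u u N - hs (fun n => u n * u n) q.+1 N))
  @ \oo --> (0 : R).
Proof.
move=> bu; have h : forall n, (n <= 2 * n)%N by move=> n; lia.
have := cvg_opp (sum_tail_cvg (ltnW q2) bu bu h).
rewrite oppr0 => h0; apply: eq_cvgn h0 _ => N.
set A := \sum_(1 <= l < N.+1) _; set B := \sum_(1 <= m < N.+1) _.
have -> : A = \sum_(1 <= l < N.+1) u l / l%:R ^+ q * hs u 1 (2 * N - l) -
    (lsum q u u N + hs (fun n => u n * u n) q.+1 N).
  by rewrite -lsum_self -sumrB; apply: eq_bigr => l _; ring.
have -> : B = hs u 1 (2 * N) * hs u q N -
    \sum_(1 <= l < N.+1) u l / l%:R ^+ q * hs u 1 (2 * N - l).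
  by rewrite [X in _ * X]/hs mulr_sumr -sumrB; apply: eq_bigr => l _; ring.
ring.
Qed.

Variable M : set R.
Hypothesis hM : qspace M.
Hypothesis hMz : limin M (lsum q alt triv).

Let q1 : (1 < q)%N. Proof. exact: ltnW. Qed.
Let q0 : (0 < q)%N. Proof. exact: ltnW. Qed.

Let inM u : limin Ralg u -> limin M u.
Proof. by apply: limin_sub; case: hM. Qed.

Let qpow n : israt (2 ^- n : R).
Proof. by apply: isratV; apply: isratX; exact: israt_nat. Qed.

Let dbl n : (n <= 2 * n)%N. Proof. by lia. Qed.

(* The relation between the chi-chi and kap-od sums makes the two occurrences of
   the latter add up instead of cancelling. *)
Lemma wsum_mod :
  limin M (fun N => wsum N + lsum q kap od N + lsum q kap od (2 * N)).
Proof.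
have hod : limin Ralg (hs (@od R) q.+1) by apply: limin_od; exact: limin_triv.
have hev : limin Ralg (hs (@ev R) q.+1) by apply: limin_ev; exact: limin_triv.
have haa : limin M (lsum q (@alt R) alt).
  by apply: limin_eq (liminB hM (inM (@lsum_alt_alt R q q1)) hMz) _ => N; rewrite addrK.
have h1 : limin M (fun N => \sum_(1 <= l < N.+1) kap l / l%:R ^+ q * (hs kap 1 (2 * N - l) - hs kap 1 l)).
  apply: limin_diff (sum_reflect_cvg kap_le1); apply: (liminB hM); first apply: (liminB hM).
  - apply: inM; apply: liminM; last exact: limin_kap.
    by apply: (limin_comp (u := hs kap 1) dbl); exact: limin_kap.
  - apply: limin_eq (liminZ hM (qpow q.+1) (limin_half haa)) _ => N.
    exact: (lsum_half q N (@kapE R) (@kapE R)).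
  - by apply: inM; rewrite (eq_hs _ (@kap2 R)).
have h2 : limin M (fun N => \sum_(1 <= l < N.+1) chi l / l%:R ^+ q * (hs chi 1 (2 * N - l) - hs chi 1 l)
    - lsum q kap od N).
  have ha : limin M (fun N => hs chi 1 (2 * N) * hs chi q N - hs (@od R) q.+1 N).
    apply: (liminB hM); last exact: inM.
    apply: inM; apply: liminM; last exact: limin_chi.
    by apply: (limin_comp (u := hs chi 1) dbl); exact: limin_chi.
  apply: limin_diff (liminB hM ha (inM (@lsum_chi_chi R q q1))) _.
  apply: eq_cvgn (sum_reflect_cvg chi_le1) _ => N.
  by rewrite (eq_hs _ (@chi2 R)); ring.
have h3 : limin M (fun N => 2 ^- q.+1 * lsum q alt triv N).
  exact: (liminZ hM (qpow _)).
have h4 : limin M (fun N => 2 ^- q * (lsum q alt triv N + hs alt q.+1 N)).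
  by apply: (liminZ hM (qpow _)); apply: (liminD hM) => //; apply: inM; exact: limin_alt.
apply: limin_eq (liminD hM (liminB hM (liminB hM h1 h2) h3) h4) _ => N.
rewrite wsumE.
rewrite (@lsum_linr _ _ 1 1 od ev triv) => [|n]; last by rewrite /triv; have := @od_ev R n; lra.
rewrite (lsum_half q (2 * N) (@kapE R) (@evE R)) (_ : (2 * N)./2 = N); last by lia.
ring.
Qed.

Definition wval : R := \sum_(1 <= p < q.+1) 2 ^- p * zeta_bar p (q.+1 - p).

(** The terms p >= 2 converge absolutely. The partial sums of zeta(1bar, q) are then solved for from
    those of the whole sum, which gives both their convergence and their limit. *)
Lemma wsum_cvg (w : R) : wsum @ \oo --> w -> w = wval.
Proof.
move=> hw.
have h2 p : (2 <= p < q.+1)%N -> zb p (q.+1 - p) @ \oo --> (zeta_bar p (q.+1 - p) : R).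
  move=> hp; case: (@zb_cvg p (q.+1 - p)) => [|||l hl]; try lia.
  by rewrite /zeta_bar; have -> := cvg_lim (@Rhausdorff R) hl.
have hs2 : (fun N => \sum_(2 <= p < q.+1) 2 ^- p * zb p (q.+1 - p) N) @ \oo -->
    \sum_(2 <= p < q.+1) 2 ^- p * (zeta_bar p (q.+1 - p) : R).
  apply: cvg_sum_seq => p; rewrite mem_index_iota => hp.
  by apply: cvg_mul; [exact: cvg_cst|exact: h2].
have h1 : zb 1 q @ \oo --> 2 * (w - \sum_(2 <= p < q.+1) 2 ^- p * (zeta_bar p (q.+1 - p) : R)).
  have h := cvg_mul (@cvgn_cst R 2) (cvg_add hw (cvg_opp hs2)).
  apply: eq_cvgn h _ => N.
  by rewrite /wsum big_ltn ?ltnS // subSS subn0 addrK expr1 mulrA mulfV ?mul1r.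
rewrite /wval big_ltn ?ltnS // subSS subn0.
by rewrite {1}/zeta_bar (cvg_lim (@Rhausdorff R) h1) expr1 mulrA mulVf ?mul1r ?subrK.
Qed.

(** The truncations N and 2N of the double sum have the same limit T, so [wsum_mod] gives W = g - 2T
    with g in M; halving is harmless in a Q-space. *)
Lemma lsum_kap_od_in : limin (sumset M (Qline wval)) (lsum q kap od).
Proof.
have [T hT] := lsum_cvg q2 (@kap_le1 R) (@od_le1 R).
have [g Mg hg] := wsum_mod.
exists T => //.
have hw : wsum @ \oo --> g - T - T.
  apply: eq_cvgn (cvg_add (cvg_add hg (cvg_opp hT)) (cvg_opp (cvg_sub dbl hT))) _ => N.
  by ring.
have e := wsum_cvg hw; exists (2^-1 * g).
  by case: hM => _ _; apply => //; exact: israt2V.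
have [c hc] := isratN (@israt2V R).
exists (ratr c * wval); first by exists c.
by rewrite -hc -e; field.
Qed.

End WSum.

(** * Nested sums as power series in tan t *)

Section NestedSums.
Context {R : realType}.
Variable e : nat -> R.
Hypothesis e1 : forall n, `|e n| <= 1.

(* [sg n * al j n / n] is the coefficient of y^n, y = tan t, in the j-fold iterated
   integral; [e] carries the sign attached to the innermost index. *)
Fixpoint al (j n : nat) {struct j} : R :=
  if j is i.+1 then
    if odd n == odd j then 2 * \sum_(1 <= y < n) al i y / y%:R else 0
  else if odd n then 0 else e n.

Definition sg (n : nat) : R := (-1) ^+ n./2.

Lemma al_parity j n : odd n != odd j -> al j n = 0.
Proof. by case: j => [|j] /=; [case: odd|move=> /negbTE ->]. Qed.

Lemma sum0_sum1 (F : nat -> R) n : \sum_(1 <= y < n) F y / y%:R = \sum_(0 <= y < n) F y / y%:R.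
Proof.
by case: n => [|n]; [rewrite !big_geq|rewrite [RHS]big_ltn // invr0 mulr0 add0r].
Qed.

(** The coefficient of y^(n+1) in (1 + y^2) phi_{j+1}'(y) = (-1)^j 2 phi_j(y), which is the
    differentiation rule in t for y = tan t. *)
Lemma al_step j n : sg n * al j.+1 n + sg n.+2 * al j.+1 n.+2 =
  (-1) ^+ j * 2 * (sg n.+1 * al j n.+1 / n.+1%:R).
Proof.
have sg2 : sg n.+2 = - sg n by rewrite /sg /= exprS mulN1r.
have [pn|pn] := eqVneq (odd n) (odd j.+1); last first.
  rewrite !(@al_parity j.+1) //=; last by rewrite negbK.
  rewrite (@al_parity j n.+1) ?mulr0 ?mul0r ?addr0 ?mulr0 //=.
  by move: pn => /=; case: (odd n); case: (odd j).
have sg1 : sg n.+1 = - (-1) ^+ j * sg n.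
  rewrite /sg /= uphalf_half exprD -[(-1) ^+ j]signr_odd.
  by move: pn => /= ->; case: (odd j) => /=; rewrite ?expr0 ?expr1; ring.
have pj : al j n = 0 by apply: al_parity; rewrite pn /=; case: (odd j).
have pn2 : odd n.+2 = odd j.+1 by rewrite /= negbK.
rewrite [al j.+1 n]/= [al j.+1 n.+2]/= negbK -[~~ odd j]/(odd j.+1) pn eqxx.
rewrite !sum0_sum1 [in sg n.+2 * _]big_nat_recr //= big_nat_recr //= pj mul0r addr0.
have s2 := @sqr_sign R j.
rewrite sg2 sg1; transitivity (- sg n * 2 * (al j n.+1 / n.+1%:R) * ((-1) ^+ j * (-1) ^+ j)); last by ring.
by rewrite s2; ring.
Qed.

Lemma al_small j : al j.+1 0 = 0 /\ al j.+1 1 = 0.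
Proof. by split; rewrite /=; case: eqP => // _; rewrite big_geq // mulr0. Qed.

Definition phiy j N (y : R) : R := \sum_(1 <= n < N.+1) sg n * al j n * (y ^+ n / n%:R).

Lemma phiyS j N y : phiy j N.+1 y = phiy j N y + sg N.+1 * al j N.+1 * (y ^+ N.+1 / N.+1%:R).
Proof. by rewrite /phiy big_nat_recr. Qed.

(** Differentiating the truncated series lowers its truncation by one and leaves two terms of top
    degree; these are the error controlled in [cmp_step]. *)
Lemma phiy_der j N y :
  \sum_(1 <= n < N.+2) sg n * al j.+1 n * (y ^+ n.-1 * (1 + y ^+ 2)) =
  (-1) ^+ j * (2 * phiy j N y) +
  (sg N.+1 * al j.+1 N.+1 * y ^+ N.+2 + sg N * al j.+1 N * y ^+ N.+1).
Proof.
elim: N => [|N IH].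
  by rewrite big_nat1 /phiy big_geq // (al_small j).1 (al_small j).2; ring.
rewrite big_nat_recr // IH phiyS -[N.+2.-1]/(N.+1).
have := al_step j N.
move: (al j.+1 N) (al j.+1 N.+2) (al j N.+1) (N.+1%:R^-1 : R) (phiy j N y) => a b c d p h.
have -> : y ^+ N.+3 = y ^+ N.+1 * y ^+ 2 by rewrite -exprD addn2.
have -> : (-1) ^+ j * (2 * (p + sg N.+1 * c * (y ^+ N.+1 * d))) =
   (-1) ^+ j * (2 * p) + y ^+ N.+1 * ((-1) ^+ j * 2 * (sg N.+1 * c * d)) by ring.
by rewrite -h; set z := y ^+ N.+1; rewrite -/z /=; ring.
Qed.

(** Growth slower than any exponential, each level costing a geometric sum, whence 2 / (s - 1). It
    makes the power series converge for |y| < 1. *)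
Lemma al_growth (s : R) j n : 1 < s -> `|al j n| <= (2 / (s - 1)) ^+ j * s ^+ n.
Proof.
move=> s1; have s0 : 0 < s - 1 by lra.
have c0 : 0 <= 2 / (s - 1) by rewrite divr_ge0 //; lra.
have sn k : 1 <= s ^+ k by rewrite exprn_ege1 //; lra.
elim: j n => [|j IH] n /=.
  rewrite expr0 mul1r; case: odd; first by rewrite normr0; apply: le_trans (sn n); lra.
  exact: le_trans (e1 n) (sn n).
have r0 : 0 <= (2 / (s - 1)) ^+ j.+1 * s ^+ n.
  by rewrite mulr_ge0 ?exprn_ge0 //; have := sn n; lra.
case: ifP => _; last by rewrite normr0.
rewrite normrM ger0_norm //.
apply: (@le_trans _ _ (2 * ((2 / (s - 1)) ^+ j * \sum_(1 <= y < n) s ^+ y))).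
  rewrite ler_wpM2l // (le_trans (ler_norm_sum _ _ _)) // mulr_sumr.
  rewrite big_nat [leRHS]big_nat ler_sum // => y /andP[y0 _].
  rewrite normrM [X in _ * X]ger0_norm ?invr_ge0 // ler_pdivrMr ?ltr0n //.
  apply: (le_trans (IH y)); rewrite ler_peMr ?ler1n // mulr_ge0 ?exprn_ge0 //.
  by have := sn y; lra.
have geo : \sum_(1 <= y < n) s ^+ y <= s ^+ n / (s - 1).
  elim: n {r0} => [|n IHn]; first by rewrite big_geq // divr_ge0 ?exprn_ge0 //; lra.
  case: n IHn => [|n] IHn; first by rewrite big_geq // divr_ge0 ?exprn_ge0 //; lra.
  rewrite big_nat_recr //=; apply: (le_trans (lerD IHn (lexx _))).
  by rewrite [in leRHS]exprS le_eqVlt; apply/orP; left; apply/eqP; field; lra.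
apply: (le_trans (ler_wpM2l _ (ler_wpM2l _ geo))) => //; first by rewrite exprn_ge0.
by rewrite exprS le_eqVlt; apply/orP; left; apply/eqP; field; lra.
Qed.

Lemma tail_inv_sqr y N : (0 < y)%N -> \sum_(y.+1 <= n < N.+1) (n%:R ^- 2 : R) <= y%:R^-1.
Proof.
move=> y0; case: (leqP N y) => [Ny|yN]; first by rewrite big_geq // invr_ge0.
suff : \sum_(y.+1 <= n < N.+1) (n%:R ^- 2 : R) <= y%:R^-1 - N%:R^-1.
  by move=> h; apply: le_trans h _; rewrite gerBl invr_ge0.
have yR : 1 <= y%:R :> R by rewrite ler1n.
move: yN => /subnK <-; elim: (N - y.+1)%N => [|d IH].
  rewrite add0n big_nat1 -natr1; move: (y%:R : R) yR => x x1.
  rewrite -subr_ge0 (_ : _ - _ = (x * (x + 1) ^+ 2)^-1).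
    by rewrite invr_ge0 mulr_ge0 ?exprn_ge0; lra.
  by field; apply/andP; split; apply: lt0r_neq0; lra.
rewrite addSn big_nat_recr /=; last by lia.
apply: (le_trans (lerD IH (lexx _))).
have : 1 <= (d + y.+1)%:R :> R by rewrite ler1n; lia.
rewrite -natr1; move: ((d + y.+1)%:R : R) => x x1.
rewrite -subr_ge0 (_ : _ - _ = (x * (x + 1) ^+ 2)^-1).
  by rewrite invr_ge0 mulr_ge0 ?exprn_ge0; lra.
by field; apply/and3P; split; apply: lt0r_neq0; lra.
Qed.

Lemma al_summable j N : \sum_(1 <= n < N.+1) `|al j n| / n%:R ^+ 2 <= 2 ^+ j * 2.
Proof.
elim: j N => [|j IH] N.
  rewrite expr0 mul1r; apply: le_trans (sum_inv_sqr_le N).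
  apply: ler_sum => n _; rewrite ler_piMl ?invr_ge0 ?exprn_ge0 //=.
  by case: odd; rewrite ?normr0.
apply: (@le_trans _ _ (2 * \sum_(1 <= y < N.+1) `|al j y| / y%:R ^+ 2)); last first.
  by rewrite exprS -mulrA ler_wpM2l.
apply: (@le_trans _ _ (\sum_(1 <= n < N.+1) \sum_(1 <= y < n) 2 * (`|al j y| / y%:R) / n%:R ^+ 2)).
  apply: ler_sum => n _; rewrite -mulr_suml ler_wpM2r ?invr_ge0 ?exprn_ge0 //=.
  case: ifP => _; last first.
    by rewrite normr0; apply: sumr_ge0 => y _; rewrite !mulr_ge0 ?invr_ge0.
  rewrite normrM ger0_norm // -mulr_sumr ler_wpM2l // (le_trans (ler_norm_sum _ _ _)) //.
  by apply: ler_sum => y _; rewrite normrM [`|_^-1|]ger0_norm ?invr_ge0.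
rewrite (sum_swap (fun n y => 2 * (`|al j y| / y%:R) / n%:R ^+ 2)) mulr_sumr.
rewrite big_nat [leRHS]big_nat; apply: ler_sum => y /andP[y0 _].
rewrite -mulr_sumr -mulrA ler_wpM2l // expr2 invfM mulrA ler_wpM2l ?mulr_ge0 ?invr_ge0 //.
exact: tail_inv_sqr.
Qed.

End NestedSums.

(** * Fourier expansion of the iterated integrals *)

Section TaylorRemainders.
Context {R : realType}.
Implicit Types (c x t : R).

Definition trw (j l : nat) : R := if odd l == odd j then (-1) ^+ l./2 / l`!%:R else 0.

(* The remainder of order j of the Taylor expansion at 0 of cos (j even) or sin (j odd). *)
Definition trT (j : nat) x : R :=
  (if odd j then sin x else cos x) - \sum_(0 <= l < j.+1) trw j l * x ^+ l.

Lemma trwS j l : trw j.+1 l.+1 * l.+1%:R = (-1) ^+ j * trw j l.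
Proof.
rewrite /trw /= (inj_eq negb_inj); case: eqP => [e|_]; last by rewrite mul0r mulr0.
have f0 : l`!%:R != 0 :> R by rewrite pnatr_eq0 -lt0n fact_gt0.
have l0 : l.+1%:R != 0 :> R by rewrite pnatr_eq0.
rewrite factS natrM invfM uphalf_half exprD e signr_odd; move: (l.+1%:R : R) l0 => z z0.
by field; rewrite f0 z0.
Qed.

Lemma trT0 j : trT j 0 = 0.
Proof.
rewrite /trT sin0 cos0 big_ltn // big_add1 big1 => [|l _]; last by rewrite expr0n mulr0.
by rewrite addr0 expr0 mulr1 /trw /=; case: (odd j); rewrite ?subr0 // fact0 expr0 divr1 subrr.
Qed.

Lemma der_trT j c t : is_derive t 1 (fun t => trT j.+1 (c * t)) ((-1) ^+ j * (c * trT j (c * t))).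
Proof.
have -> : (-1) ^+ j * (c * trT j (c * t)) =
  (-1) ^+ j * (c * (if odd j then sin (c * t) else cos (c * t))) -
  \sum_(0 <= l < j.+2) trw j.+1 l * (l%:R * (c * t) ^+ l.-1 * (c * 1)).
  rewrite big_ltn // mul0r mul0r mulr0 add0r big_add1 /= /trT !mulrBr; congr (_ - _).
  rewrite !mulr_sumr; apply: eq_bigr => l _.
  transitivity ((-1) ^+ j * trw j l * (c * (c * t) ^+ l)); first by ring.
  by rewrite -trwS; ring.
apply: derB.
  rewrite -[(-1) ^+ j]signr_odd /=; case: (odd j) => /=.
    by apply: (der_eq (der_cosZ c t)); ring.
  by apply: (der_eq (der_sinZ c t)); ring.
apply: der_sum_nat => l _; apply: derZ; apply: derX; apply: derZ; exact: der_id.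
Qed.

(** The iterated primitives of a cosine minus 1 that vanish at 0 are Taylor remainders. [kk] is 1
    for log cos t and 2 for log cos 2t; the power of kk k is chosen so that differentiation gives
    the factor 2 of [phiy_der] for either [kk]. *)
Definition fseries (j : nat) (kk : R) (N : nat) t : R :=
  \sum_(1 <= k < N.+1) (-1) ^+ k / k%:R * ((kk * k%:R) ^- j * trT j (2 * kk * k%:R * t)).

Lemma fseries0 j kk N : fseries j kk N 0 = 0.
Proof. by rewrite /fseries big1 // => k _; rewrite mulr0 trT0 !mulr0. Qed.

Lemma der_fseries j kk N t : kk != 0 ->
  is_derive t 1 (fseries j.+1 kk N) ((-1) ^+ j * (2 * fseries j kk N t)).
Proof.
move=> kk0; rewrite /fseries !mulr_sumr; apply: der_sum_nat => k /andP[k0 _].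
have kR : k%:R != 0 :> R by rewrite pnatr_eq0 -lt0n.
apply: (der_eq (derZ _ (derZ _ (der_trT j _ t)))).
have kj : (kk * k%:R) ^+ j != 0 by rewrite expf_neq0 // mulf_neq0.
by rewrite exprS; move: ((kk * k%:R) ^+ j) kj => z z0; field; rewrite kR z0 kk0.
Qed.

Lemma trT_0 x : trT 0 x = cos x - 1.
Proof. by rewrite /trT big_nat1 /trw /= fact0 divr1 expr0 mulr1. Qed.

Lemma der_fseries0 kk N t :
  is_derive t 1 (fseries 0 kk N)
    (- (kk * \sum_(1 <= k < N.+1) (-1) ^+ k * (2 * sin (2 * k%:R * (kk * t))))).
Proof.
rewrite /fseries mulr_sumr -sumrN; apply: der_sum_nat => k /andP[k0 _].
have kR : k%:R != 0 :> R by rewrite pnatr_eq0 -lt0n.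
have -> : (fun t => (-1) ^+ k / k%:R * ((kk * k%:R) ^- 0 * trT 0 (2 * kk * k%:R * t))) =
  (fun t => (-1) ^+ k / k%:R * (cos (2 * kk * k%:R * t) - 1)).
  by apply/funext => x; rewrite expr0 invr1 mul1r trT_0.
apply: (der_eq (derZ _ (derB (der_cosZ _ t) (der_cst 1 t)))).
have -> : 2 * k%:R * (kk * t) = 2 * kk * k%:R * t by ring.
by field.
Qed.

Lemma der_ln_cos t : 0 < cos t -> is_derive t 1 (fun t => ln (cos t)) (- tan t).
Proof.
move=> ct; apply: (der_eq (der_comp (is_derive1_ln ct) (is_derive_cos t))).
by rewrite /tan mulrN mulrC.
Qed.

(** The derivative of the difference is the oscillating term of [dirichlet_sin]; subtracting [h],
    its leading primitive, leaves a derivative of order 1/N, uniformly because cos t >= cos b. Any b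
    < pi/2 is allowed since log cos 2t has to be reached too. *)
Lemma lncos_bound b : 0 <= b -> b < pi / 2 -> exists2 C : R, 0 <= C &
  forall N t, 0 <= t <= b -> `|fseries 0 1 N t + ln (cos t)| <= C / N.+1%:R.
Proof.
move=> b0 bpi; set c0 := cos b.
have cc t : 0 <= t <= b -> c0 <= cos t.
  move=> /andP[t0]; rewrite le_eqVlt => /predU1P[->//|tb].
  by rewrite ltW // ltr_cos // in_itv /=; have := pi_gt0 R; lra.
have c00 : 0 < c0 by apply: cos_gt0_pihalf; have := pi_gt0 R; lra.
exists (c0 ^- 2 * b + 2 * c0^-1).
  by rewrite addr_ge0 ?mulr_ge0 ?invr_ge0 ?exprn_ge0 ?(ltW c00).
move=> N t tb.
have cpos x : 0 <= x <= b -> 0 < cos x by move=> /cc; exact: lt_le_trans.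
pose cN : R := 2 * N%:R + 1.
have Nge : 0 <= N%:R :> R by [].
have cN1 : N.+1%:R <= cN by rewrite /cN -natr1; lra.
have cN0 : 0 < cN by rewrite /cN; lra.
pose h x : R := (-1) ^+ N * ((cos x)^-1 * (cos (cN * x) / cN)).
have hb x : 0 <= x <= b -> `|h x| <= c0^-1 * cN^-1.
  move=> xb; rewrite /h; apply: norm_mul_le1; first by rewrite normrX normrN1 expr1n.
  rewrite normrM ler_pM //.
    have cx := cpos x xb.
    by rewrite ger0_norm ?invr_ge0 ?(ltW cx) // lef_pV2 ?posrE ?cc.
  rewrite normrM [X in _ * X]ger0_norm ?invr_ge0 ?(ltW cN0) //.
  by rewrite ler_piMl ?cos_max // invr_ge0 ltW.
pose g x : R := fseries 0 1 N x + ln (cos x) - h x + h 0.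
have dg x : 0 <= x <= b -> is_derive x 1 g
    (- ((-1) ^+ N * ((cos x) ^- 2 * sin x * (cos (cN * x) / cN)))).
  move=> xb; have cx := cpos x xb; have cx0 : cos x != 0 by rewrite gt_eqF.
  apply: (der_eq (derD (derB (derD (der_fseries0 1 N x) (der_ln_cos cx))
    (derZ _ (derM (derV cx0 (is_derive_cos x)) (derM (der_cosZ cN x) (der_cst cN^-1 x)))))
    (der_cst (h 0) x))).
  rewrite !mul1r dirichlet_sin // -/cN; field.
  by rewrite cx0 gt_eqF.
have bound : `|g t| <= c0 ^- 2 / cN * t.
  apply: (@der_bound _ g (fun x => c0 ^- 2 / cN * x) _ (fun=> c0 ^- 2 / cN) b
    (fun x hx => dg x (ltac:(lra))) _ _ _ _ _ t tb).
  - by move=> x _; apply: (der_eq (derZ _ (der_id x))); exact: mulr1.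
  - by apply: der_within => x; exact: dg.
  - by apply: der_within => x _; apply: derZ.
  - move=> x xb; have {}xb : 0 <= x <= b by lra.
    rewrite normrN; apply: norm_mul_le1; first by rewrite normrX normrN1 expr1n.
    rewrite normrM ler_pM //.
      rewrite mulrC; apply: norm_mul_le1; first exact: sin_max.
      have cx := cpos x xb.
      rewrite ger0_norm ?invr_ge0 ?exprn_ge0 ?(ltW cx) //.
      rewrite lef_pV2 ?posrE ?exprn_gt0 //.
      by apply: lerXn2r; rewrite ?nnegrE ?(ltW cx) ?(ltW c00) ?cc.
    rewrite normrM [X in _ * X]ger0_norm ?invr_ge0 ?(ltW cN0) //.
    by rewrite ler_piMl ?cos_max // invr_ge0 ltW.
  - by rewrite /g fseries0 cos0 ln1 !addr0 add0r addNr normr0 mulr0.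
have h0b : `|h 0| <= c0^-1 * cN^-1 by apply: hb; rewrite lexx b0.
have htb := hb t tb.
have -> : fseries 0 1 N t + ln (cos t) = g t + h t - h 0 by rewrite /g; ring.
have c2 : 0 <= c0 ^- 2 by rewrite invr_ge0 exprn_ge0 // ltW.
apply: (@le_trans _ _ ((c0 ^- 2 * b + 2 * c0^-1) / cN)).
  have b2 : c0 ^- 2 / cN * t <= c0 ^- 2 / cN * b.
    by rewrite ler_wpM2l //; [rewrite divr_ge0 // ltW|lra].
  apply: (le_trans (ler_normB _ _)); apply: (le_trans (lerD (ler_normD _ _) (lexx _))).
  have -> : (c0 ^- 2 * b + 2 * c0^-1) / cN =
    c0 ^- 2 / cN * b + (c0^-1 * cN^-1 + c0^-1 * cN^-1) by ring.
  by move: bound h0b htb b2; move: (c0 ^- 2 / cN * t) (c0 ^- 2 / cN * b) (c0^-1 * cN^-1) => X Y Z *; lra.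
rewrite ler_wpM2l ?addr_ge0 ?mulr_ge0 ?invr_ge0 ?exprn_ge0 ?(ltW c00) //.
by rewrite lef_pV2 ?posrE ?ltr0n.
Qed.

End TaylorRemainders.

(** * Power series against Fourier series below pi/4 *)

Section Comparison.
Context {R : realType}.
Implicit Types (b t : R).

Definition small b (D : nat -> R -> R) := exists2 eps : nat -> R,
  eps @ \oo --> (0 : R) & forall N t, 0 <= t <= b -> `|D N t| <= eps N.

(** The factor tan t is a zero at 0 which later cancels the pole of 2 / sin 2t. *)
Definition smalltan b (D : nat -> R -> R) := exists2 eps : nat -> R,
  eps @ \oo --> (0 : R) & forall N t, 0 <= t <= b -> `|D N t| <= eps N * tan t.

Lemma smalltanW b D : b <= qp -> smalltan b D -> small b D.
Proof.
move=> ba [eps e0 h]; exists (fun N => `|eps N|); first by apply/norm_cvg0P.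
move=> N t tb; have tq : 0 <= t <= qp by lra.
apply: (le_trans (h N t tb)); have y0 := tan_ge0 tq; have y1 := tan_le1 tq.
apply: (@le_trans _ _ (`|eps N| * tan t)); first by rewrite ler_wpM2r // ler_norm.
by rewrite ler_piMr.
Qed.

Variables (e : nat -> R) (c : R).
Hypothesis e1 : forall n, `|e n| <= 1.

(** For j = 0 the limit is log cos t when c = 0, and log cos t - (1/2) log cos 2t when c = 1. *)
Definition fourier j N t : R := - fseries j 1 N t + c / 2 * fseries j 2 N t.

Lemma der_fourier j N t :
  is_derive t 1 (fourier j.+1 N) ((-1) ^+ j * (2 * fourier j N t)).
Proof.
have two0 : 2 != 0 :> R by rewrite pnatr_eq0.
apply: (der_eq (derD (derN (der_fseries j N t (oner_neq0 R)))
  (derZ (c / 2) (der_fseries j N t two0)))).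
by rewrite /fourier; ring.
Qed.

Lemma fourier0 j N : fourier j N 0 = 0.
Proof. by rewrite /fourier !fseries0 oppr0 mulr0 addr0. Qed.

Lemma der_phiy_tan j N t : cos t != 0 ->
  is_derive t 1 (fun t => phiy e j N (tan t))
    (\sum_(1 <= n < N.+1) sg n * al e j n * (tan t ^+ n.-1 * (1 + tan t ^+ 2))).
Proof.
move=> ct; apply: der_sum_nat => n /andP[n0 _]; apply: derZ.
have nR : n%:R != 0 :> R by rewrite pnatr_eq0 -lt0n.
apply: (der_eq (derM (derX n (der_tan ct)) (der_cst n%:R^-1 t))).
by move: (n%:R : R) nR => z z0; field.
Qed.

Lemma phiy0 j N : phiy e j N 0 = 0.
Proof. by rewrite /phiy big_nat big1 // => n /andP[n0 _]; rewrite expr0n gtn_eqF // mul0r mulr0. Qed.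

Lemma norm_sg n : `|sg n : R| <= 1.
Proof. by rewrite normrX normrN1 expr1n. Qed.

Lemma al_geom_cvg j (rho : R) : 0 <= rho < 1 ->
  (fun n => `|al e j n| * rho ^+ n) @ \oo --> (0 : R).
Proof.
(* This s satisfies both s > 1 and s rho < 1, so the growth allowed by [al_growth] is beaten by
   rho^n. *)
move=> hr; pose s := 2 / (1 + rho).
have s1 : 1 < s by rewrite /s ltr_pdivlMr; lra.
have sr : `|s * rho| < 1.
  rewrite ger0_norm; last by rewrite mulr_ge0; lra.
  by rewrite /s mulrAC ltr_pdivrMr; lra.
apply: (@cvg0_le _ _ (fun n => (2 / (s - 1)) ^+ j * (s * rho) ^+ n)); last first.
  by apply: cvg_scale; apply: cvg_expr.
move=> n; rewrite normrM normr_id [X in _ * X]ger0_norm ?exprn_ge0; [|lra..].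
by rewrite [(s * rho) ^+ n]exprMn mulrA ler_wpM2r ?exprn_ge0 ?al_growth //; lra.
Qed.

(** The power series is truncated at N + j because each differentiation lowers the truncation by
    one, while the Fourier truncation N stays fixed. *)
Let cmp j N t : R := phiy e j (N + j) (tan t) - fourier j N t.

(** Both functions vanish at 0 and obey the same derivative recursion, except for the two top-degree
    terms, which are geometrically small as tan b < 1. A constant bound on the derivative is at most
    that constant times 1 + tan^2, the derivative of tan; hence the gain of a factor tan t. *)
Lemma cmp_step j b : 0 <= b -> b < qp -> small b (cmp j) -> smalltan b (cmp j.+1).
Proof.
move=> b0 bq [eps eps0 h]; set rho := tan b.
have bq' : 0 <= b <= qp by lra.
have r0 : 0 <= rho by apply: tan_ge0.
have r1 : rho < 1 by rewrite -tan_qp tan_mono.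
have yr t : 0 <= t <= b -> tan t <= rho.
  by move=> /andP[t0]; rewrite le_eqVlt => /predU1P[->//|tb]; rewrite ltW // tan_mono // ltW.
pose r N : R := `|al e j.+1 (N + j).+1| * rho ^+ (N + j).+1 + `|al e j.+1 (N + j)| * rho ^+ (N + j).
exists (fun N => 2 * eps N + r N).
  rewrite -(addr0 0); apply: cvg_add; first exact: cvg_scale.
  have hg := @al_geom_cvg j.+1 rho (ltac:(lra)).
  rewrite -(addr0 0); apply: cvg_add.
    by apply: (cvg_sub (s := fun N => (N + j).+1) _ hg) => n; lia.
  by apply: (cvg_sub (s := fun N => (N + j)%N) _ hg) => n; lia.
move=> N t tb.
pose D' t : R := (-1) ^+ j * (2 * cmp j N t) +
  (sg (N + j).+1 * al e j.+1 (N + j).+1 * tan t ^+ (N + j).+2 +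
   sg (N + j) * al e j.+1 (N + j) * tan t ^+ (N + j).+1).
have dD x : 0 <= x <= b -> is_derive x 1 (cmp j.+1 N) (D' x).
  move=> xb; have cx : cos x != 0 by apply: cos_neq0_qp; lra.
  rewrite /cmp addnS; apply: (der_eq (derB (der_phiy_tan _ _ cx) (der_fourier j N x))).
  by rewrite phiy_der /D' /cmp; ring.
have dg x : 0 <= x <= b -> is_derive x 1 (fun t => (2 * eps N + r N) * tan t)
    ((2 * eps N + r N) * (1 + tan x ^+ 2)).
  by move=> xb; apply: derZ; apply: der_tan_qp; lra.
apply: (@der_bound _ (cmp j.+1 N) (fun t => (2 * eps N + r N) * tan t) D' _ b
   (fun x hx => dD x (ltac:(lra))) (fun x hx => dg x (ltac:(lra)))
   (der_within dD) (der_within dg) _ _ t tb); last first.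
  by rewrite /cmp tan0 phiy0 fourier0 subrr normr0 mulr0.
move=> x hx; have xb : 0 <= x <= b by lra.
have y0 : 0 <= tan x by apply: tan_ge0; lra.
have y1 := yr x xb.
have bnd : `|D' x| <= 2 * eps N + r N.
  rewrite /D'; apply: (le_trans (ler_normD _ _)); apply: lerD.
    apply: norm_mul_le1; first by rewrite normrX normrN1 expr1n.
    by rewrite normrM ger0_norm // ler_wpM2l // h.
  apply: (le_trans (ler_normD _ _)); rewrite /r; apply: lerD; rewrite -mulrA;
    (apply: norm_mul_le1; first exact: norm_sg); rewrite normrM ler_wpM2l //;
    rewrite ger0_norm ?exprn_ge0 // exprS.
    apply: (@le_trans _ _ (1 * tan x ^+ (N + j).+1)).
      by rewrite ler_wpM2r ?exprn_ge0 //; lra.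
    by rewrite mul1r lerXn2r ?nnegrE.
  apply: (@le_trans _ _ (1 * tan x ^+ (N + j))).
    by rewrite ler_wpM2r ?exprn_ge0 //; lra.
  by rewrite mul1r lerXn2r ?nnegrE.
apply: (le_trans bnd); rewrite ler_peMr ?lerDl ?sqr_ge0 //.
exact: le_trans (normr_ge0 _) bnd.
Qed.

Lemma cmp_all j b : 0 <= b -> b < qp -> small b (cmp 0) -> smalltan b (cmp j.+1).
Proof.
move=> b0 bq h0; elim: j => [|j IH]; first exact: cmp_step.
by apply: cmp_step => //; apply: smalltanW => //; exact: ltW.
Qed.

End Comparison.

Section BaseCases.
Context {R : realType}.
Implicit Types (b t : R).

Lemma base_sum_triv N (y : R) :
  \sum_(1 <= n < N.+1) sg n * al triv 0 n * (y ^+ n.-1 * (1 + y ^+ 2)) =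
  - y + (-1) ^+ N./2 * y ^+ (2 * N./2).+1.
Proof.
elim: N => [|N IH]; first by rewrite big_geq //=; ring.
rewrite big_nat_recr // IH /sg /al /=; case: (boolP (odd N)) => oN /=.
  rewrite uphalf_half oN add1n /triv (_ : (2 * N./2.+1).+1 = (2 * N./2).+3)%N; last by lia.
  have -> : y ^+ N = y ^+ (2 * N./2).+1 by congr (_ ^+ _); lia.
  by rewrite /= !exprS; ring.
by rewrite uphalf_half (negbTE oN) add0n /=; ring.
Qed.

Lemma base_sum_sg N (y : R) : y ^+ 2 != 1 ->
  \sum_(1 <= n < N.+1) sg n * al sg 0 n * (y ^+ n.-1 * (1 + y ^+ 2)) =
  (1 + y ^+ 2) * (y - y ^+ (2 * N./2).+1) / (1 - y ^+ 2).
Proof.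
move=> y1; have y2 : 1 - y ^+ 2 != 0 by rewrite subr_eq0 eq_sym.
elim: N => [|N IH]; first by rewrite big_geq //= expr1 subrr mulr0 mul0r.
rewrite big_nat_recr // IH /al /=; case: (boolP (odd N)) => oN /=.
  have -> : sg N.+1 * sg N.+1 = 1 :> R by exact: sqr_sign.
  rewrite uphalf_half oN add1n (_ : (2 * N./2.+1).+1 = (2 * N./2).+3)%N; last by lia.
  have -> : y ^+ N = y ^+ (2 * N./2).+1 by congr (_ ^+ _); lia.
  by rewrite /= !exprS; field; rewrite -?expr2.
by rewrite uphalf_half (negbTE oN) add0n /=; ring.
Qed.

End BaseCases.

Section SmallBase.
Context {R : realType}.
Implicit Types (b t : R).

Lemma cvg_geom_lin (K C rho : R) : 0 <= rho < 1 ->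
  (fun N => K * rho ^+ N + C * N.+1%:R^-1) @ \oo --> (0 : R).
Proof.
move=> hr; rewrite -(addr0 0); apply: cvg_add; last first.
  by apply: cvg_scale; exact: cvg_invS.
by apply: cvg_scale; apply: cvg_expr; rewrite ger0_norm; lra.
Qed.

Lemma tan_le_end b t : b < qp -> 0 <= t <= b -> 0 <= tan t <= tan b.
Proof.
move=> bq ht; rewrite tan_ge0 /=; last by lra.
move: ht => /andP[t0]; rewrite le_eqVlt => /predU1P[->//|tb].
by rewrite ltW // tan_mono // ltW.
Qed.

Lemma tan_end b : 0 <= b -> b < qp -> 0 <= tan b < 1.
Proof.
by move=> b0 bq; rewrite -[X in _ < X]tan_qp tan_mono // tan_ge0 // b0 ltW.
Qed.

Lemma tan_pow_end b N t : 0 <= b -> b < qp -> 0 <= t <= b ->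
  0 <= tan t ^+ (2 * N./2).+1 <= tan b ^+ N.
Proof.
move=> b0 bq ht; have /andP[y0 y1] := tan_le_end bq ht; have /andP[r0 r1] := tan_end b0 bq.
rewrite exprn_ge0 //=; apply: (@le_trans _ _ (tan t ^+ N)).
  by apply: ler_wiXn2l => //; [lra|lia].
by apply: lerXn2r; rewrite ?nnegrE.
Qed.

(** The level-0 series sums to - (1/2) log(1 + tan^2 t) = log cos t. *)
Lemma small_triv b : 0 <= b -> b < qp -> small b (fun N t => phiy triv 0 (N + 0) (tan t) - fourier 0 0 N t).
Proof.
move=> b0 bq; have pi0 := pi_gt0 R; have qpE : qp = pi / 4 :> R by [].
have b_pihalf : b < pi / 2 by lra.
have b_le1 t : 0 <= t <= b -> t <= 1 by have := @qp_lt1 R; lra.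
have /andP[r0 r1] := tan_end b0 bq.
have yr t := @tan_le_end b t bq; have ypow N t := @tan_pow_end b N t b0 bq.
have tb t : 0 <= t <= b -> 0 <= t <= qp by lra.
have [C C0 hC] := lncos_bound b0 b_pihalf.
set rho := tan b in r0 r1 yr ypow *.
have hrho : 0 <= rho < 1 by rewrite r0.
exists (fun N => 1 * rho ^+ N + C * N.+1%:R^-1); first exact: cvg_geom_lin.
move=> N t ht; rewrite addn0.
have -> : phiy triv 0 N (tan t) - fourier 0 0 N t =
  (phiy triv 0 N (tan t) - ln (cos t)) + (fseries 0 1 N t + ln (cos t)).
  by rewrite /fourier; ring.
apply: (le_trans (ler_normD _ _)); apply: lerD; last exact: hC.
pose D' t : R := (-1) ^+ N./2 * tan t ^+ (2 * N./2).+1.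
have dD x : 0 <= x <= b -> is_derive x 1 (fun t => phiy triv 0 N (tan t) - ln (cos t)) (D' x).
  move=> xb; have cx := cos_gt0_qp (tb _ xb).
  apply: (der_eq (derB (der_phiy_tan triv 0 N (lt0r_neq0 cx)) (der_ln_cos cx))).
  by rewrite base_sum_triv /D'; ring.
have dg x : 0 <= x <= b -> is_derive x 1 (fun t => rho ^+ N * t) (rho ^+ N * 1).
  by move=> _; apply: derZ.
apply: (@le_trans _ _ (rho ^+ N * t)); last first.
  by rewrite mul1r ler_piMr ?exprn_ge0 ?b_le1.
apply: (@der_bound _ _ (fun t => rho ^+ N * t) D' _ b
   (fun x hx => dD x (ltac:(lra))) (fun x hx => dg x (ltac:(lra)))
   (der_within dD) (der_within dg) _ _ t ht); last first.
  by rewrite tan0 cos0 ln1 phiy0 subrr normr0 mulr0.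
move=> x hx; have xb : 0 <= x <= b by lra.
rewrite mulr1; apply: norm_mul_le1; first by rewrite normrX normrN1 expr1n.
by have /andP[h1 h2] := ypow N _ xb; rewrite ger0_norm.
Qed.

(** The sign [sg] squares away, so the level-0 series sums to - (1/2) log(1 - tan^2 t) = log cos t -
    (1/2) log cos 2t; this is the origin of c = 1 and of the frequency multiplier 2. *)
Lemma small_sg b : 0 <= b -> b < qp -> small b (fun N t => phiy sg 0 (N + 0) (tan t) - fourier 1 0 N t).
Proof.
move=> b0 bq; have pi0 := pi_gt0 R; have qpE : qp = pi / 4 :> R by [].
have b_pihalf : b < pi / 2 by lra.
have b_le1 t : 0 <= t <= b -> t <= 1 by have := @qp_lt1 R; lra.
have /andP[r0 r1] := tan_end b0 bq.
have yr t := @tan_le_end b t bq; have ypow N t := @tan_pow_end b N t b0 bq.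
have tb t : 0 <= t <= b -> 0 <= t <= qp by lra.
have [C C0 hC] := lncos_bound b0 b_pihalf.
set rho := tan b in r0 r1 yr ypow *.
have hrho : 0 <= rho < 1 by rewrite r0.
have [||C2 C20 hC2] := @lncos_bound _ (2 * b); [lra..|].
have r2 : 0 < 1 - rho ^+ 2 by rewrite subr_gt0 expr_lt1.
(* From 1 + tan^2 t <= 2 in the numerator and 1 - tan^2 t >= 1 - rho^2 in the denominator. *)
pose K := 2 / (1 - rho ^+ 2).
exists (fun N => K * rho ^+ N + (C + 2^-1 * C2) * N.+1%:R^-1); first exact: cvg_geom_lin.
move=> N t ht; rewrite addn0.
have f2 : fseries 0 2 N t = fseries 0 1 N (2 * t).
  rewrite /fseries; apply: eq_bigr => k _; rewrite !expr0.
  by congr (_ * (_ * trT _ _)); ring.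
have -> : phiy sg 0 N (tan t) - fourier 1 0 N t =
  (phiy sg 0 N (tan t) - (ln (cos t) - 2^-1 * ln (cos (2 * t)))) +
  ((fseries 0 1 N t + ln (cos t)) - 2^-1 * (fseries 0 1 N (2 * t) + ln (cos (2 * t)))).
  by rewrite /fourier f2; field.
apply: (le_trans (ler_normD _ _)); apply: lerD; last first.
  apply: (le_trans (ler_normB _ _)); rewrite [leRHS]mulrDl; apply: lerD; first exact: hC.
  rewrite normrM ger0_norm // -mulrA ler_wpM2l //.
  by apply: hC2; lra.
pose D' t : R := - ((1 + tan t ^+ 2) * tan t ^+ (2 * N./2).+1 / (1 - tan t ^+ 2)).
have cos2 x : 0 <= x <= b -> 0 < cos (2 * x).
  by move=> xb; apply: cos_gt0_pihalf; lra.
have dD x : 0 <= x <= b -> is_derive x 1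
   (fun t => phiy sg 0 N (tan t) - (ln (cos t) - 2^-1 * ln (cos (2 * t)))) (D' x).
  move=> xb; have cx := cos_gt0_qp (tb _ xb); have c2x := cos2 x xb.
  have /andP[y0 y1] := yr _ xb.
  have yne : tan x ^+ 2 != 1 by rewrite lt_eqF // expr_lt1 //; lra.
  have d2 := der_comp (der_ln_cos c2x) (derZ 2 (der_id x)).
  apply: (der_eq (derB (der_phiy_tan sg 0 N (lt0r_neq0 cx)) (derB (der_ln_cos cx) (derZ 2^-1 d2)))).
  have t2 : tan (2 * x) = 2 * tan x / (1 - tan x ^+ 2).
    by rewrite !mulr_natl tan_mulr2n // gt_eqF.
  rewrite base_sum_sg // t2 /D'; field.
  by rewrite subr_eq0 eq_sym.
have dg x : 0 <= x <= b -> is_derive x 1 (fun t => K * rho ^+ N * t) (K * rho ^+ N * 1).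
  by move=> _; apply: derZ.
have KN : 0 <= K * rho ^+ N by rewrite mulr_ge0 ?exprn_ge0 // divr_ge0 // ltW.
apply: (@le_trans _ _ (K * rho ^+ N * t)); last first.
  by rewrite ler_piMr ?b_le1.
apply: (@der_bound _ _ (fun t => K * rho ^+ N * t) D' _ b
   (fun x hx => dD x (ltac:(lra))) (fun x hx => dg x (ltac:(lra)))
   (der_within dD) (der_within dg) _ _ t ht); last first.
  by rewrite tan0 mulr0 cos0 ln1 phiy0 mulr0 !subrr normr0 mulr0.
move=> x hx; have xb : 0 <= x <= b by lra.
have /andP[y0 y1] := yr _ xb; have /andP[h1 h2] := ypow N _ xb.
have y2 : tan x ^+ 2 <= rho ^+ 2 by rewrite lerXn2r ?nnegrE.
have y3 : rho ^+ 2 <= 1 by rewrite exprn_ile1 // ltW.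
have y4 : 0 <= tan x ^+ 2 by rewrite sqr_ge0.
rewrite mulr1 /D' normrN ger0_norm; last by rewrite !mulr_ge0 ?invr_ge0 //; lra.
rewrite /K mulrAC; apply: ler_pM => //; rewrite ?mulr_ge0 ?invr_ge0 //; try lra.
by apply: ler_pM; rewrite ?invr_ge0 ?lef_pV2 ?posrE //; lra.
Qed.

End SmallBase.

(** * The outer integration against 2 / sin 2t *)

Section TopLevel.
Context {R : realType}.
Implicit Types (b t x : R).

(* The primitive of 2 (cos 2kt - 1) / sin 2t vanishing at 0; the recursion comes from
   cos 2(k+2)t - cos 2kt = - 2 sin 2(k+1)t sin 2t. *)
Fixpoint iq (k : nat) t {struct k} : R :=
  match k with
  | 0 => 0
  | 1 => 2 * ln (cos t)
  | k'.+2 => iq k' t + 2 * (cos (2 * k'.+1%:R * t) - 1) / k'.+1%:R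
  end.

Lemma nat_ind2 (P : nat -> Prop) : P 0 -> P 1 -> (forall k, P k -> P k.+2) -> forall k, P k.
Proof.
move=> p0 p1 pS k; suff : P k /\ P k.+1 by case.
by elim: k => [|k [IH1 IH2]]; split => //; exact: pS.
Qed.

Lemma iq0 k : iq k 0 = 0.
Proof.
elim/nat_ind2: k => [||k IH] //=; first by rewrite cos0 ln1 mulr0.
by rewrite IH mulr0 cos0 subrr mulr0 mul0r addr0.
Qed.

(* At t = 0 the formula holds because both sides vanish, with 0^-1 = 0. *)
Lemma der_iq k t : 0 <= t <= qp ->
  is_derive t 1 (iq k) ((cos (2 * k%:R * t) - 1) * ((tan t)^-1 + tan t)).
Proof.
move=> tq; have ct := cos_gt0_qp tq.
have [->|t0] := eqVneq t 0.
  rewrite mulr0 cos0 subrr mul0r.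
  elim/nat_ind2: k => [||k IH] /=; first exact: der_cst.
    have c0 : 0 < cos (0 : R) by rewrite cos0.
    by apply: (der_eq (derZ 2 (der_ln_cos c0))); rewrite tan0 oppr0 mulr0.
  have e : 2 * k.+1%:R * 0 = 0 :> R by rewrite mulr0.
  apply: (der_eq (derD IH (derM (derZ 2 (derB (der_cosZ (2 * k.+1%:R) 0) (der_cst 1 0))) (der_cst k.+1%:R^-1 0)))).
  by rewrite e sin0; ring.
have y0 : tan t != 0 by rewrite gt_eqF // tan_gt0 //; move: t0 tq; rewrite lt_neqAle eq_sym => ->.
have c0 : cos t != 0 by rewrite gt_eqF.
have s0 : sin t != 0 by move: y0; rewrite /tan mulf_eq0 negb_or => /andP[].
have yE : (tan t)^-1 + tan t = (sin t * cos t)^-1.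
  have h := cos2Dsin2 t; rewrite /tan -[RHS]mul1r -h; field.
  by rewrite c0 s0.
rewrite yE; elim/nat_ind2: k => [||k IH] /=.
- by apply: (der_eq (der_cst 0 t)); rewrite mulr0 mul0r cos0 subrr mul0r.
- apply: (der_eq (derZ 2 (der_ln_cos ct))).
  rewrite mulr1 (mulr_natl t) cos_mulr2n cos2sin2 /tan. field.
  by rewrite c0 s0.
have k0 : k.+1%:R != 0 :> R by rewrite pnatr_eq0.
apply: (der_eq (derD IH (derM (derZ 2 (derB (der_cosZ (2 * k.+1%:R) t) (der_cst 1 t))) (der_cst k.+1%:R^-1 t)))).
have -> : 2 * k%:R * t = 2 * k.+1%:R * t - (t + t) by rewrite -natr1; ring.
have -> : 2 * k.+2%:R * t = 2 * k.+1%:R * t + (t + t) by rewrite -(natr1 k.+1); ring.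
rewrite trigo.cosB (trigo.cosD _ (t + t)) (trigo.sinD t t); move: (k.+1%:R : R) k0 => z z0; field.
by rewrite c0 s0 z0.
Qed.

(** A crude linear bound, sufficient against the decay k^-(2m+1) with m >= 1. *)
Lemma iq_bound k t : 0 <= t <= qp -> `|iq k t| <= 4 * k%:R.
Proof.
move=> tq; have ct := cos_gt0_qp tq.
elim/nat_ind2: k => [||k IH] /=; first by rewrite normr0 mulr0.
  have c1 : ln (cos t) <= 0 by rewrite ln_le0 // cos_le1.
  have c2 : (cos t) ^- 2 <= 2.
    rewrite cos2_tan2 ?gt_eqF //; have y1 := tan_le1 tq; have y0 := tan_ge0 tq.
    have : tan t ^+ 2 <= 1 by rewrite exprn_ile1.
    by lra.
  have := @ln_sublinear R ((cos t) ^- 2).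
  rewrite lnV ?posrE ?exprn_gt0 // lnXn // invr_gt0 exprn_gt0 // => /(_ isT) h.
  rewrite normrM ger0_norm // ler0_norm //.
  by move: h; rewrite -mulr_natl => h; lra.
apply: (le_trans (ler_normD _ _)).
have : `|2 * (cos (2 * k.+1%:R * t) - 1) / k.+1%:R| <= 4.
  rewrite normrM [X in _ * X]ger0_norm ?invr_ge0 // ler_pdivrMr ?ltr0n // normrM ger0_norm //.
  have := cos_le1 (2 * k.+1%:R * t); have := cos_geN1 (2 * k.+1%:R * t).
  have : 1 <= k.+1%:R :> R by rewrite ler1n.
  move=> h1 h2 h3; apply: (@le_trans _ _ (2 * 2)); last by lra.
  by rewrite ler_wpM2l // ler_norml; apply/andP; split; lra.
have -> : k.+2%:R = k%:R + 2 :> R by rewrite -addn2 natrD.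
by lra.
Qed.

(** Splitting off the constant 1 makes every piece integrable against 2 / sin 2t near 0: cos x - 1
    leads to [iq], and the powers t^(2i), i >= 1, lead to the moments. *)
Lemma trT_even m x : trT (2 * m) x = cos x - 1 -
  \sum_(1 <= i < m.+1) (-1) ^+ i / (2 * i)`!%:R * x ^+ (2 * i).
Proof.
rewrite /trT (_ : odd (2 * m) = false); last by lia.
rewrite -addrA -opprD; congr (_ - _).
have w l : trw (2 * m) l = trw 0 l :> R by rewrite /trw (_ : odd (2 * m) = false) //; lia.
under eq_bigr do rewrite w.
elim: m {w} => [|m IH].
  by rewrite big_nat1 big_geq // addr0 /trw /= expr0 fact0 divr1 mulr1.
rewrite (_ : (2 * m.+1).+1 = (2 * m).+3)%N; last by lia.
rewrite big_nat_recr //= big_nat_recr //= IH [in RHS]big_nat_recr //= -!addrA; congr (_ + (_ + _)).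
rewrite {1}/trw ifF ?mul0r ?add0r /trw; last by rewrite /= ; lia.
rewrite ifT; last by rewrite /=; lia.
rewrite (_ : (2 * m).+2 = (2 * m.+1)%N); last by lia.
by rewrite (_ : (2 * m.+1)./2 = m.+1) //; lia.
Qed.

End TopLevel.

Section Outer.
Context {R : realType}.
Variables (e : nat -> R) (c : R) (m : nat) (mf : nat -> R -> R).
Hypothesis e1 : forall n, `|e n| <= 1.
Hypothesis m0 : (0 < m)%N.
Hypothesis mf0 : forall i, (0 < i)%N -> mf i 0 = 0.
Hypothesis mfC : forall i, (0 < i)%N -> {within `[0, qp], continuous (mf i)}.
Hypothesis mfD : forall i t, (0 < i)%N -> 0 < t < qp -> is_derive t 1 (mf i) (mint i t).
Hypothesis base : forall b, 0 <= b -> b < qp ->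
  small b (fun N t => phiy e 0 (N + 0) (tan t) - fourier c 0 N t).

Definition outer N (t : R) : R :=
  \sum_(1 <= n < N.+1) sg n * al e (2 * m) n * (tan t ^+ n / n%:R ^+ 2).

Definition outer_term (kk k : nat) (t : R) : R :=
  iq (kk * k) t - \sum_(1 <= i < m.+1)
    (-1) ^+ i / (2 * i)`!%:R * (2 * kk%:R * k%:R) ^+ (2 * i) * mf i t.

Definition outer_fourier (kk N : nat) (t : R) : R :=
  \sum_(1 <= k < N.+1) (-1) ^+ k / k%:R * ((kk%:R * k%:R) ^- (2 * m) * outer_term kk k t).

Definition outer_diff N (t : R) : R :=
  outer (N + 2 * m) t - (- outer_fourier 1 N t + c / 2 * outer_fourier 2 N t).

Lemma der_outer N t : 0 < t < qp ->
  is_derive t 1 (outer N) (phiy e (2 * m) N (tan t) * ((tan t)^-1 + tan t)).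
Proof.
move=> ht; have ct : cos t != 0 by apply: cos_neq0_qp; lra.
have y0 : tan t != 0 by rewrite gt_eqF // tan_gt0; lra.
rewrite /phiy mulr_suml; apply: der_sum_nat => n /andP[n0 _].
have nR : n%:R != 0 :> R by rewrite pnatr_eq0 -lt0n.
apply: (der_eq (derZ _ (derM (derX n (der_tan ct)) (der_cst (n%:R ^+ 2)^-1 t)))).
have -> : tan t ^+ n = tan t ^+ n.-1 * tan t by rewrite -exprSr prednK.
move: (n%:R : R) nR => z z0; field.
by rewrite z0 y0.
Qed.

Lemma der_outer_term kk k t : 0 < t < qp ->
  is_derive t 1 (outer_term kk k) (trT (2 * m) (2 * kk%:R * k%:R * t) * ((tan t)^-1 + tan t)).
Proof.
move=> ht; have tq : 0 <= t <= qp by lra.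
have dsum := @der_sum_nat R 1 m.+1 (fun i t => (-1) ^+ i / (2 * i)`!%:R * (2 * kk%:R * k%:R) ^+ (2 * i) * mf i t)
  (fun i => (-1) ^+ i / (2 * i)`!%:R * (2 * kk%:R * k%:R) ^+ (2 * i) * mint i t) t.
apply: (der_eq (derB (der_iq (kk * k) tq) (dsum _))).
  by move=> i /andP[i0 _]; apply: derZ; exact: mfD.
rewrite trT_even natrM [RHS]mulrBl; congr (_ - _).
  by congr ((cos _ - 1) * _); ring.
rewrite mulr_suml; apply: eq_bigr => i _.
by rewrite /mint [_ ^+ (2 * i) in RHS]exprMn; ring.
Qed.

Lemma der_outer_fourier kk N t : 0 < t < qp ->
  is_derive t 1 (outer_fourier kk N) (fseries (2 * m) kk%:R N t * ((tan t)^-1 + tan t)).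
Proof.
move=> ht; rewrite /fseries mulr_suml; apply: der_sum_nat => k /andP[k0 _].
by apply: (der_eq (derZ _ (derZ _ (der_outer_term kk k ht)))); ring.
Qed.

Lemma outer_zero N : outer N 0 = 0.
Proof.
by rewrite /outer big_nat big1 // => n /andP[n0 _]; rewrite tan0 expr0n gtn_eqF // mul0r mulr0.
Qed.

Lemma outer_fourier_zero kk N : outer_fourier kk N 0 = 0.
Proof.
rewrite /outer_fourier big1 // => k _; rewrite /outer_term iq0 big_nat big1.
  by rewrite subrr !mulr0.
by move=> i /andP[i0 _]; rewrite mf0 // mulr0.
Qed.

Lemma within_sum (r : seq nat) (F : nat -> R -> R) :
  (forall k, k \in r -> {within `[0, qp], continuous (F k)}) ->
  {within `[0, qp], continuous (fun t => \sum_(k <- r) F k t)}.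
Proof.
elim: r => [|k r IH] h.
  have -> : (fun t => \sum_(k <- [::]) F k t) = fun=> 0 by apply/funext => t; rewrite big_nil.
  by move=> t; exact: cvg_cst.
have -> : (fun t => \sum_(j <- k :: r) F j t) = fun t => F k t + \sum_(j <- r) F j t.
  by apply/funext => t; rewrite big_cons.
move=> t; apply: cvgD; first by apply: h; rewrite inE eqxx.
by apply: IH => j jr; apply: h; rewrite inE jr orbT.
Qed.

Lemma within_outer_fourier kk N : {within `[0, qp], continuous (outer_fourier kk N)}.
Proof.
apply: within_sum => k _ t; apply: cvgM; first exact: cvg_cst.
apply: cvgM; first exact: cvg_cst.
apply: cvgB; first exact: (der_within (@der_iq R (kk * k))).
apply: (within_sum (F := fun i t => (-1) ^+ i / (2 * i)`!%:R * (2 * kk%:R * k%:R) ^+ (2 * i) * mf i t)).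
move=> i; rewrite mem_index_iota => /andP[i0 _] {}t.
by apply: cvgM; [exact: cvg_cst|exact: mfC].
Qed.

Lemma within_outer N : {within `[0, qp], continuous (outer N)}.
Proof.
apply: within_sum => n _ t; apply: cvgM; first exact: cvg_cst.
apply: cvgM; last exact: cvg_cst.
have hn : {within `[0, qp], continuous (fun t : R => tan t ^+ n)}.
  apply: (der_within (f' := fun t => n%:R * tan t ^+ n.-1 * (1 + tan t ^+ 2))) => x xq.
  by apply: derX; exact: der_tan_qp.
exact: hn.
Qed.

Lemma within_outer_diff N : {within `[0, qp], continuous (outer_diff N)}.
Proof.
move=> t; apply: cvgB; first exact: within_outer.
apply: cvgD; first by apply: cvgN; exact: within_outer_fourier.
by apply: cvgM; [exact: cvg_cst|exact: within_outer_fourier].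
Qed.

(** [cmp_all] bounds the integrand's first factor by eps tan t, and tan t (1 / tan t + tan t) = 1 +
    tan^2 t is again the derivative of tan. *)
Lemma outer_diff_cvg b : 0 <= b -> b < qp -> (fun N => outer_diff N b) @ \oo --> (0 : R).
Proof.
move=> b0 bq; have := @cmp_all R e c e1 (2 * m).-1 b b0 bq (base b0 bq).
rewrite (_ : (2 * m).-1.+1 = (2 * m)%N); last by lia.
move=> [eps eps0 h].
apply: (@cvg0_le _ _ (fun N => tan b * eps N)); last exact: cvg_scale.
move=> N; rewrite mulrC.
have sub : `[0, b]%classic `<=` `[0, qp]%classic.
  by move=> t /=; rewrite !in_itv /= => /andP[-> h']; exact: le_trans (ltW bq).
pose D' t := (phiy e (2 * m) (N + 2 * m) (tan t) - fourier c (2 * m) N t) * ((tan t)^-1 + tan t).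
apply: (@der_bound _ (outer_diff N) (fun t => eps N * tan t) D'
  (fun t => eps N * (1 + tan t ^+ 2)) b).
- move=> t tb; have tq : 0 < t < qp by lra.
  apply: (der_eq (derB (der_outer _ tq) (derD (derN (der_outer_fourier 1 N tq))
    (derZ (c / 2) (der_outer_fourier 2 N tq))))).
  by rewrite /D' /fourier; ring.
- by move=> t tb; apply: derZ; apply: der_tan_qp; lra.
- exact: continuous_subspaceW sub (@within_outer_diff N).
- apply: (der_within (f' := fun t => eps N * (1 + tan t ^+ 2))) => t tb.
  by apply: derZ; apply: der_tan_qp; lra.
- move=> t tb; have tb' : 0 <= t <= b by lra.
  have y0 : 0 < tan t by apply: tan_gt0; lra.
  have yy : 0 <= (tan t)^-1 + tan t by rewrite addr_ge0 ?invr_ge0 ?ltW.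
  rewrite /D' normrM [X in _ * X]ger0_norm //.
  apply: (le_trans (ler_wpM2r yy (h N t tb'))).
  by rewrite -mulrA mulrDr mulfV ?gt_eqF // -expr2.
- by rewrite /outer_diff outer_zero !outer_fourier_zero oppr0 mulr0 addr0 subrr normr0 tan0 mulr0.
- by rewrite b0 lexx.
Qed.

End Outer.

(** * Passing to the endpoint pi/4 *)

Section UniformCauchy.
Context {R : realType}.
Implicit Types (X Y : nat -> R -> R).

Lemma zero_qp : 0 <= (0 : R) <= qp.
Proof. by rewrite lexx ltW // qp_gt0. Qed.

Definition ucauchy X := forall eps : R, 0 < eps -> exists n0, forall n N t,
  (n0 <= n)%N -> (n0 <= N)%N -> 0 <= t <= qp -> `|X N t - X n t| <= eps.

(** An interchange of limits: for one fixed large index the function is small on [0, pi/4) by the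
    pointwise limit and the Cauchy bound, and small at pi/4 by its continuity; the Cauchy bound at
    pi/4 then covers all larger indices. *)
Lemma ucauchy_limit X : (forall N, {within `[0, qp], continuous (X N)}) -> ucauchy X ->
  (forall t, 0 <= t -> t < qp -> (fun N => X N t) @ \oo --> (0 : R)) ->
  (fun N => X N qp) @ \oo --> (0 : R).
Proof.
move=> cX uX hX; apply/cvgrPdist_le => eps eps0.
have [|n0 h] := uX (eps / 4); first by lra.
have small_t t : 0 <= t -> t < qp -> `|X n0 t| <= eps / 2.
  move=> t0 tq; have := hX t t0 tq => /cvgrPdist_le /(_ (eps / 4)) h4.
  have e4 : 0 < eps / 4 by lra.
  have [N1 _ hN1] := h4 e4.
  have hN := hN1 (maxn n0 N1) (leq_maxr _ _).
  have hn := h (maxn n0 N1) n0 t (leq_maxl _ _) (leqnn _) (ltac:(lra)).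
  move: hN hn; rewrite /= sub0r normrN => hN hn.
  have := ler_normD (X n0 t - X (maxn n0 N1) t) (X (maxn n0 N1) t).
  by rewrite subrK; lra.
have hq : `|X n0 qp| <= 3 * eps / 4.
  have [_ _] := (continuous_within_itvP (X n0) (@qp_gt0 R)).1 (cX n0).
  move=> /cvgrPdist_le /(_ (eps / 4)) h4.
  have e4 : 0 < eps / 4 by lra.
  near (@qp R)^'- => t.
  have tq : t < qp by near: t; exact: nbhs_left_lt.
  have t0 : 0 <= t by near: t; apply: nbhs_left_ge; exact: qp_gt0.
  have hqt : `|X n0 qp - X n0 t| <= eps / 4 by near: t; exact: h4.
  have := small_t t t0 tq; have := ler_normD (X n0 qp - X n0 t) (X n0 t).
  by rewrite subrK; lra.
exists n0 => // N /= hN; rewrite sub0r normrN.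
have := h n0 N qp (leqnn _) hN; rewrite lexx (ltW qp_gt0) => /(_ isT) h1.
have := ler_normD (X N qp - X n0 qp) (X n0 qp).
by rewrite subrK; lra.
Unshelve. all: by end_near. Qed.

Lemma cvg_cauchy (u : nat -> R) (l eps : R) : u @ \oo --> l -> 0 < eps ->
  exists n0, forall n N, (n0 <= n)%N -> (n0 <= N)%N -> `|u N - u n| <= eps.
Proof.
move=> /cvgrPdist_le /(_ (eps / 2)) h e0.
have [|n0 _ hn] := h; first by lra.
exists n0 => n N h1 h2; have := hn n h1; have := hn N h2; rewrite /= => a b.
rewrite (_ : u N - u n = (l - u n) - (l - u N)); last by ring.
by apply: (le_trans (ler_normB _ _)); lra.
Qed.

Lemma ucauchy_series (F : nat -> R -> R) (b : nat -> R) (C : R) :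
  (forall k t, (0 < k)%N -> 0 <= t <= qp -> `|F k t| <= b k) ->
  (forall N, \sum_(1 <= k < N.+1) b k <= C) ->
  ucauchy (fun N t => \sum_(1 <= k < N.+1) F k t).
Proof.
move=> Fb bC eps e0.
have b0 k : (0 < k)%N -> 0 <= b k.
  by move=> k0; apply: le_trans (Fb k 0 k0 zero_qp).
have [|l hl] := @cvg_dominated _ b b C _ bC; first by move=> k k0; rewrite ger0_norm ?b0.
have [n0 h] := cvg_cauchy hl e0.
have main n N t : (n0 <= n)%N -> (n <= N)%N -> 0 <= t <= qp ->
    `|\sum_(1 <= k < N.+1) F k t - \sum_(1 <= k < n.+1) F k t| <= eps.
  move=> hn nN tq; apply: le_trans (h n N hn (leq_trans hn nN)).
  rewrite (@big_cat_nat _ _ _ n.+1 1 N.+1) //= addrAC subrr add0r.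
  rewrite [in leRHS](@big_cat_nat _ _ _ n.+1 1 N.+1) //= [in leRHS]addrAC subrr add0r.
  apply: (le_trans (ler_norm_sum _ _ _)); apply: le_trans (ler_norm _).
  rewrite [leLHS]big_nat [leRHS]big_nat; apply: ler_sum => k /andP[k0 _].
  by apply: Fb => //; lia.
exists n0 => n N t hn hN tq; case: (leqP n N) => nN; first exact: main.
by rewrite distrC; apply: main => //; exact: ltnW.
Qed.

Lemma ucauchyD X Y : ucauchy X -> ucauchy Y -> ucauchy (fun N t => X N t + Y N t).
Proof.
move=> hX hY eps e0; have [|n1 h1] := hX (eps / 2); first by lra.
have [|n2 h2] := hY (eps / 2); first by lra.
exists (maxn n1 n2) => n N t; rewrite !geq_max => /andP[a1 a2] /andP[b1 b2] tq.
have := h1 n N t a1 b1 tq; have := h2 n N t a2 b2 tq.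
rewrite (_ : _ + _ - _ = (X N t - X n t) + (Y N t - Y n t)); last by ring.
by move=> ? ?; apply: (le_trans (ler_normD _ _)); lra.
Qed.

Lemma ucauchy_scale (u : nat -> R) (l : R) (f : R -> R) (C : R) : u @ \oo --> l ->
  (forall t, 0 <= t <= qp -> `|f t| <= C) -> ucauchy (fun N t => u N * f t).
Proof.
move=> ul fC eps e0; have C0 : 0 <= C.
  by apply: le_trans (fC 0 zero_qp).
have [|n0 h] := @cvg_cauchy u l (eps / (C + 1)) ul; first by rewrite divr_gt0 //; lra.
exists n0 => n N t hn hN tq; rewrite -mulrBl normrM.
apply: (@le_trans _ _ (eps / (C + 1) * C)); first by rewrite ler_pM ?h ?fC.
rewrite mulrAC ler_pdivrMr; last by lra.
by rewrite ler_wpM2l //; lra.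
Qed.

Lemma ucauchyZ (k : R) X : ucauchy X -> ucauchy (fun N t => k * X N t).
Proof.
move=> hX eps e0; have k0 : 0 < `|k| + 1 by have := normr_ge0 k; lra.
have [|n0 h] := hX (eps / (`|k| + 1)); first by rewrite divr_gt0.
exists n0 => n N t hn hN tq; rewrite -mulrBr normrM.
apply: (@le_trans _ _ (`|k| * (eps / (`|k| + 1)))); first by rewrite ler_wpM2l ?h.
rewrite mulrCA ler_piMr ?(ltW e0) // ler_pdivrMr //; lra.
Qed.

Lemma ucauchy_sum (r : seq nat) (X : nat -> nat -> R -> R) :
  (forall i, i \in r -> ucauchy (X i)) -> ucauchy (fun N t => \sum_(i <- r) X i N t).
Proof.
elim: r => [|i r IH] h eps e0.
  by exists 0%N => n N t _ _ _; rewrite !big_nil subrr normr0 ltW.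
have [||n0 hn] := @ucauchyD (X i) (fun N t => \sum_(j <- r) X j N t) _ _ eps e0.
- by apply: h; rewrite inE eqxx.
- by apply: IH => j jr; apply: h; rewrite inE jr orbT.
by exists n0 => n N t a b tq; rewrite !big_cons; exact: hn.
Qed.

Lemma ucauchy_shift X p : ucauchy X -> ucauchy (fun N t => X (N + p)%N t).
Proof.
move=> hX eps e0; have [n0 h] := hX eps e0; exists n0 => n N t hn hN.
by apply: h; lia.
Qed.

Lemma ucauchy_eq X Y : ucauchy Y -> (forall N t, X N t = Y N t) -> ucauchy X.
Proof.
move=> hY e eps e0; have [n0 h] := hY eps e0; exists n0 => n N t hn hN tq.
by rewrite !e; exact: h.
Qed.

End UniformCauchy.

Section Endpoint.
Context {R : realType}.
Variables (e : nat -> R) (c : R) (m : nat) (mf : nat -> R -> R).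
Hypothesis e1 : forall n, `|e n| <= 1.
Hypothesis m0 : (0 < m)%N.
Hypothesis mf0 : forall i, (0 < i)%N -> mf i 0 = 0.
Hypothesis mfC : forall i, (0 < i)%N -> {within `[0, qp], continuous (mf i)}.
Hypothesis mfD : forall i t, (0 < i)%N -> 0 < t < qp -> is_derive t 1 (mf i) (mint i t).
Hypothesis base : forall b, 0 <= b -> b < qp ->
  small b (fun N t => phiy e 0 (N + 0) (tan t) - fourier c 0 N t).

Lemma mf_bound i t : (0 < i)%N -> 0 <= t <= qp -> `|mf i t| <= 1.
Proof.
move=> i0 tq; apply: (@le_trans _ _ (t ^+ 2)).
  apply: (@der_bound _ (mf i) (fun t => t ^+ 2) (mint i) (fun t => 2%:R * t ^+ 1 * 1) qp).
  - by move=> x hx; exact: mfD.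
  - by move=> x _; apply: derX.
  - exact: mfC.
  - by apply: (der_within (f' := fun t => 2%:R * t ^+ 1 * 1)) => x _; apply: derX.
  - by move=> x hx; rewrite expr1 mulr1; apply: mint_bound => //; lra.
  - by rewrite mf0 // normr0 expr0n.
  - exact: tq.
by have := @qp_lt1 R => q1; apply: exprn_ile1; lra.
Qed.

Definition outer_coef (kk i : nat) : R :=
  (-1) ^+ i / (2 * i)`!%:R * (2 * kk%:R) ^+ (2 * i) * kk%:R ^- (2 * m).

(** The factor k^(2i) of the Taylor coefficient lowers the exponent 2m+1 to 2m-2i+1, so exchanging
    the sums over k and i leaves alternating single sums. For i = m this is the conditionally
    convergent series of - log 2, which is why it is kept as a sequence times a fixed function. *)
Lemma outer_fourierE kk N t : outer_fourier m mf kk N t =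
  kk%:R ^- (2 * m) * (\sum_(1 <= k < N.+1) alt k * iq (kk * k) t / k%:R ^+ (2 * m).+1) -
  \sum_(1 <= i < m.+1) outer_coef kk i * (hs alt (2 * m - 2 * i).+1 N * mf i t).
Proof.
rewrite /outer_fourier /outer_term.
have -> : \sum_(1 <= i < m.+1) outer_coef kk i * (hs alt (2 * m - 2 * i).+1 N * mf i t) =
   \sum_(1 <= k < N.+1) \sum_(1 <= i < m.+1)
     outer_coef kk i * (alt k / k%:R ^+ (2 * m - 2 * i).+1 * mf i t).
  by rewrite exchange_big; apply: eq_bigr => i _; rewrite /hs mulr_suml mulr_sumr.
rewrite mulr_sumr -sumrB; apply: eq_big_nat => k /andP[k0 _].
have kR : k%:R != 0 :> R by rewrite pnatr_eq0 -lt0n.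
rewrite !mulrBr; congr (_ - _).
  by rewrite exprMn exprS /alt !invfM; ring.
rewrite !mulr_sumr; apply: eq_big_nat => i /andP[i0 im].
rewrite /outer_coef /alt [(2 * kk%:R * k%:R) ^+ _]exprMn.
have -> : k%:R ^+ (2 * i) = k%:R ^+ (2 * m).+1 / k%:R ^+ (2 * m - 2 * i).+1 :> R.
  have -> : (2 * m).+1 = (2 * i + (2 * m - 2 * i).+1)%N by lia.
  by rewrite exprD mulfK // expf_neq0.
rewrite exprMn invfM exprS.
have := expf_neq0 (2 * m) kR; move: (k%:R ^+ (2 * m) : R) => z z0.
transitivity ((-1) ^+ k * ((z * z^-1) * (k%:R^-1 * k%:R)) * (kk%:R ^- (2 * m) *
  ((-1) ^+ i / (2 * i)`!%:R * (2 * kk%:R) ^+ (2 * i) / k%:R ^+ (2 * m - 2 * i).+1 * mf i t))).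
  by ring.
by rewrite mulfV // mulVf //; ring.
Qed.

Lemma ucauchy_outer_fourier kk : ucauchy (outer_fourier m mf kk).
Proof.
have h1 : ucauchy (fun N (t : R) =>
    \sum_(1 <= k < N.+1) alt k * iq (kk * k) t / k%:R ^+ (2 * m).+1).
  apply: (@ucauchy_series _ _ (fun k => 4 * kk%:R * k%:R ^- 2) (4 * kk%:R * 2)); last first.
    by move=> N; rewrite -mulr_sumr ler_wpM2l // sum_inv_sqr_le.
  move=> k t k0 tq; have kR : 0 < k%:R :> R by rewrite ltr0n.
  rewrite -mulrA; apply: norm_mul_le1; first exact: alt_le1.
  rewrite normrM [X in _ * X]ger0_norm ?invr_ge0 ?exprn_ge0 //.
  apply: (@le_trans _ _ (4 * (kk * k)%:R / k%:R ^+ (2 * m).+1)).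
    by rewrite ler_wpM2r ?invr_ge0 ?exprn_ge0 // iq_bound.
  rewrite natrM !mulrA -mulrA ler_wpM2l // ler_pdivrMr ?exprn_gt0 // ler_pdivlMl ?exprn_gt0 //.
  by rewrite -exprSr ler_weXn2l ?ler1n //; lia.
have h2 : ucauchy (fun N t =>
    \sum_(1 <= i < m.+1) outer_coef kk i * (hs alt (2 * m - 2 * i).+1 N * mf i t)).
  apply: (ucauchy_sum (X := fun i N t =>
    outer_coef kk i * (hs alt (2 * m - 2 * i).+1 N * mf i t))) => i.
  rewrite mem_index_iota => /andP[i0 _].
  apply: (@ucauchyZ _ _ (fun N t => hs alt (2 * m - 2 * i).+1 N * mf i t)).
  have [l _ hl] := @limin_alt R (2 * m - 2 * i).+1 (ltn0Sn _).
  by apply: (ucauchy_scale hl (C := 1)) => t; exact: mf_bound.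
apply: ucauchy_eq (ucauchyD (ucauchyZ (kk%:R ^- (2 * m)) h1) (ucauchyZ (-1) h2)) _ => N t.
by rewrite outer_fourierE mulN1r.
Qed.

Lemma ucauchy_outer : ucauchy (outer e m).
Proof.
apply: (@ucauchy_series _ _ (fun n => `|al e (2 * m) n| / n%:R ^+ 2) (2 ^+ (2 * m) * 2)); last first.
  by move=> N; exact: al_summable.
move=> n t n0 tq; rewrite -mulrA; apply: norm_mul_le1; first exact: norm_sg.
rewrite mulrA normrM [X in _ * X]ger0_norm ?invr_ge0 ?exprn_ge0 // ler_wpM2r ?invr_ge0 ?exprn_ge0 //.
rewrite normrM ler_piMr // normrX exprn_ile1 // ger0_norm ?tan_ge0 // tan_le1 //.
Qed.

Lemma outer_diff_end : (fun N => outer_diff e c m mf N qp) @ \oo --> (0 : R).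
Proof.
apply: ucauchy_limit.
- by move=> N; exact: within_outer_diff.
- have h1 := ucauchy_shift (2 * m) ucauchy_outer.
  have h2 := ucauchy_outer_fourier 1.
  have h3 := ucauchyZ (- (c / 2)) (ucauchy_outer_fourier 2).
  apply: ucauchy_eq (ucauchyD h1 (ucauchyD h2 h3)) _ => N t.
  by rewrite /outer_diff; ring.
- by move=> t t0 tq; apply: outer_diff_cvg.
Qed.

Lemma outer_end N : outer e m N qp = \sum_(1 <= n < N.+1) sg n * al e (2 * m) n / n%:R ^+ 2.
Proof.
by rewrite /outer; apply: eq_bigr => n _; rewrite tan_qp expr1n mul1r.
Qed.

Lemma iq_end1 : iq 1 qp = - ln 2 :> R.
Proof.
have tq : 0 <= (qp : R) <= qp by rewrite lexx ltW // qp_gt0.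
have ct := cos_gt0_qp tq; have := cos2_tan2 (lt0r_neq0 ct).
rewrite tan_qp expr1n => h.
have -> : 2 = cos qp ^- 2 :> R by rewrite h; ring.
by rewrite lnV ?posrE ?exprn_gt0 // lnXn // opprK /=; ring.
Qed.

Lemma iq_endS k : iq k.+2 qp = iq k qp + 2 * (kap k.+1 - 1) / k.+1%:R :> R.
Proof. by rewrite /= cos_qp. Qed.

Hypothesis mfR : forall i, (0 < i)%N -> Ralg (mf i qp).

Lemma outer_fourier_in (M : set R) kk : qspace M ->
  limin M (fun N => \sum_(1 <= k < N.+1) alt k * iq (kk * k) qp / k%:R ^+ (2 * m).+1) ->
  limin M (fun N => outer_fourier m mf kk N qp).
Proof.
move=> hM h; have n2 n := @israt_nat R n.
have h1 := liminZ hM (isratV (isratX (2 * m) (n2 kk))) h.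
have h2 : limin M (fun N => \sum_(1 <= i < m.+1)
    outer_coef kk i * (hs alt (2 * m - 2 * i).+1 N * mf i qp)).
  apply: (limin_sum hM) => i; rewrite mem_index_iota => /andP[i0 _] _.
  apply: (liminZ hM).
    apply: isratM; last by apply: isratV; apply: isratX.
    apply: isratM; last by apply: isratX; apply: isratM.
    apply: isratM; last by apply: isratV.
    by apply: isratX; apply: isratN; exact: israt1.
  case: hM => hR _ _; apply: (limin_sub hR); apply: liminM; first exact: limin_alt.
  by apply: limin_cst; exact: mfR.
by apply: limin_eq (liminB hM h1 h2) _ => N; rewrite outer_fourierE.
Qed.

(** The comparison reaches the power series only along the truncations N + 2m; its absolute
    convergence at y = 1 identifies the limit over all truncations. *)
Lemma outer_in (M : set R) : qspace M ->
  limin M (fun N => outer_fourier m mf 1 N qp) ->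
  limin M (fun N => c / 2 * outer_fourier m mf 2 N qp) ->
  limin M (fun N => \sum_(1 <= n < N.+1) sg n * al e (2 * m) n / n%:R ^+ 2).
Proof.
move=> hM h1 h2.
have h : limin M (fun N => outer e m (N + 2 * m) qp).
  apply: limin_diff (liminD hM (liminN hM h1) h2) _.
  exact: outer_diff_end.
have [l hl] : exists l : R, (fun N => outer e m N qp) @ \oo --> l.
  have hl := @cvg_dominated _ (fun n => sg n * al e (2 * m) n / n%:R ^+ 2)
    (fun n => `|al e (2 * m) n| / n%:R ^+ 2) (2 ^+ (2 * m) * 2) _ (al_summable e1 (2 * m)).
  have [|l hl'] := hl.
    move=> n n0; rewrite -mulrA; apply: norm_mul_le1; first exact: norm_sg.
    by rewrite normrM [X in _ * X]ger0_norm ?invr_ge0 ?exprn_ge0.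
  by exists l; apply: eq_cvgn hl' _ => N; rewrite outer_end.
case: h => k Mk hk; exists k => //.
have -> : k = l.
  apply: (cvgn_unique hk); apply: (cvg_sub (s := fun N => (N + 2 * m)%N) _ hl) => n.
  exact: leq_addr.
by apply: eq_cvgn hl _ => N; rewrite outer_end.
Qed.

End Endpoint.

(** * Sums over decreasing chains *)

Section Chains.
Context {R : realType}.
Implicit Types (w : nat -> nat -> R).

Fixpoint nest (K : nat) w (x : nat) {struct K} : R :=
  if K is k.+1 then \sum_(0 <= y < x) w 0 y * nest k (fun i => w i.+1) y else 1.

Lemma nestS k w x : nest k.+1 w x = \sum_(0 <= y < x) w 0 y * nest k (fun i => w i.+1) y.
Proof. by []. Qed.

Definition chain (N K : nat) (n : {ffun 'I_K -> 'I_N}) : bool :=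
  [forall i : 'I_K, forall j : 'I_K, (i < j)%N ==> (n j < n i)%N].

Definition cons_ffun (N K : nat) (p : 'I_N * {ffun 'I_K -> 'I_N}) : {ffun 'I_K.+1 -> 'I_N} :=
  [ffun i => if unlift ord0 i is Some j then p.2 j else p.1].

Definition uncons_ffun (N K : nat) (n : {ffun 'I_K.+1 -> 'I_N}) : 'I_N * {ffun 'I_K -> 'I_N} :=
  (n ord0, [ffun j => n (lift ord0 j)]).

Lemma cons_ffun0 N K (p : 'I_N * {ffun 'I_K -> 'I_N}) : cons_ffun p ord0 = p.1.
Proof. by rewrite ffunE unlift_none. Qed.

Lemma cons_ffunS N K (p : 'I_N * {ffun 'I_K -> 'I_N}) j : cons_ffun p (lift ord0 j) = p.2 j.
Proof. by rewrite ffunE liftK. Qed.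

Lemma cons_ffunK N K : cancel (@cons_ffun N K) (@uncons_ffun N K).
Proof.
move=> [y g]; rewrite /uncons_ffun cons_ffun0; congr (_, _).
by apply/ffunP => j; rewrite ffunE cons_ffunS.
Qed.

Lemma uncons_ffunK N K : cancel (@uncons_ffun N K) (@cons_ffun N K).
Proof.
move=> n; apply/ffunP => i; case: (unliftP ord0 i) => [j ->|->].
  by rewrite cons_ffunS ffunE.
by rewrite cons_ffun0.
Qed.

Lemma chain_cons N K (y : 'I_N) (g : {ffun 'I_K -> 'I_N}) x :
  chain (cons_ffun (y, g)) && [forall i, (cons_ffun (y, g) i < x)%N] =
  (y < x)%N && (chain g && [forall i, (g i < y)%N]).
Proof.
apply/idP/idP.
  move=> /andP[/forallP hc /forallP hx].
  have yx : (y < x)%N by have := hx ord0; rewrite cons_ffun0.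
  rewrite yx /=; apply/andP; split.
    apply/forallP => i; apply/forallP => j; apply/implyP => ij.
    have /forallP/(_ (lift ord0 j))/implyP := hc (lift ord0 i).
    by rewrite !cons_ffunS; apply; rewrite !lift0 ltnS.
  apply/forallP => i; have /forallP/(_ (lift ord0 i))/implyP := hc ord0.
  by rewrite cons_ffunS cons_ffun0; apply; rewrite lift0.
move=> /and3P[yx /forallP hc /forallP hg]; apply/andP; split.
  apply/forallP => i; apply/forallP => j; apply/implyP.
  case: (unliftP ord0 i) => [i' ->|->]; case: (unliftP ord0 j) => [j' ->|->] //.
    by rewrite !cons_ffunS !lift0 ltnS => ij; have /forallP/(_ j')/implyP := hc i'; apply.
  by rewrite cons_ffunS cons_ffun0.
apply/forallP => i; case: (unliftP ord0 i) => [i' ->|->]; rewrite ?cons_ffunS ?cons_ffun0 //=.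
exact: ltn_trans (hg i') yx.
Qed.

(** The bound x is there for the induction: deleting the largest entry y of a chain leaves a chain
    bounded by y. *)
Lemma sum_chain_bounded N K w x : (x <= N)%N ->
  \sum_(n : {ffun 'I_K -> 'I_N} | chain n && [forall i, (n i < x)%N])
    \prod_(i < K) w i (n i) = nest K w x.
Proof.
elim: K w x => [|K IH] w x xN /=.
  rewrite (eq_bigl predT) => [|n]; last first.
    by apply/andP; split; [apply/forallP => -[]|apply/forallP => -[]].
  under eq_bigr do rewrite big_ord0.
  by rewrite sumr_const card_ffun !card_ord expn0.
rewrite (reindex (@cons_ffun N K)) /=; last first.
  by exists (@uncons_ffun N K) => p _; [exact: cons_ffunK|exact: uncons_ffunK].
rewrite (eq_bigl (fun p : 'I_N * {ffun 'I_K -> 'I_N} => (p.1 < x)%N && (chain p.2 && [forall i, (p.2 i < p.1)%N]))); last first.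
  by move=> [y g]; rewrite chain_cons.
rewrite -(pair_big_dep (fun y : 'I_N => (y < x)%N)
  (fun y (g : {ffun 'I_K -> 'I_N}) => chain g && [forall i, (g i < y)%N])
  (fun y g => \prod_(i < K.+1) w i (cons_ffun (y, g) i))) /=.
rewrite big_mkord (big_ord_widen N (fun y => w 0 y * nest K (fun i => w i.+1) y) xN).
apply: eq_bigr => y _; rewrite -(IH (fun i => w i.+1) y (ltnW (ltn_ord y))) mulr_sumr.
apply: eq_bigr => g _; rewrite big_ord_recl cons_ffun0; congr (_ * _).
by apply: eq_bigr => i _; rewrite cons_ffunS lift0.
Qed.

Lemma sum_chain N K w :
  \sum_(n : {ffun 'I_K -> 'I_N} | chain n) \prod_(i < K) w i (n i) = nest K w N.
Proof.
rewrite -(sum_chain_bounded K w (leqnn N)); apply: eq_bigl => n.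
by rewrite (_ : [forall i, _] = true) ?andbT //; apply/forallP => i; exact: ltn_ord.
Qed.

End Chains.

(** * The S values as nested sums *)

Section SValues.
Context {R : realType}.
Variables (e : nat -> R) (m : nat).
Hypothesis m0 : (0 < m)%N.

(** The parity conditions become zero weights, and positivity comes from 0^-1 = 0; of the conditions
    on the index tuples only the chain condition remains for [nest]. *)
Definition weight (i x : nat) : R :=
  if odd x == odd i then
    (if i == 0%N then sg x else 1) * (if i == (2 * m)%N then e x else 1) *
    (if i == 0%N then x%:R ^- 2 else x%:R^-1)
  else 0.

Lemma weight_prod N (n : {ffun 'I_(2 * m).+1 -> 'I_N.+1}) :
  \prod_(i < (2 * m).+1) weight i (n i) =
  if [forall i, 0 < n i]%N && [forall i, odd (n i) == odd i]
  then sg (n ord0) * e (n ord_max) / S_denom n else 0.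
Proof.
case: (boolP (_ && _)) => [/andP[/forallP hpos /forallP hodd]|].
  under eq_bigr => i _ do rewrite /weight (hodd i).
  rewrite !big_split /=; congr (_ * _ * _).
  - by rewrite (bigD1 ord0) //= big1 ?mulr1 // => i /negbTE; rewrite -val_eqE /= => ->.
  - rewrite (bigD1 ord_max) //= eqxx big1 ?mulr1 // => i /negbTE; rewrite -val_eqE /= => ->.
    by [].
  rewrite /S_denom invfM -prodfV [LHS](bigD1 ord0) //=.
  congr (_ * _); apply: eq_bigr => i /negbTE; rewrite -val_eqE /= => ->.
  by [].
rewrite negb_and => /orP[] /forallPn [i hi]; rewrite (bigD1 i) //= /weight.
  have -> : n i = 0%N :> nat by move: hi; rewrite lt0n negbK => /eqP.
  by case: eqP => _; rewrite ?mul0r //; case: ifP => _; rewrite ?expr0n ?invr0 ?mulr0 ?mul0r.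
by rewrite (negbTE hi) mul0r.
Qed.

Lemma alS j n : al e j.+1 n =
  if odd n == odd j.+1 then 2 * \sum_(0 <= y < n) al e j y / y%:R else 0.
Proof. by rewrite -sum0_sum1. Qed.

Lemma S_sum_nest N :
  \sum_(n : {ffun 'I_(2 * m).+1 -> 'I_N.+1} | S_index n)
    (sg (n ord0) * e (n ord_max) / S_denom n) = nest (2 * m).+1 weight N.+1.
Proof.
rewrite -sum_chain big_mkcond [RHS]big_mkcond; apply: eq_bigr => n _.
rewrite weight_prod /S_index /chain.
by case: [forall i, _ < _]%N; case: [forall i, forall j, _]; case: [forall i, _ == _].
Qed.

(** [al] is built from the innermost index and [nest] from the outermost, so level j matches the
    weights at positions 2m - j to 2m. The outermost position, with its square and its sign, is
    excluded by j < 2m. *)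
Lemma nest_al j x : (j < 2 * m)%N ->
  al e j x / x%:R = 2 ^+ j * (weight (2 * m - j) x * nest j (fun i => weight (i + (2 * m - j).+1)) x).
Proof.
elim: j x => [|j IH] x jm.
  rewrite subn0 expr0 mul1r /= mulr1 /weight eqxx oddM /= gtn_eqF; last by lia.
  by case: (odd x) => /=; rewrite ?mul0r // mul1r.
have IH' := fun y => IH y (ltnW jm).
rewrite alS nestS.
under eq_bigr do rewrite IH'.
rewrite -mulr_sumr [weight (2 * m - j.+1) x]/weight.
rewrite (_ : odd (2 * m - j.+1) = ~~ odd j); last by lia.
case: ifP => _; last by rewrite !mul0r mulr0.
rewrite (_ : (2 * m - j.+1 == 0)%N = false); last by lia.
rewrite (_ : (2 * m - j.+1 == 2 * m)%N = false); last by lia.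
rewrite (_ : \sum_(0 <= y < x) weight (0 + (2 * m - j.+1).+1) y * _ =
  \sum_(0 <= y < x) weight (2 * m - j) y *
    nest j (fun i => weight (i + (2 * m - j).+1)) y); last first.
  apply: eq_bigr => y _.
  rewrite (_ : (0 + (2 * m - j.+1).+1)%N = (2 * m - j)%N); last by lia.
  by congr (_ * nest _ _ _); apply/funext => i; congr weight; lia.
by rewrite exprS; ring.
Qed.

Lemma nest_al_top N : nest (2 * m).+1 weight N.+1 =
  2 ^- (2 * m) * \sum_(1 <= n < N.+1) sg n * al e (2 * m) n / n%:R ^+ 2.
Proof.
rewrite nestS big_ltn // {1}/weight /= expr0n invr0 !mulr0 mul0r add0r.
rewrite mulr_sumr; apply: eq_bigr => n _.
rewrite [weight 0 n]/weight /=; case: ifP => on; last first.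
  rewrite al_parity ?mulr0 ?mul0r ?mulr0 ?mul0r //.
  by move: on; rewrite oddM /=; case: (odd n).
rewrite (_ : (0 == 2 * m)%N = false); last by lia.
have -> : al e (2 * m) n = 2 ^+ (2 * m) * nest (2 * m) (fun i => weight i.+1) n.
  have -> : (2 * m = (2 * m).-1.+1)%N by lia.
  rewrite alS nestS ifT; last by move: on => /= /eqP ->; lia.
  rewrite exprS -mulrA; congr (_ * _).
  rewrite mulr_sumr; apply: eq_bigr => y _.
  rewrite nest_al; last by lia.
  rewrite (_ : (2 * m - (2 * m).-1)%N = 1%N); last by lia.
  by congr (_ * (_ * nest _ _ _)); apply/funext => i; rewrite addn2.
have h2 : 2 ^- (2 * m) * 2 ^+ (2 * m) = 1 :> R by rewrite mulVf // expf_neq0 // pnatr_eq0.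
move: h2; move: (2 ^+ (2 * m) : R) (nest _ _ _) => b c h2.
transitivity (b^-1 * b * (sg n / n%:R ^+ 2 * c)); last by ring.
by rewrite h2; ring.
Qed.

End SValues.

(** * Assembly of the two memberships *)

Section Conclusion.
Context {R : realType}.
Variable m : nat.
Hypothesis m0 : (0 < m)%N.

Local Notation hQ := (@Ralg_qspace R).

Lemma S_value (e : nat -> R) (M : set R) : qspace M ->
  limin M (fun N => \sum_(1 <= n < N.+1) sg n * al e (2 * m) n / n%:R ^+ 2) ->
  M (2 ^+ (2 * m).+1 * limn (fun N =>
    \sum_(n : {ffun 'I_(2 * m).+1 -> 'I_N.+1} | S_index n)
      (sg (n ord0) * e (n ord_max) / S_denom n : R))).
Proof.
move=> hM h; have q2 : israt (2 ^- (2 * m) : R) by apply: isratV; apply: isratX; exact: israt_nat.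
have h2 := liminZ hM q2 h.
case: (hM) => _ _; apply; first by apply: isratX; exact: israt_nat.
apply: limin_lim; apply: limin_eq h2 _ => N.
by rewrite S_sum_nest nest_al_top.
Qed.

Lemma mint_primitives : exists mf : nat -> R -> R, forall i, (0 < i)%N ->
  [/\ mf i 0 = 0, {within `[0, qp], continuous (mf i)} &
    forall t, 0 < t < qp -> is_derive t 1 (mf i) (mint i t)].
Proof.
have : forall i, exists M : R -> R, (0 < i)%N -> [/\ M 0 = 0, {within `[0, qp], continuous M} &
    forall t, 0 < t < qp -> is_derive t 1 M (mint i t)].
  by case=> [|i]; [exists (fun=> 0)|have [M hM] := @mint_primitive R i.+1 (ltn0Sn i); exists M].
by move=> /choice [mf h]; exists mf.
Qed.

Local Notation Mz := (sumset Ralg (Qline (zeta_bar (2 * m + 1) 1 : R))).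

Lemma Mz_qspace : qspace Mz. Proof. exact: qspace_line hQ. Qed.

Lemma lsum_in_Mz : limin Mz (lsum (2 * m).+1 alt triv).
Proof.
have [|l hl] := @lsum_cvg R (2 * m).+1 alt triv _ alt_le1 triv_le1; first by lia.
exists l => //; have -> : l = zeta_bar (2 * m + 1) 1.
  symmetry; apply/cvg_lim => //; apply: eq_cvgn hl _ => N.
  by rewrite -zb_lsum /zb addn1.
exact: sumset_r hQ.
Qed.

Lemma fourier1_in (M : set R) mf : qspace M -> limin M (lsum (2 * m).+1 alt triv) ->
  (forall i, (0 < i)%N -> Ralg (mf i qp)) ->
  limin M (fun N => outer_fourier m mf 1 N qp).
Proof.
move=> hM hz hR; apply: outer_fourier_in => //.
apply: limin_eq (@sum_altI_in R (2 * m).+1 M hM _ hz (fun k => iq k qp) _ iq_end1 (@iq_endS R)) _ => //.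
  by lia.
by move=> N; apply: eq_bigr => k _; rewrite mul1n.
Qed.

Lemma S_ones_in : Mz (S_2bar_ones m).
Proof.
have [mf hmf] := mint_primitives.
have mf0 i : (0 < i)%N -> mf i 0 = 0 by move=> /hmf [].
have mfC i : (0 < i)%N -> {within `[0, qp], continuous (mf i)} by move=> /hmf [].
have mfD i t : (0 < i)%N -> 0 < t < qp -> is_derive t 1 (mf i) (mint i t) by move=> /hmf [_ _]; apply.
have mfR i : (0 < i)%N -> Ralg (mf i qp).
  by move=> i0; apply: (mint_Ralg i0 (mf0 i i0) (mfC i i0)) => t; exact: mfD.
have hM := Mz_qspace.
have h : limin Mz (fun N => \sum_(1 <= n < N.+1) sg n * al triv (2 * m) n / n%:R ^+ 2).
  apply: (@outer_in R triv 0 m mf triv_le1 m0 mf0 mfC mfD (@small_triv R) Mz hM).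
    exact: fourier1_in lsum_in_Mz mfR.
  by apply: limin_eq (limin0 hM (@cvgn_cst R 0)) _ => N; rewrite !mul0r.
rewrite /S_2bar_ones (_ : (fun N => _) = fun N =>
    \sum_(n : {ffun 'I_(2 * m).+1 -> 'I_N.+1} | S_index n)
      (sg (n ord0) * triv (n ord_max) / S_denom n : R)); first exact: S_value hM h.
by apply/funext => N; apply: eq_bigr => n _; rewrite mulr1.
Qed.

Lemma wval_W : wval (2 * m).+1 = W m :> R.
Proof. by rewrite /wval /W addn2. Qed.

Lemma S_ones_1bar_in : sumset Mz (Qline (W m)) (S_2bar_ones_1bar m).
Proof.
have [mf hmf] := mint_primitives.
have mf0 i : (0 < i)%N -> mf i 0 = 0 by move=> /hmf [].
have mfC i : (0 < i)%N -> {within `[0, qp], continuous (mf i)} by move=> /hmf [].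
have mfD i t : (0 < i)%N -> 0 < t < qp -> is_derive t 1 (mf i) (mint i t) by move=> /hmf [_ _]; apply.
have mfR i : (0 < i)%N -> Ralg (mf i qp).
  by move=> i0; apply: (mint_Ralg i0 (mf0 i i0) (mfC i i0)) => t; exact: mfD.
have q2 : (2 < (2 * m).+1)%N by lia.
have hM : qspace (sumset Mz (Qline (W m))) by apply: qspace_line; exact: Mz_qspace.
have hz : limin (sumset Mz (Qline (W m))) (lsum (2 * m).+1 alt triv).
  exact: limin_sub (@sumset_l R _ _) lsum_in_Mz.
have hk : limin (sumset Mz (Qline (W m))) (lsum (2 * m).+1 kap od).
  by rewrite -wval_W; exact: lsum_kap_od_in Mz_qspace lsum_in_Mz.
have h2 : limin (sumset Mz (Qline (W m))) (fun N => outer_fourier m mf 2 N qp).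
  apply: outer_fourier_in => //.
  have qr : israt (- 2 ^+ (2 * m).+2 : R) by apply: isratN; apply: isratX; exact: israt_nat.
  have hk2 := limin_comp (s := fun N => (2 * N)%N) (ltac:(by move=> n; lia)) hk.
  apply: limin_eq (liminZ hM qr hk2) _ => N.
  by rewrite -(@sum_altI2 R (2 * m).+1 (fun k => iq k qp) (erefl _) iq_end1 (@iq_endS R)).
have h : limin (sumset Mz (Qline (W m)))
    (fun N => \sum_(1 <= n < N.+1) sg n * al sg (2 * m) n / n%:R ^+ 2).
  apply: (@outer_in R sg 1 m mf (@norm_sg R) m0 mf0 mfC mfD (@small_sg R) _ hM).
    exact: fourier1_in hz mfR.
  by apply: (liminZ hM) h2; exact: israt_half 1.
exact: S_value hM h.
Qed.

End Conclusion.

Theorem theorem4 (m : nat) (hm : (1 <= m)%N) :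
  sumset Ralg (Qline (zeta_bar (2 * m + 1) 1))
    (S_2bar_ones m : Rdefinitions.R) /\
  sumset (sumset Ralg (Qline (zeta_bar (2 * m + 1) 1))) (Qline (W m))
    (S_2bar_ones_1bar m : Rdefinitions.R).
Proof. by split; [exact: S_ones_in|exact: S_ones_1bar_in]. Qed.
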